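(* Let $\gamma:S^1\to\mathbb{R}^2$ be a closed Lipschitz curve. For $0<\varepsilon\le1$ let $\gamma_\varepsilon(t)=(\gamma(t),\varepsilon\cos t,\varepsilon\sin t)\in\mathbb{R}^4$ be the lifted Jordan curves, and let $\gamma_0(t)=(\gamma(t),0,0)$. For each $0<\varepsilon\le1$ let $u_\varepsilon:\overline{D^2}\to\mathbb{R}^4$ be a Douglas minimizer spanning $\gamma_\varepsilon$, the family $\{u_\varepsilon\}$ being normalized by the three-point condition. Then there exist a sequence $\varepsilon_j\downarrow0$ and a map $u_0:\overline{D^2}\to\mathbb{R}^4$ belonging to $W^{1,2}(D^2)\cap C(\overline{D^2})$ such that $$u_{\varepsilon_j}\rightharpoonup u_0\ \text{ weakly in }W^{1,2}(D^2),\qquad u_{\varepsilon_j}\to u_0\ \text{ strongly in }L^2(D^2),$$ $$u_{\varepsilon_j}\to u_0\ \text{ uniformly on every compact } K\subset\subset D^2.$$ Moreover, the boundary trace of $u_0$ satisfies $$u_0|_{\partial D^2}=\gamma_0\circ\phi_0,$$ where $\phi_0:S^1\to S^1$ is a monotone parametrization.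
   Context: $D^2$ is the (open) unit disk in $\mathbb{R}^2$, $\partial D^2=S^1$, and $S^1=\{(\cos t,\sin t):t\in[0,2\pi)\}$ is parametrized by the angle $t$. For every $\varepsilon>0$ the lifted curve $\gamma_\varepsilon$ is injective on $S^1$, hence a Jordan curve in $\mathbb{R}^4$. Monotone parametrization: a (not necessarily continuous) map $\phi_0:S^1\to S^1$ of the form $e^{i\theta}\mapsto e^{i\varphi(\theta)}$, $\theta\in[0,2\pi)$, where $\varphi:[0,2\pi)\to\mathbb{R}$ is a monotone function with $\sup\varphi-\inf\varphi\le2\pi$ (after a rotation of the circle, $\varphi$ takes values in $[0,2\pi]$, with $2\pi$ identified with $0$). Spanning and Douglas minimizers: a map $u:\overline{D^2}\to\mathbb{R}^4$, continuous on $\overline{D^2}$ and in $W^{1,2}(D^2)$, spans the Jordan curve given by $\gamma_\varepsilon$ if $u|_{\partial D^2}=\gamma_\varepsilon\circ\phi$ for some continuous, surjective, weakly monotone map $\phi:S^1\to S^1$. A Douglas minimizer spanning it is a spanning map $u$ that is harmonic and (weakly) conformal in $D^2$ and minimizes area among all spanning maps; equivalently it minimizes the Dirichlet energy $\mathscr{E}(u)=\frac12\int_{D^2}|\nabla u|^2$ among them. Three-point condition: three distinct points $e^{i\theta_1},e^{i\theta_2},e^{i\theta_3}\in\partial D^2$ and three distinct points $p_1,p_2,p_3\in S^1$ (in the same cyclic order) with $\gamma(p_1),\gamma(p_2),\gamma(p_3)$ distinct are fixed independently of $\varepsilon$, and $u_\varepsilon(e^{i\theta_k})=\gamma_\varepsilon(p_k)$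 for $k=1,2,3$ and all $0<\varepsilon\le1$. (This can be arranged by precomposing with Möbius transformations of the disk.) *)

(* Defs.v *)
From HB Require Import structures.
From mathcomp Require Import all_boot all_order all_algebra.
From mathcomp Require Import all_classical all_reals all_analysis.

Set Implicit Arguments.
Unset Strict Implicit.
Unset Printing Implicit Defensive.

Import Order.TTheory GRing.Theory Num.Theory.
Import numFieldNormedType.Exports.

Local Open Scope classical_set_scope.
Local Open Scope ring_scope.

Section Definitions.
Variable R : realType.

Local Notation plane := (R * R)%type.
Local Notation space := 'rV[R]_4.

Definition disk : set plane := [set x | x.1 ^+ 2 + x.2 ^+ 2 < 1].
Definition cdisk : set plane := [set x | x.1 ^+ 2 + x.2 ^+ 2 <= 1].
Definition circle : set plane := [set x | x.1 ^+ 2 + x.2 ^+ 2 = 1].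

(* e^{it} *)
Definition circ (t : R) : plane := (cos t, sin t).

Definition axis (i : 'I_2) : plane := ((i == 0)%:R, (i == 1)%:R).

Definition area_measure : {measure set (measurableTypeR R * measurableTypeR R)
    -> \bar R} :=
  (@lebesgue_measure R \x @lebesgue_measure R)%E.
Local Notation mu := area_measure.

(* The norms of R * R and 'rV[R]_4 in the library are sup norms; all metric
   quantities on R^4 below are built from the Euclidean product. *)
Definition dot (a b : space) : R := \sum_(k < 4) a 0 k * b 0 k.
Definition sqnorm (a : space) : R := dot a a.

(* C^k on the set A, which is meant to be open *)
Fixpoint Ck_on (V : normedModType R) (A : set plane) (k : nat)
    (f : plane -> V) : Prop :=
  (forall x, A x -> {for x, continuous f}) /\
  (if k is k'.+1 then
     forall i, (forall x, A x -> derivable f x (axis i)) /\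
               Ck_on A k' (fun x => 'D_(axis i) f x)
   else True).

(* C_c^oo(D^2), with test functions extended by 0 to the plane *)
Definition test_function (h : plane -> R) : Prop :=
  [/\ forall k, Ck_on (V := R^o) setT k h,
      compact (closure [set x | h x != 0]) &
      closure [set x | h x != 0] `<=` disk].

Definition in_L2 (f : plane -> R) : Prop :=
  f \_ disk \in Lfun mu 2%:E.

Definition weak_partial (f : plane -> R) (i : 'I_2) (g : plane -> R) : Prop :=
  forall h, test_function h ->
    \int[mu]_(x in disk) (f x * 'D_(axis i) (h : plane -> R^o) x) =
    - \int[mu]_(x in disk) (g x * h x).

(* f is in W^{1,2}(D^2) and G is (a representative of) its weak gradient *)
Definition W12_grad (f : plane -> space) (G : 'I_2 -> plane -> space) : Prop :=
  forall k : 'I_4,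
    in_L2 (fun x => f x 0 k) /\
    forall i : 'I_2, in_L2 (fun x => G i x 0 k) /\
      weak_partial (fun x => f x 0 k) i (fun x => G i x 0 k).

Definition W12 (f : plane -> space) : Prop := exists G, W12_grad f G.

Definition W12_norm (f : plane -> space) (G : 'I_2 -> plane -> space) : R :=
  Num.sqrt (\int[mu]_(x in disk)
    (sqnorm (f x) + \sum_(i < 2) sqnorm (G i x))).

(* An element of the dual of W^{1,2}(D^2), as a functional on representatives:
   boundedness forces its value to depend only on the a.e. class. *)
Definition W12_dual (L : (plane -> space) -> R) : Prop :=
  (forall (a : R) f g, W12 f -> W12 g ->
     L (fun x => a *: f x + g x) = a * L f + L g) /\
  (exists C : R, forall f G, W12_grad f G -> `|L f| <= C * W12_norm f G).

Definition W12_weak_cvg (f : nat -> plane -> space) (f0 : plane -> space) :=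
  forall L, W12_dual L -> L (f j) @[j --> \oo] --> L f0.

Definition L2_cvg (f : nat -> plane -> space) (f0 : plane -> space) :=
  (\int[mu]_(x in disk) (sqnorm (f j x - f0 x))%:E)%E @[j --> \oo] --> 0%E.

Definition harmonic_on_disk (u : plane -> space) : Prop :=
  Ck_on disk 2 u /\
  forall x, disk x ->
    \sum_(i < 2) 'D_(axis i) (fun y => 'D_(axis i) u y) x = 0.

Definition conformal_on_disk (u : plane -> space) : Prop :=
  forall x, disk x ->
    sqnorm ('D_(axis 0) u x) = sqnorm ('D_(axis 1) u x) /\
    dot ('D_(axis 0) u x) ('D_(axis 1) u x) = 0.

(* Area of a map with weak gradient G: the integral of |G_0 /\ G_1|. *)
Definition area (G : 'I_2 -> plane -> space) : \bar R :=
  (\int[mu]_(x in disk)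
    (Num.sqrt (sqnorm (G 0 x) * sqnorm (G 1 x) - dot (G 0 x) (G 1 x) ^+ 2))%:E)%E.

Definition angle_values (w : R -> R) : set (\bar R) :=
  [set (w t)%:E | t in [set t | t \in `[0, 2 * pi[]].

(* phi (e^{it}) = e^{i w(t)}; the oscillation is computed in \bar R, so that
   the bound also says that w is bounded. *)
Definition monotone_param (phi : plane -> plane) : Prop :=
  exists w : R -> R,
    [/\ {in `[0, 2 * pi[ &, nondecreasing_fun w} \/
        {in `[0, 2 * pi[ &, nonincreasing_fun w},
        (ereal_sup (angle_values w) - ereal_inf (angle_values w)
           <= (2 * pi)%:E)%E &
        forall t, t \in `[0, 2 * pi[ -> phi (circ t) = circ (w t)].

(* Maps out of S^1 are total functions on the plane; only their values on the
   circle matter.  A weakly monotone map of S^1 is one of the form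
   monotone_param, in either orientation. *)
Definition spans (c : plane -> space) (u : plane -> space) : Prop :=
  [/\ {within cdisk, continuous u}, W12 u &
      exists phi : plane -> plane,
        [/\ {within circle, continuous phi}, set_surj circle circle phi,
            monotone_param phi &
            forall x, circle x -> u x = c (phi x)]].

(* Weak gradients are unique a.e., so the choice of G and H is immaterial. *)
Definition douglas_minimizer (c : plane -> space) (u : plane -> space) : Prop :=
  [/\ spans c u, harmonic_on_disk u, conformal_on_disk u &
      forall v G H, spans c v -> W12_grad u G -> W12_grad v H ->
        (area G <= area H)%E].

(* The lifted curve (gamma, eps cos t, eps sin t) at p = (cos t, sin t). *)
Definition lifted (gamma : plane -> plane) (eps : R) (p : plane) : space :=
  \row_(k < 4) [:: (gamma p).1; (gamma p).2; eps * p.1; eps * p.2]`_k.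

(* e^{ia}, e^{ib}, e^{ic} are met in this order counterclockwise,
   for angles a, b, c in [0, 2 pi[ *)
Definition ccw (a b c : R) : Prop :=
  [\/ a < b /\ b < c, b < c /\ c < a | c < a /\ a < b].

(* The prescribed points are e^{i theta k} and p_k = e^{i tau k}. *)
Definition three_points (gamma : plane -> plane) (theta tau : 'I_3 -> R)
  : Prop :=
  [/\ forall k, 0 <= theta k < 2 * pi /\ 0 <= tau k < 2 * pi,
      injective theta, injective tau,
      injective (fun k => gamma (circ (tau k))) &
      ccw (theta 0) (theta 1) (theta 2%:R) <-> ccw (tau 0) (tau 1) (tau 2%:R)].

End Definitions.

(* Main.v *)
Require Import Defs.
From HB Require Import structures.
From mathcomp Require Import all_boot all_order all_algebra.
From mathcomp Require Import all_classical all_reals all_analysis.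
From mathcomp Require Import measurable_realfun.
From mathcomp Require Import ring lra.

(** The minimizers are harmonic, hence Poisson integrals of their traces, and
    these traces are reparametrizations of the lifted curves by monotone maps of
    the circle.  The compactness of the family is therefore that of a family of
    monotone functions, and all the convergence statements come from explicit
    properties of the Poisson kernel.

    Energy.  Shrinking the last two coordinates of u 1 by eps gives a map that
    spans the lifted curve of parameter eps and has no more energy than u 1.
    Since u eps minimizes area and is conformal, its energy is its area, which is
    at most that of this competitor: the energies are bounded (energy_bound).

    Selection.  A monotone parametrization lifts to an orientation and to a
    nondecreasing function W with W (t + 2 pi) = W t + 2 pi
    (monotone_param_lift).  By Helly's principle a sequence of such lifts
    converges outside a countable set to a function w of the same kind (helly).
    The traces then converge boundedly almost everywhere, hence in L^1 of the
    circle, to g0 = gamma_0 (e^{i s w(t)}), where s is the limit orientation.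
    As the Poisson kernel and its derivatives are bounded on smaller disks, the
    minimizers and their gradients converge locally uniformly to the Poisson
    integral u0 of g0 (poisson_unif, poisson1_unif), whose energy is finite by
    Fatou's lemma (poisson1_energy).

    Continuity up to the boundary.  The function w may jump, but g0 does not.
    At a jump of g0 the tangential derivative of its Poisson integral would be at
    least c/s on a square of side s/4 at distance about s from the jump, for
    every small s.  Each of these squares would carry at least a fixed amount of
    energy, although they shrink to a boundary point (jump_gradient, no_jump).
    Hence the curve takes the same value at both ends of every jump of w, the
    data g0 are continuous (finite_energy_continuous), and u0 extends
    continuously to the closed disk with trace g0.

    Weak convergence in W^{1,2}.  The components of the differences u_eps - u0
    and of their gradients are bounded in L^2 and tend to 0 locally uniformly.
    For an arbitrary bounded functional the conclusion follows from a Banach-Saks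
    argument (weak_cvg0).  Strong convergence in L^2 is dominated convergence.

    The definitions speak of weak gradients, of which the classical gradient of a
    harmonic map is one: this rests on integration by parts (weak_partial_C1)
    and on the fundamental lemma of the calculus of variations
    (fundamental_lemma), for which test functions are built as expressions in
    the functions x^-m exp(-1/x). *)

Set Implicit Arguments.
Unset Strict Implicit.
Unset Printing Implicit Defensive.

Import Order.TTheory GRing.Theory Num.Theory.
Import numFieldNormedType.Exports.

Local Open Scope classical_set_scope.
Local Open Scope ring_scope.

(** * Topology and measure in the plane *)

Section PlaneMeasure.
Variable R : realType.
Local Notation plane := (R * R)%type.
Local Notation mplane := (measurableTypeR R * measurableTypeR R)%type.
Local Notation mu := (@area_measure R).

(** The product sigma-algebra is generated by products of Borel sets, so an
    open set has to be exhibited as a countable union of products: here, of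
    the squares with rational centre and side 2/(n+1) that it contains. *)
Lemma plane_open_measurable (U : set plane) :
  open U -> measurable (U : set mplane).
Proof.
move=> oU.
pose box (i : rat * rat * nat) : set plane :=
  ball (ratr i.1.1 : R) (i.2.+1%:R^-1) `*` ball (ratr i.1.2 : R) (i.2.+1%:R^-1).
have -> : U = \bigcup_(i in [set i | box i `<=` U]) box i.
  apply/seteqP; split => [x Ux|x [i /= iU xi]]; last exact: iU.
  have /nbhs_ballP[e /= e0 xeU] := open_nbhs_nbhs (conj oU Ux).
  have [n ne] : exists n : nat, (n.+1%:R^-1 : R) < e / 2.
    have e20 : 0 < e / 2 by rewrite divr_gt0.
    have := near_infty_natSinv_lt (PosNum e20).
    by move=> [n _ /(_ n (leqnn n))] ?; exists n.
  have n0 : (0 : R) < n.+1%:R^-1 by rewrite invr_gt0.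
  have q (y : R) : exists q : rat, ball y (n.+1%:R^-1) (ratr q).
    have [|h [yh [q _ qh]]] := @dense_rat R (ball y (n.+1%:R^-1)) _ (ball_open y _).
      by exists y; exact: ballxx.
    by exists q; rewrite qh.
  have [q1 x1] := q x.1; have [q2 x2] := q x.2.
  exists (q1, q2, n); last by split; apply: ball_sym.
  move=> y [/= y1 y2]; apply: xeU; split => /=; apply: (@le_ball _ _ _ (n.+1%:R^-1 + n.+1%:R^-1)).
  - by rewrite (splitr e) lerD// ltW.
  - exact: ball_triangle x1 y1.
  - by rewrite (splitr e) lerD// ltW.
  - exact: ball_triangle x2 y2.
rewrite bigcup_mkcond; apply: countable_bigcupT_measurable; first exact: countableP.
move=> [[q1 q2] n]; case: ifPn => // _.
by apply: measurableX; apply: open_measurable; exact: ball_open.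
Qed.

Lemma plane_continuous_measurable (U : set plane) (f : plane -> R) : open U ->
  (forall x, U x -> {for x, continuous f}) ->
  measurable_fun (U : set mplane) (f : mplane -> measurableTypeR R).
Proof.
move=> oU cf; apply: (measurability _ (RGenOpens.measurableE R)).
move=> _ [_ [a [b ->] <-]].
apply: plane_open_measurable; rewrite openE => x [Ux /= fx].
apply: filterI; first exact: open_nbhs_nbhs.
apply: cf => //; exact: open_nbhs_nbhs.
Qed.

Lemma sqn_continuous : continuous (fun x : plane => x.1 ^+ 2 + x.2 ^+ 2).
Proof.
move=> x; apply: cvgD; rewrite ?expr2.
  by apply: (@cvgM _ _ _ _ (fun x : plane => x.1) (fun x : plane => x.1)); exact: cvg_fst.
by apply: (@cvgM _ _ _ _ (fun x : plane => x.2) (fun x : plane => x.2)); exact: cvg_snd.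
Qed.

Lemma open_disk : open (@disk R).
Proof.
have -> : @disk R = (fun x => x.1 ^+ 2 + x.2 ^+ 2) @^-1` [set y | y < 1] by [].
apply: open_comp; last exact: open_lt.
by move=> x _; exact: sqn_continuous.
Qed.

Lemma measurable_disk : measurable (@disk R : set mplane).
Proof. by apply: plane_open_measurable; exact: open_disk. Qed.

Lemma disk_bound (x : plane) : cdisk x -> `|x.1| <= 1 /\ `|x.2| <= 1.
Proof.
rewrite /cdisk /= => x1; split; rewrite -(@ler_sqr R) ?nnegrE// expr1n real_normK ?num_real//; nra.
Qed.

Lemma disk_cdisk : @disk R `<=` @cdisk R.
Proof. by move=> x /ltW. Qed.

Definition box : set plane := `[-1, 1] `*` `[-1, 1].

Lemma measurable_box : measurable (box : set mplane).
Proof. exact: measurableX. Qed.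

Lemma cdisk_box : @cdisk R `<=` box.
Proof.
move=> x /disk_bound[]; rewrite !ler_norml => h1 h2.
by split; rewrite /= in_itv.
Qed.

Lemma box_finite : (mu box < +oo)%E.
Proof.
have -> : mu box =
    (@lebesgue_measure R [set` `[(-1)%R, 1%R]%R] * @lebesgue_measure R [set` `[(-1)%R, 1%R]%R])%E.
  exact: product_measure1E.
by rewrite lebesgue_measure_itv /= lte_fin; case: ifPn; rewrite ?mul0e ?ltry// -EFinD -EFinM ltry.
Qed.

Lemma disk_finite : (mu (@disk R) < +oo)%E.
Proof.
apply: le_lt_trans box_finite; apply: le_measure; rewrite ?inE//.
- exact: measurable_disk.
- exact: measurable_box.
- by move=> x /disk_cdisk/cdisk_box.
Qed.

Lemma compact_cdisk : compact (@cdisk R).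
Proof.
have c1 : closed (@cdisk R).
  have -> : @cdisk R = (fun x => x.1 ^+ 2 + x.2 ^+ 2) @^-1` [set y | y <= 1] by [].
  apply: closed_comp; last exact: closed_le.
  by move=> x _; exact: sqn_continuous.
have cS : compact box by apply: compact_setX; exact: segment_compact.
exact: (subclosed_compact c1 cS cdisk_box).
Qed.

End PlaneMeasure.

(** * Rational kernels on the disk *)

Section PoissonKernel.
Variable R : realType.
Local Notation plane := (R * R)%type.

Lemma is_derive_fst (x v : plane) : is_derive x v (fst : plane -> R) v.1.
Proof.
have lf : linear (fst : plane -> R) by [].
pose f : {linear plane -> R} := HB.pack (fst : plane -> R) (GRing.isLinear.Build _ _ _ _ _ lf).
have cf : continuous (f : plane -> R) by move=> y; exact: cvg_fst.
apply: DeriveDef; first by apply: diff_derivable; exact: (@linear_differentiable _ _ _ f).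
by rewrite deriveE ?(@diff_lin _ _ _ f)//; exact: (@linear_differentiable _ _ _ f).
Qed.

Lemma is_derive_snd (x v : plane) : is_derive x v (snd : plane -> R) v.2.
Proof.
have lf : linear (snd : plane -> R) by [].
pose f : {linear plane -> R} := HB.pack (snd : plane -> R) (GRing.isLinear.Build _ _ _ _ _ lf).
have cf : continuous (f : plane -> R) by move=> y; exact: cvg_snd.
apply: DeriveDef; first by apply: diff_derivable; exact: (@linear_differentiable _ _ _ f).
by rewrite deriveE ?(@diff_lin _ _ _ f)//; exact: (@linear_differentiable _ _ _ f).
Qed.

(** Partial derivatives in the plane are reduced to derivatives of functions
    of one variable, for which the mean value theorem, the fundamental theorem
    of calculus and differentiation under the integral are available. *)
Lemma is_derive_line (f : plane -> R) (x v : plane) (d : R) :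
  is_derive x v f d <-> is_derive (0 : R) (1 : R) (fun h : R => f (x + h *: v)) d.
Proof.
have E : (fun h : R => f (x + h *: v)) = (fun h => f (h *: v + x)).
  by apply/funext => h; rewrite addrC.
rewrite E.
have E2 : 'D_v f x = 'D_1 (fun h : R => f (h *: v + x)) 0.
  rewrite /derive; set a := (fun h => _); set b := (X in _ = lim (X @ _)).
  suff -> : a = b by []; apply/funext => h; rewrite /a /b /=.
  by rewrite addr0 scale0r add0r [h *: 1]mulr1.
split=> -[df <-]; apply: DeriveDef.
- by move/derivable1P : df.
- by rewrite E2.
- by apply/derivable1P.
- by rewrite -E2.
Qed.

Definition sqn (x : plane) : R := x.1 ^+ 2 + x.2 ^+ 2.

(** The squared distance |e^{it} - x|^2. *)
Definition den (x : plane) (t : R) : R := (cos t - x.1) ^+ 2 + (sin t - x.2) ^+ 2.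

Lemma denE x t : den x t = 1 - 2 * (cos t * x.1 + sin t * x.2) + sqn x.
Proof. by rewrite /den /sqn; have := cos2Dsin2 t; nra. Qed.

(** The distance from x to the circle is 1 - |x|, and 1 - |x| is at least
    (1 - |x|^2) / 2. *)
Lemma den_ge x t : sqn x <= 1 -> (1 - sqn x) ^+ 2 / 4 <= den x t.
Proof.
move=> q1; rewrite denE; set p := cos t * x.1 + sin t * x.2; set q := sqn x in q1 *.
have q0 : 0 <= q by rewrite /q /sqn addr_ge0// sqr_ge0.
have pq : p ^+ 2 <= q.
  have := sqr_ge0 (cos t * x.2 - sin t * x.1); have := cos2Dsin2 t.
  by rewrite /p /q /sqn; nra.
(* S is an upper bound for 2 sqrt q, hence for 2 p. *)
set S := 1 + q - (1 - q) ^+ 2 / 4.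
have S0 : 0 <= S by rewrite /S; nra.
have Sq : 4 * q <= S ^+ 2.
  rewrite -subr_ge0 (_ : _ - _ = (1 - q) ^+ 2 * ((1 - q) / 2 + (1 - q) ^+ 2 / 16)).
    by apply: mulr_ge0; [exact: sqr_ge0|apply: addr_ge0; [lra|apply: mulr_ge0; [exact: sqr_ge0|lra]]].
  by rewrite /S; field.
suff : 2 * p <= S by rewrite /S; lra.
have [p0|p0] := leP p 0; first lra.
rewrite -ler_sqr ?nnegrE; [nra|lra|lra].
Qed.

Lemma den_gt0 x t : sqn x < 1 -> 0 < den x t.
Proof.
move=> q1; apply: lt_le_trans (den_ge t (ltW q1)).
by apply: mulr_gt0 => //; rewrite exprn_gt0// subr_gt0.
Qed.

(** Identifying the plane with the complex numbers,
    1 / (e^{it} - x) = Ak x t - i Bk x t. *)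
Definition Ak (x : plane) (t : R) : R := (cos t - x.1) / den x t.
Definition Bk (x : plane) (t : R) : R := (sin t - x.2) / den x t.

Lemma AkBk x t : sqn x < 1 -> Ak x t ^+ 2 + Bk x t ^+ 2 = (den x t)^-1.
Proof.
move=> q1; have := lt0r_neq0 (den_gt0 t q1); rewrite /Ak /Bk /den => h; field.
exact: h.
Qed.

Lemma is_derive_den x t (i : 'I_2) :
  is_derive x (axis R i) (den ^~ t)
    (- 2 * ((cos t - x.1) * (axis R i).1 + (sin t - x.2) * (axis R i).2)).
Proof.
rewrite /den.
have h1 := is_derive_fst x (axis R i).
have h2 := is_derive_snd x (axis R i).
by apply: is_derive_eq; rewrite /GRing.scale /=; ring.
Qed.

Lemma I2_ind (P : 'I_2 -> Prop) : P 0 -> P 1 -> forall i, P i.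
Proof.
move=> P0 P1 [[|[|//]] h].
- by rewrite (_ : Ordinal h = 0)//; exact: val_inj.
- by rewrite (_ : Ordinal h = 1)//; exact: val_inj.
Qed.

Lemma norm_axis i : `|axis R i| <= 1.
Proof.
elim/I2_ind: i; rewrite /Num.norm /= /ProdNormedZmodule.norm /=.
  by rewrite normr1 normr0 ge_max lexx ler01.
by rewrite normr1 normr0 ge_max lexx ler01.
Qed.

Lemma is_derive_div (V : normedModType R) (f g : V -> R) (x v : V) (df dg : R) :
  g x != 0 -> is_derive x v f df -> is_derive x v g dg ->
  is_derive x v (fun y => f y / g y) (df / g x - f x * dg / g x ^+ 2).
Proof.
move=> g0 hf hg.
have hV : is_derive x v (fun y => (g y)^-1) (- (g x) ^- 2 * dg).
  apply: DeriveDef; first by apply: derivableV => //; exact: ex_derive.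
  by rewrite deriveV//; have [_ ->] := hg.
have := @is_deriveM _ _ _ _ _ _ _ _ hf hV.
move/is_derive_eq; apply; rewrite /GRing.scale /=; field; exact: g0.
Qed.

(** This lemma and the next one are the real and imaginary parts of
    d/dx (e^{it} - x)^-1 = (e^{it} - x)^-2, and of its product by i. *)
Lemma is_derive_Ak x t (i : 'I_2) : sqn x < 1 ->
  is_derive x (axis R i) (Ak ^~ t)
   (if i == 0 then Ak x t ^+ 2 - Bk x t ^+ 2 else 2 * (Ak x t * Bk x t)).
Proof.
move=> x1.
have d0 := lt0r_neq0 (den_gt0 t x1).
have h1 : is_derive x (axis R i) (fun y : plane => cos t - y.1) (- (axis R i).1).
  have h := is_derive_fst x (axis R i).
  by apply: is_derive_eq; rewrite sub0r.
have h2 := is_derive_den x t i.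
have := @is_derive_div _ _ (den ^~ t) _ _ _ _ d0 h1 h2; move/is_derive_eq; apply.
elim/I2_ind: i {h1 h2}; rewrite /Ak /Bk /axis /=; move: d0; rewrite /den => d0; field; exact: d0.
Qed.

Lemma is_derive_Bk x t (i : 'I_2) : sqn x < 1 ->
  is_derive x (axis R i) (Bk ^~ t)
   (if i == 0 then 2 * (Ak x t * Bk x t) else Bk x t ^+ 2 - Ak x t ^+ 2).
Proof.
move=> x1.
have d0 := lt0r_neq0 (den_gt0 t x1).
have h1 : is_derive x (axis R i) (fun y : plane => sin t - y.2) (- (axis R i).2).
  have h := is_derive_snd x (axis R i).
  by apply: is_derive_eq; rewrite sub0r.
have h2 := is_derive_den x t i.
have := @is_derive_div _ _ (den ^~ t) _ _ _ _ d0 h1 h2; move/is_derive_eq; apply.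
elim/I2_ind: i {h1 h2}; rewrite /Ak /Bk /axis /=; move: d0; rewrite /den => d0; field; exact: d0.
Qed.

(** Kernels on disk x circle that are polynomial in e^{it} and in the real and
    imaginary parts of 1 / (e^{it} - x).  The class contains the Poisson kernel
    and is closed under differentiation in x, so that regularity and bounds
    have to be proved once, by induction on expressions. *)
Inductive kexpr :=
  | KCst of R | KCos | KSin | KA | KB | KAdd of kexpr & kexpr
  | KMul of kexpr & kexpr.

Fixpoint keval (e : kexpr) (x : plane) (t : R) : R :=
  match e with
  | KCst c => c | KCos => cos t | KSin => sin t
  | KA => Ak x t | KB => Bk x t
  | KAdd a b => keval a x t + keval b x t
  | KMul a b => keval a x t * keval b x t
  end.

Fixpoint kdiff (i : 'I_2) (e : kexpr) : kexpr :=
  match e with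
  | KCst _ | KCos | KSin => KCst 0
  | KA => if i == 0 then KAdd (KMul KA KA) (KMul (KCst (-1)) (KMul KB KB))
          else KMul (KCst 2) (KMul KA KB)
  | KB => if i == 0 then KMul (KCst 2) (KMul KA KB)
          else KAdd (KMul KB KB) (KMul (KCst (-1)) (KMul KA KA))
  | KAdd a b => KAdd (kdiff i a) (kdiff i b)
  | KMul a b => KAdd (KMul (kdiff i a) b) (KMul a (kdiff i b))
  end.

Lemma is_derive_keval e x t i : sqn x < 1 ->
  is_derive x (axis R i) (fun y => keval e y t) (keval (kdiff i e) x t).
Proof.
move=> x1; elim: e => [c||||||] /=.
- exact: is_derive_cst.
- exact: is_derive_cst.
- exact: is_derive_cst.
- have := is_derive_Ak t i x1; move/is_derive_eq; apply.
  by case: ifP => _ /=; ring.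
- have := is_derive_Bk t i x1; move/is_derive_eq; apply.
  by case: ifP => _ /=; ring.
- by move=> a iha b ihb; exact: is_deriveD.
- move=> a iha b ihb; have := @is_deriveM _ _ _ _ _ _ _ _ iha ihb.
  by move/is_derive_eq; apply; rewrite /GRing.scale /=; ring.
Qed.

Lemma AkBk_bound r x t : sqn x <= r -> r < 1 ->
  `|Ak x t| <= 2 / (1 - r) /\ `|Bk x t| <= 2 / (1 - r).
Proof.
move=> xr r1; have x1 := le_lt_trans xr r1.
have E := AkBk t x1.
have h : (den x t)^-1 <= (2 / (1 - r)) ^+ 2.
  rewrite expr_div_n -[leRHS]invrK lef_pV2 ?posrE ?den_gt0 ?invr_gt0 ?divr_gt0 ?exprn_gt0 ?subr_gt0//.
  rewrite invf_div (le_trans _ (den_ge t (ltW x1)))// -natrX ler_pM2r ?invr_gt0//.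
  rewrite ler_sqr ?nnegrE; lra.
have c0 : 0 <= 2 / (1 - r) by rewrite divr_ge0// subr_ge0 ltW.
by split; rewrite -ler_sqr ?nnegrE// real_normK ?num_real//; apply: le_trans h;
  rewrite -E ?lerDl ?lerDr sqr_ge0.
Qed.

Lemma keval_bound e r : r < 1 ->
  exists2 C, 0 <= C & forall x t, sqn x <= r -> `|keval e x t| <= C.
Proof.
move=> r1.
have c0 : 0 <= 2 / (1 - r) by rewrite divr_ge0// subr_ge0 ltW.
elim: e => [c||||||] /=.
- by exists `|c|.
- by exists 1 => // x t _; rewrite cos_max.
- by exists 1 => // x t _; rewrite sin_max.
- by exists (2 / (1 - r)) => // x t xr; have [] := AkBk_bound t xr r1.
- by exists (2 / (1 - r)) => // x t xr; have [] := AkBk_bound t xr r1.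
- move=> a [C C0 hC] b [D D0 hD]; exists (C + D); first exact: addr_ge0.
  by move=> x t xr; rewrite (le_trans (ler_normD _ _))// lerD// ?hC ?hD.
- move=> a [C C0 hC] b [D D0 hD]; exists (C * D); first exact: mulr_ge0.
  by move=> x t xr; rewrite normrM ler_pM// ?hC ?hD.
Qed.

(** The resolvent identity
    1/(e-x) - 1/(e-y) = (x - y) / ((e-x) (e-y)), in real coordinates; it gives
    Lipschitz bounds without any appeal to derivatives. *)
Lemma Ak_sub x y t : sqn x < 1 -> sqn y < 1 ->
  Ak x t - Ak y t = (x.1 - y.1) * (Ak x t * Ak y t - Bk x t * Bk y t)
                  + (x.2 - y.2) * (Ak x t * Bk y t + Bk x t * Ak y t).
Proof.
move=> x1 y1; have := lt0r_neq0 (den_gt0 t x1); have := lt0r_neq0 (den_gt0 t y1).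
rewrite /Ak /Bk /den => h1 h2; field; by rewrite h1 h2.
Qed.

Lemma Bk_sub x y t : sqn x < 1 -> sqn y < 1 ->
  Bk x t - Bk y t = (x.1 - y.1) * (Ak x t * Bk y t + Bk x t * Ak y t)
                  - (x.2 - y.2) * (Ak x t * Ak y t - Bk x t * Bk y t).
Proof.
move=> x1 y1; have := lt0r_neq0 (den_gt0 t x1); have := lt0r_neq0 (den_gt0 t y1).
rewrite /Ak /Bk /den => h1 h2; field; by rewrite h1 h2.
Qed.

Lemma norm_fst_le (z : plane) : `|z.1| <= `|z|.
Proof. by rewrite [leRHS]/Num.norm /= le_max lexx. Qed.

Lemma norm_snd_le (z : plane) : `|z.2| <= `|z|.
Proof. by rewrite [leRHS]/Num.norm /= le_max lexx orbT. Qed.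

Lemma keval_lip e r : r < 1 ->
  exists2 C, 0 <= C & forall x y t, sqn x <= r -> sqn y <= r ->
    `|keval e x t - keval e y t| <= C * `|x - y|.
Proof.
move=> r1.
set c := 2 / (1 - r).
have c0 : 0 <= c by rewrite divr_ge0// subr_ge0 ltW.
have bnd (x y : plane) (a b : R) : sqn x <= r -> sqn y <= r -> `|a| <= c ^+ 2 + c ^+ 2 ->
  `|b| <= c ^+ 2 + c ^+ 2 ->
  `|(x.1 - y.1) * a + (x.2 - y.2) * b| <= 4 * c ^+ 2 * `|x - y|.
  move=> xr yr ha hb; rewrite (le_trans (ler_normD _ _))// !normrM.
  have h1 := norm_fst_le (x - y); have h2 := norm_snd_le (x - y).
  rewrite (_ : 4 * _ * _ = `|x - y| * (c ^+ 2 + c ^+ 2) + `|x - y| * (c ^+ 2 + c ^+ 2)); last by ring.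
  by apply: lerD; apply: ler_pM.
have bAB x y t : sqn x <= r -> sqn y <= r ->
    `|Ak x t * Ak y t - Bk x t * Bk y t| <= c ^+ 2 + c ^+ 2 /\
    `|Ak x t * Bk y t + Bk x t * Ak y t| <= c ^+ 2 + c ^+ 2.
  move=> xr yr; have [a1 b1] := AkBk_bound t xr r1; have [a2 b2] := AkBk_bound t yr r1.
  rewrite -/c in a1 b1 a2 b2.
  move: (Ak x t) (Bk x t) (Ak y t) (Bk y t) a1 b1 a2 b2 => p q p' q' a1 b1 a2 b2.
  split; [apply: le_trans (ler_normB _ _) _|apply: le_trans (ler_normD _ _) _];
    by rewrite !normrM expr2; apply: lerD; apply: ler_pM.
elim: e => [k||||||] /=.
- by exists 0 => // x y t _ _; rewrite subrr normr0 mul0r.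
- by exists 0 => // x y t _ _; rewrite subrr normr0 mul0r.
- by exists 0 => // x y t _ _; rewrite subrr normr0 mul0r.
- exists (4 * c ^+ 2); first by rewrite mulr_ge0// sqr_ge0.
  move=> x y t xr yr; have [h1 h2] := bAB x y t xr yr.
  by rewrite Ak_sub ?(le_lt_trans _ r1)//; exact: bnd.
- exists (4 * c ^+ 2); first by rewrite mulr_ge0// sqr_ge0.
  move=> x y t xr yr; have [h1 h2] := bAB x y t xr yr.
  by rewrite Bk_sub ?(le_lt_trans _ r1)// -mulrN; apply: bnd => //; rewrite normrN.
- move=> a [C C0 hC] b [D D0 hD]; exists (C + D); first exact: addr_ge0.
  move=> x y t xr yr; rewrite opprD addrACA mulrDl (le_trans (ler_normD _ _))//.
  by rewrite lerD// ?hC ?hD.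
- move=> a [C C0 hC] b [D D0 hD].
  have [Ca Ca0 hCa] := keval_bound a r1; have [Cb Cb0 hCb] := keval_bound b r1.
  exists (C * Cb + Ca * D); first by rewrite addr_ge0// mulr_ge0.
  move=> x y t xr yr.
  rewrite (_ : _ - _ = (keval a x t - keval a y t) * keval b x t +
    keval a y t * (keval b x t - keval b y t)); last by ring.
  rewrite (le_trans (ler_normD _ _))// !normrM mulrDl lerD//.
    by rewrite mulrAC ler_pM// ?hC ?hCb.
  by rewrite -mulrA ler_pM// ?hCa ?hD.
Qed.

Lemma continuous_keval e x : sqn x < 1 -> continuous (keval e x).
Proof.
move=> x1.
have cden : continuous (den x).
  move=> t; rewrite /den; under eq_fun do rewrite !expr2.
  by apply: cvgD; apply: cvgM; apply: cvgB;
    try exact: cvg_cst; try exact: continuous_cos; exact: continuous_sin.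
elim: e => [k||||||] /=.
- by move=> ?; exact: cvg_cst.
- exact: continuous_cos.
- exact: continuous_sin.
- move=> t; apply: cvgM; first by apply: cvgB; [exact: continuous_cos|exact: cvg_cst].
  by apply: cvgV; [exact: lt0r_neq0 (den_gt0 t x1)|exact: cden].
- move=> t; apply: cvgM; first by apply: cvgB; [exact: continuous_sin|exact: cvg_cst].
  by apply: cvgV; [exact: lt0r_neq0 (den_gt0 t x1)|exact: cden].
- by move=> a ca b cb t; apply: cvgD; [exact: ca|exact: cb].
- by move=> a ca b cb t; apply: cvgM; [exact: ca|exact: cb].
Qed.

End PoissonKernel.

(** * Integrals of kernels against boundary data *)

Section PoissonIntegral.
Variable R : realType.
Local Notation plane := (R * R)%type.
Local Notation leb := (@lebesgue_measure R).
Local Notation period := ([set` `[0, 2 * pi[%R] : set R).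

Definition bounded_data (g : R -> R) :=
  measurable_fun period g /\ exists M, forall t, period t -> `|g t| <= M.

Definition kint (e : kexpr R) (g : R -> R) (x : plane) : R :=
  \int[leb]_(t in period) (keval e x t * g t).

Lemma period_finite : (leb period < +oo)%E.
Proof. by rewrite lebesgue_measure_itv /= lte_fin; case: ifPn; rewrite ?ltry. Qed.

Lemma measurable_period : measurable (period : set (measurableTypeR R)).
Proof. exact: measurable_itv. Qed.

Lemma bounded_integrable (f : R -> R) : measurable_fun period f ->
  (exists M, forall t, period t -> `|f t| <= M) ->
  leb.-integrable period (EFin \o f).
Proof.
move=> mf [M fM]; apply: measurable_bounded_integrable => //; first exact: period_finite.
exists M; split; first exact: num_real.
by move=> N MN t Tt /=; exact: le_trans (fM t Tt) (ltW MN).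
Qed.

Lemma measurable_keval e x : sqn x < 1 -> measurable_fun period (keval e x).
Proof.
move=> x1; apply: (@measurable_funS _ _ _ _ setT) => //.
by apply: continuous_measurable_fun; exact: continuous_keval.
Qed.

Lemma integrable_data g : bounded_data g -> leb.-integrable period (EFin \o g).
Proof. by move=> [mg gM]; exact: bounded_integrable. Qed.

Lemma integrable_kg e g x : bounded_data g -> sqn x < 1 ->
  leb.-integrable period (EFin \o (fun t => keval e x t * g t)).
Proof.
move=> [mg [M gM]] x1; apply: bounded_integrable.
  by apply: measurable_funM => //; exact: measurable_keval.
have [C C0 hC] := keval_bound e x1; exists (C * M) => t Tt.
by rewrite normrM ler_pM// ?hC ?gM.
Qed.

Lemma bounded_data_norm g : bounded_data g -> bounded_data (fun t => `|g t|).
Proof.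
move=> [mg [M gM]]; split; first exact: measurableT_comp.
by exists M => t Tt; rewrite normr_id gM.
Qed.

Lemma bounded_dataB g h : bounded_data g -> bounded_data h ->
  bounded_data (fun t => g t - h t).
Proof.
move=> [mg [M gM]] [mh [N hN]]; split; first exact: measurable_funB.
by exists (M + N) => t Tt; rewrite (le_trans (ler_normB _ _))// lerD ?gM ?hN.
Qed.

Lemma bounded_data_cst c : bounded_data (fun=> c).
Proof. by split => //; exists `|c|. Qed.

Lemma bounded_data_step (tau c1 c2 : R) : bounded_data (fun t => if t < tau then c1 else c2).
Proof.
split; last first.
  exists (`|c1| + `|c2|) => t _; case: ifP => _; by rewrite ?lerDl ?lerDr.
apply: (@measurable_funS _ _ _ _ setT) => //.
by apply: measurable_fun_ifT => //; apply: measurable_fun_ltr.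
Qed.

Lemma kintB e g h x : bounded_data g -> bounded_data h -> sqn x < 1 ->
  kint e (fun t => g t - h t) x = kint e g x - kint e h x.
Proof.
move=> bg bh x1; rewrite /kint -RintegralB//; try exact: integrable_kg.
by apply: eq_Rintegral => t _; rewrite mulrBr.
Qed.

Lemma kint_le e g x C : bounded_data g -> sqn x < 1 ->
  (forall t, `|keval e x t| <= C) ->
  `|kint e g x| <= C * \int[leb]_(t in period) `|g t|.
Proof.
move=> bg x1 hC.
have ig := integrable_data (bounded_data_norm bg).
have h := le_normr_Rintegral measurable_period (integrable_kg e bg x1).
apply: (le_trans h).
rewrite -RintegralZl//; apply: le_Rintegral => //.
- have := integrable_kg e bg x1 => /integrable_norm.
  by apply: eq_integrable => //.
- by have := integrableZl measurable_period C ig; apply: eq_integrable.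
- by move=> t _; rewrite normrM ler_wpM2r.
Qed.

Lemma sqn_near (x : plane) r : sqn x < r -> \forall y \near x, sqn y < r.
Proof.
move=> xr; have := @sqn_continuous R x; rewrite /continuous_at => /cvgr_lt.
exact.
Qed.

Lemma continuous_kint e g x : bounded_data g -> sqn x < 1 ->
  {for x, continuous (kint e g)}.
Proof.
move=> bg x1.
pose r := (1 + sqn x) / 2.
have xr : sqn x < r by rewrite /r; lra.
have r1 : r < 1 by rewrite /r; lra.
have [C C0 hC] := keval_lip e r1.
pose I := \int[leb]_(t in period) `|g t|.
have I0 : 0 <= I by apply: Rintegral_ge0.
have key y : sqn y < r -> `|kint e g x - kint e g y| <= C * `|x - y| * I.
  move=> yr; have y1 := lt_trans yr r1.
  rewrite /kint -RintegralB//; try exact: integrable_kg.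
  rewrite (_ : \int[leb]_(t in period) _ = \int[leb]_(t in period)
     ((keval e x t - keval e y t) * g t)); last first.
    by apply: eq_Rintegral => t _; rewrite mulrBl.
  have ii : leb.-integrable period (EFin \o (fun t => (keval e x t - keval e y t) * g t)).
    have := integrableB measurable_period (integrable_kg e bg x1) (integrable_kg e bg y1).
    by apply: eq_integrable => // t _ /=; rewrite mulrBl.
  have h := le_normr_Rintegral measurable_period ii.
  apply: (le_trans h).
  rewrite -RintegralZl//; last exact: integrable_data (bounded_data_norm bg).
  apply: le_Rintegral => //.
  - by have := integrable_norm ii; apply: eq_integrable.
  - have := integrableZl measurable_period (C * `|x - y|) (integrable_data (bounded_data_norm bg)).
    by apply: eq_integrable.
  - by move=> t _; rewrite normrM ler_wpM2r// hC// ltW.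
apply/cvgrPdist_le => eps eps0.
have h1 : \forall y \near x, sqn y < r by exact: sqn_near.
have h2 : \forall y \near x, `|x - y| < eps / (C * I + 1).
  apply: (@cvgr_dist_lt _ _ _ (nbhs x) _ id x) => //.
  by rewrite divr_gt0// ltr_wpDl// mulr_ge0.
near=> y; apply: le_trans (key y _) _; first by near: y.
rewrite mulrAC; have : `|x - y| <= eps / (C * I + 1) by apply: ltW; near: y.
have CI : 0 <= C * I by rewrite mulr_ge0.
rewrite ler_pdivlMr ?ltr_wpDl//; apply: le_trans.
by rewrite mulrC ler_wpM2l// lerDl.
Unshelve. all: by end_near. Qed.

Lemma axisE i (x : plane) h : x + h *: axis R i =
  (x.1 + h * (axis R i).1, x.2 + h * (axis R i).2).
Proof. by []. Qed.

Lemma is_derive_shift_line (f : plane -> R) (x v : plane) (l d : R) :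
  is_derive (x + l *: v) v f d -> is_derive l (1 : R) (fun h : R => f (x + h *: v)) d.
Proof.
have E : (fun h : R => h^-1 *: (f (h *: v + (x + l *: v)) - f (x + l *: v))) =
    (fun h : R => h^-1 *: (((fun h : R => f (x + h *: v)) (h *: (1 : R) + l)) - f (x + l *: v))).
  apply/funext => h; congr (_ *: (f _ - _)).
  by rewrite scalerDl [h *: (1 : R)]mulr1 addrCA.
move=> [df <-]; apply: DeriveDef.
  by move: df; rewrite /derivable E.
by rewrite /derive E.
Qed.

(** The kernels have bounded derivatives on a smaller disk, which dominates
    the difference quotients. *)
Lemma is_derive_kint e g x i : bounded_data g -> sqn x < 1 ->
  is_derive x (axis R i) (kint e g) (kint (kdiff i e) g x).
Proof.
move=> bg x1.
pose r := (1 + sqn x) / 2.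
have xr : sqn x < r by rewrite /r; lra.
have r1 : r < 1 by rewrite /r; lra.
have [C C0 hC] := keval_bound (kdiff i e) r1.
have [d d0 hd] : exists2 d : R, 0 < d & forall l, `]- d, d[%classic l -> sqn (x + l *: axis R i) < r.
  have h : \forall y \near x, sqn y < r by exact: sqn_near.
  move/nbhs_ballP: h => [d /= d0 hd]; exists d => // l; rewrite /= in_itv /= => ld.
  apply: hd; rewrite -ball_normE /= opprD addNKr normrN normrZ.
  apply: (@le_lt_trans _ _ `|l|); last by rewrite ltr_norml.
  by rewrite ler_piMr// norm_axis.
apply/is_derive_line.
pose f l t := keval e (x + l *: axis R i) t * g t.
have df l t : `]- d, d[%classic l -> is_derive l (1 : R) (f ^~ t) (keval (kdiff i e) (x + l *: axis R i) t * g t).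
  move=> ld; have l1 := lt_trans (hd l ld) r1.
  have h := is_derive_shift_line (is_derive_keval e t i l1).
  rewrite /f; apply: is_derive_eq; rewrite /GRing.scale /=; ring.
have I0 : `]- d, d[%classic 0 by rewrite /= in_itv /= oppr_lt0 d0.
have bg' := bg; case: bg' => mg [M gM].
have M0 : 0 <= `|M| by [].
have intf l : `]- d, d[%classic l -> leb.-integrable period (EFin \o f l).
  by move=> ld; apply: integrable_kg => //; exact: lt_trans (hd l ld) r1.
have derf l t : `]- d, d[%classic l -> period t -> derivable (f ^~ t) l 1.
  by move=> ld _; have [h _] := df l t ld; exact: h.
have G0 (t : R) : 0 <= C * `|M| by rewrite mulr_ge0.
have iG : leb.-integrable period (EFin \o (fun=> C * `|M|)).
  by apply: bounded_integrable => //; exists (C * `|M|) => t _; rewrite ger0_norm ?mulr_ge0.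
have E1 l t : `]- d, d[%classic l -> partial1of2 f l t = keval (kdiff i e) (x + l *: axis R i) t * g t.
  by move=> ld; rewrite partial1of2E; have [_ ->] := df l t ld.
have Gub l t : `]- d, d[%classic l -> period t -> `|partial1of2 f l t| <= C * `|M|.
  move=> ld Tt; rewrite E1// normrM ler_pM// ?hC//; first by rewrite ltW// hd.
  by rewrite (le_trans (gM t Tt))// ler_norm.
have := derivable_under_integral measurable_period I0 intf derf G0 iG Gub.
have := differentiation_under_integral measurable_period I0 intf derf G0 iG Gub.
rewrite derive1E => E2 dF.
have -> : (fun h : R => kint e g (x + h *: axis R i)) = (fun l => \int[leb]_(t in period) f l t) by [].
apply: DeriveDef => //; rewrite E2; apply: eq_Rintegral => t _.
by rewrite E1// scale0r addr0.
Qed.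

End PoissonIntegral.
Arguments measurable_period {R}.

(** * The Poisson integral *)

Section PoissonLimit.
Variable R : realType.
Local Notation plane := (R * R)%type.
Local Notation leb := (@lebesgue_measure R).
Local Notation period := ([set` `[0, 2 * pi[%R] : set R).

(** The real part of (e^{it} + x) / (e^{it} - x) = 2 e^{it} / (e^{it} - x) - 1. *)
Definition PK : kexpr R :=
  KAdd (KCst (-1)) (KMul (KCst 2) (KAdd (KMul (@KCos R) (@KA R)) (KMul (@KSin R) (@KB R)))).

Lemma PKE (x : plane) t : sqn x < 1 -> keval PK x t = (1 - sqn x) / den x t.
Proof.
move=> x1; have d0 := lt0r_neq0 (den_gt0 t x1).
rewrite /= /Ak /Bk.
have -> : 1 - sqn x = - den x t + 2 * (cos t * (cos t - x.1) + sin t * (sin t - x.2)).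
  by rewrite denE; have := cos2Dsin2 t; nra.
by field; exact: d0.
Qed.

Lemma PK_ge0 (x : plane) t : sqn x < 1 -> 0 <= keval PK x t.
Proof. by move=> x1; rewrite PKE// divr_ge0// ?ltW ?den_gt0// subr_gt0. Qed.

Lemma PK_harmonic (x : plane) t :
  keval (kdiff 0 (kdiff 0 PK)) x t + keval (kdiff 1 (kdiff 1 PK)) x t = 0.
Proof. by rewrite /=; ring. Qed.

(** The derivative of 1 / (e^{it} - x) in t is -i e^{it} / (e^{it} - x)^2, which
    up to a constant factor is the derivative in x of e^{it} / (e^{it} - x):
    the gradient in x of the Poisson kernel is an exact derivative in t.
    Consequently the gradient of the Poisson integral of a step function is
    known in closed form (kint_step0, kint_step1). *)
Lemma is_derive_Bk_t (x : plane) (t : R) : sqn x < 1 ->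
  is_derive t (1 : R) (Bk x) (keval (kdiff 0 PK) x t / 2).
Proof.
move=> x1; have d0 := lt0r_neq0 (den_gt0 t x1).
have hd : is_derive t (1 : R) (den x) (2 * (cos t * (sin t - x.2) - sin t * (cos t - x.1))).
  by rewrite /den; apply: is_derive_eq; rewrite /GRing.scale /=; ring.
have hn : is_derive t (1 : R) (fun t => sin t - x.2) (cos t).
  by apply: is_derive_eq; rewrite /GRing.scale /=; ring.
have := is_derive_div d0 hn hd; move/is_derive_eq; apply.
rewrite /= /Ak /Bk; move: d0; rewrite /den => d0; field; exact: d0.
Qed.

Lemma is_derive_Ak_t (x : plane) (t : R) : sqn x < 1 ->
  is_derive t (1 : R) (Ak x) (- (keval (kdiff 1 PK) x t / 2)).
Proof.
move=> x1; have d0 := lt0r_neq0 (den_gt0 t x1).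
have hd : is_derive t (1 : R) (den x) (2 * (cos t * (sin t - x.2) - sin t * (cos t - x.1))).
  by rewrite /den; apply: is_derive_eq; rewrite /GRing.scale /=; ring.
have hn : is_derive t (1 : R) (fun t => cos t - x.1) (- sin t).
  by apply: is_derive_eq; rewrite /GRing.scale /=; ring.
have := is_derive_div d0 hn hd; move/is_derive_eq; apply.
rewrite /= /Ak /Bk; move: d0; rewrite /den => d0; field; exact: d0.
Qed.

Lemma integrable_co (f : R -> R) (a b : R) : continuous f ->
  leb.-integrable [set` `[a, b[%R] (EFin \o f).
Proof.
move=> cf.
have ic : leb.-integrable [set` `[a, b]%R] (EFin \o f).
  apply: continuous_compact_integrable; first exact: segment_compact.
  exact: continuous_subspaceT.
by apply: integrableS ic => //; exact: subset_itv_co_cc.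
Qed.

Lemma FTC_co (F f : R -> R) (a b : R) : a <= b ->
  (forall t, is_derive t (1 : R) F (f t)) -> continuous f ->
  \int[leb]_(t in [set` `[a, b[%R]) f t = F b - F a.
Proof.
rewrite le_eqVlt => /predU1P[->|ab] dF cf.
  by rewrite set_itvco0 Rintegral_set0 subrr.
rewrite Rintegral_itv_bndo_bndc//; last first.
  exact: integrable_co.
have dF1 t : derivable F t 1 by have [h _] := dF t.
have cF : continuous F by move=> t; apply: differentiable_continuous; exact/derivable1_diffP.
rewrite /Rintegral (@continuous_FTC2 _ f F)//.
- exact: continuous_subspaceT.
- split => [t _//||]; [apply: cvg_at_right_filter|apply: cvg_at_left_filter]; exact: cF.
- by move=> t _; rewrite derive1E; have [_ ->] := dF t.
Qed.

Lemma kint_step e (x : plane) (F : R -> R) (tau c1 c2 : R) : sqn x < 1 ->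
  0 <= tau <= 2 * pi ->
  (forall t, is_derive t (1 : R) F (keval e x t)) ->
  kint e (fun t => if t < tau then c1 else c2) x =
  c1 * (F tau - F 0) + c2 * (F (2 * pi) - F tau).
Proof.
move=> x1 /andP[t0 t2] dF.
have ck := @continuous_keval _ e x x1.
have mI (a b : R) : leb.-integrable [set` `[a, b[%R] (EFin \o keval e x).
  exact: integrable_co.
have bs := bounded_data_step tau c1 c2.
have E : period = [set` `[0, tau[%R] `|` [set` `[tau, 2 * pi[%R].
  by apply: itv_bndbnd_setU; rewrite bnd_simp.
have ii := integrable_kg e bs x1.
rewrite /kint E Rintegral_setU//; last 2 first.
- by rewrite -E.
- apply/disj_setPS => y [/=]; rewrite !in_itv /= => /andP[_ yt] /andP[ty _].
  by rewrite ltNge ty in yt.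
congr (_ + _).
- rewrite -(@FTC_co F (keval e x))// -RintegralZl//.
  apply: eq_Rintegral => t; rewrite inE /= in_itv /= => /andP[_ ->].
  by rewrite mulrC.
- rewrite -(@FTC_co F (keval e x))// -RintegralZl//.
  apply: eq_Rintegral => t; rewrite inE /= in_itv /= => /andP[tt _].
  by rewrite ltNge tt mulrC.
Qed.

Lemma Bk_2pi (x : plane) : Bk x (2 * pi) = Bk x 0.
Proof. by rewrite /Bk /den mulr_natl cos2pi sin2pi cos0 sin0. Qed.

Lemma Ak_2pi (x : plane) : Ak x (2 * pi) = Ak x 0.
Proof. by rewrite /Ak /den mulr_natl cos2pi sin2pi cos0 sin0. Qed.

Lemma kint_step0 (x : plane) (tau c1 c2 : R) : sqn x < 1 -> 0 <= tau <= 2 * pi ->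
  kint (kdiff 0 PK) (fun t => if t < tau then c1 else c2) x =
  2 * (c2 - c1) * (Bk x 0 - Bk x tau).
Proof.
move=> x1 t2.
have dF t : is_derive t (1 : R) (fun t => 2 * Bk x t) (keval (kdiff 0 PK) x t).
  have h := is_derive_Bk_t t x1.
  by apply: is_derive_eq; rewrite /GRing.scale /=; field.
by rewrite (kint_step c1 c2 x1 t2 dF) Bk_2pi; ring.
Qed.

Lemma kint_step1 (x : plane) (tau c1 c2 : R) : sqn x < 1 -> 0 <= tau <= 2 * pi ->
  kint (kdiff 1 PK) (fun t => if t < tau then c1 else c2) x =
  - 2 * (c2 - c1) * (Ak x 0 - Ak x tau).
Proof.
move=> x1 t2.
have dF t : is_derive t (1 : R) (fun t => - 2 * Ak x t) (keval (kdiff 1 PK) x t).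
  have h := is_derive_Ak_t t x1.
  by apply: is_derive_eq; rewrite /GRing.scale /=; field.
by rewrite (kint_step c1 c2 x1 t2 dF) Ak_2pi; ring.
Qed.

Lemma derive0_cst (h : R -> R) (a : R) :
  (forall l, `|l| <= `|a| -> is_derive l (1 : R) h 0) -> h a = h 0.
Proof.
move=> dh.
have [a0|a0|->//] := ltgtP a 0.
- have [||c _] := @MVT _ h (fun=> 0) a 0 a0.
  + move=> l; rewrite in_itv /= => /andP[l1 l2]; apply: dh.
    by rewrite !ltr0_norm// lerN2 ltW.
  + apply: derivable_within_continuous => l; rewrite in_itv /= => /andP[l1 l2].
    have [|//] := dh l; rewrite !ler0_norm ?lerN2//; exact: ltW.
  + by rewrite mul0r => /eqP; rewrite subr_eq0 => /eqP.
- have [||c _] := @MVT _ h (fun=> 0) 0 a a0.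
  + move=> l; rewrite in_itv /= => /andP[l1 l2]; apply: dh.
    by rewrite !gtr0_norm// ltW.
  + apply: derivable_within_continuous => l; rewrite in_itv /= => /andP[l1 l2].
    have [|//] := dh l; rewrite !ger0_norm//; exact: ltW.
  + by rewrite mul0r => /eqP; rewrite subr_eq0 => /eqP.
Qed.

Lemma disk_derive0_cst (f : plane -> R) :
  (forall x, sqn x < 1 -> forall i, is_derive x (axis R i) f 0) ->
  forall x, sqn x < 1 -> f x = f (0, 0).
Proof.
move=> df [a b] ab1.
have e0 h : ((0, 0) : plane) + h *: axis R 0 = (h, 0).
  by rewrite axisE /axis /= mulr1 mulr0 !add0r.
have e1 h : ((a, 0) : plane) + h *: axis R 1 = (a, h).
  by rewrite axisE /axis /= mulr1 mulr0 !addr0 add0r.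
have h1 : f (a, b) = f (a, 0).
  rewrite -[in LHS]e1 -[in RHS]e1.
  apply: (@derive0_cst (fun h => f ((a, 0) + h *: axis R 1))) => l lb.
  apply: is_derive_shift_line; apply: df; rewrite e1.
  apply: le_lt_trans ab1; rewrite /sqn /= lerD2l -[leLHS]real_normK ?num_real//.
  by rewrite -[leRHS]real_normK ?num_real// ler_sqr ?nnegrE.
rewrite h1; rewrite -[in LHS]e0 -[in RHS](e0 0).
apply: (@derive0_cst (fun h => f ((0, 0) + h *: axis R 0))) => l la.
apply: is_derive_shift_line; apply: df; rewrite e0.
apply: le_lt_trans ab1; rewrite /sqn /= expr0n /= addr0.
apply: (@le_trans _ _ (a ^+ 2)); last by rewrite lerDl sqr_ge0.
rewrite -[leLHS]real_normK ?num_real//.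
by rewrite -[leRHS]real_normK ?num_real// ler_sqr ?nnegrE.
Qed.

Lemma Rintegral_period c : \int[leb]_(t in period) c = c * (2 * pi).
Proof.
have E : leb period = (2 * pi)%:E.
  by rewrite lebesgue_measure_itv /= lte_fin mulr_gt0 ?pi_gt0//= oppr0 adde0.
exact: (etrans (Rintegral_cst leb measurable_period c) (congr1 (fun z => c * fine z) E)).
Qed.

(** By the previous lemmas with equal values on both sides of the step, the
    gradient of the integral vanishes; at the centre the kernel equals 1. *)
Lemma kint_PK1 (x : plane) : sqn x < 1 -> kint PK (fun=> 1) x = 2 * pi.
Proof.
move=> x1.
have pi0 := @pi_ge0 R.
have h2 : 0 <= (0 : R) <= 2 * pi by rewrite lexx mulr_ge0.
have dN (y : plane) : sqn y < 1 -> forall i, is_derive y (axis R i) (kint PK (fun=> 1)) 0.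
  move=> y1 i.
  have := is_derive_kint PK i (bounded_data_cst 1) y1.
  move/is_derive_eq; apply.
  elim/I2_ind: i.
  - have := kint_step0 1 1 y1 h2; rewrite subrr mulr0 mul0r => <-.
    by congr kint; apply/funext => t; rewrite if_same.
  - have := kint_step1 1 1 y1 h2; rewrite subrr mulr0 mul0r => <-.
    by congr kint; apply/funext => t; rewrite if_same.
rewrite (disk_derive0_cst dN x1).
rewrite /kint (@eq_Rintegral _ _ _ _ _ (fun=> 1)).
  by rewrite Rintegral_period mul1r.
move=> t _; rewrite /= /Ak /Bk (_ : den (0, 0) t = 1).
  by rewrite /= !subr0 !divr1 !mulr1 -!expr2 cos2Dsin2; ring.
by rewrite /den /= !subr0 cos2Dsin2.
Qed.

Lemma kint_cst e c (x : plane) : sqn x < 1 -> kint e (fun=> c) x = c * kint e (fun=> 1) x.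
Proof.
move=> x1; rewrite /kint -RintegralZl//; last exact: (integrable_kg e (bounded_data_cst 1) x1).
by apply: eq_Rintegral => t _; rewrite mulr1 mulrC.
Qed.

Definition poisson (g : R -> R) (x : plane) : R := (2 * pi)^-1 * kint PK g x.

Lemma poisson_cst c x : sqn x < 1 -> poisson (fun=> c) x = c.
Proof.
move=> x1; rewrite /poisson kint_cst// kint_PK1//.
by rewrite mulrCA mulVf ?mulr1// mulf_neq0// lt0r_neq0// pi_gt0.
Qed.

(** The usual approximate-identity argument: the mass of the kernel that is not
    close to p is O(1 - |x|^2).  Only the behaviour of g at the single boundary
    point p is involved, so the lemma also applies to discontinuous data. *)
Lemma poisson_near (p : plane) (g : R -> R) (c eps : R) : sqn p = 1 -> bounded_data g ->
  (forall e, 0 < e -> exists2 d, 0 < d & forall t, period t -> den p t < d -> `|g t - c| <= e) ->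
  0 < eps -> \forall x \near p, sqn x < 1 -> `|poisson g x - c| <= eps.
Proof.
move=> p1 bg gc eps0.
have [d d0 hd] := gc (eps / 2) (divr_gt0 eps0 (ltr0n _ 2)).
have bgc := bounded_dataB bg (bounded_data_cst c).
have [_ [M gM]] := bgc.
have h1 : \forall x \near p, (x.1 - p.1) ^+ 2 + (x.2 - p.2) ^+ 2 < d / 4.
  have cc : (fun x : plane => (x.1 - p.1) ^+ 2 + (x.2 - p.2) ^+ 2) @ p --> (0 : R).
    rewrite [X in _ --> X](_ : _ = (p.1 - p.1) ^+ 2 + (p.2 - p.2) ^+ 2); last by rewrite !subrr expr0n addr0.
    under eq_fun do rewrite !expr2.
    by rewrite !expr2; apply: cvgD; apply: cvgM; apply: cvgB; try exact: cvg_cst;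
      try exact: cvg_fst; exact: cvg_snd.
  by move/cvgr_lt : cc; apply; rewrite divr_gt0.
have N0 : 0 < 4 * `|M| / d + 1 by rewrite ltr_wpDl// divr_ge0 ?mulr_ge0// ltW.
have h2 : \forall x \near p, 1 - sqn x < eps / 2 / (4 * `|M| / d + 1).
  have cc : (fun x : plane => 1 - sqn x) @ p --> (0 : R).
    rewrite -[X in _ --> X](subrr 1) -[X in _ --> _ - X]p1.
    by apply: cvgB; [exact: cvg_cst|exact: sqn_continuous].
  by move/cvgr_lt : cc; apply; rewrite !divr_gt0.
near=> x => x1.
have xp : (x.1 - p.1) ^+ 2 + (x.2 - p.2) ^+ 2 < d / 4 by near: x.
have xe : 1 - sqn x < eps / 2 / (4 * `|M| / d + 1) by near: x.
have q0 : 0 < 1 - sqn x by rewrite subr_gt0.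
have pi0 := @pi_gt0 R.
rewrite -[in X in `|X|](poisson_cst c x1) /poisson -mulrBr normrM gtr0_norm ?invr_gt0 ?mulr_gt0//.
rewrite -kintB//; last exact: bounded_data_cst.
rewrite mulrC ler_pdivrMr ?mulr_gt0//.
have ii := integrable_kg PK bgc x1.
have h := le_normr_Rintegral measurable_period ii.
apply: (le_trans h).
rewrite (_ : eps * (2 * pi) = kint PK (fun=> eps / 2) x + eps / 2 * (2 * pi)); last first.
  by rewrite kint_cst// kint_PK1//; field.
have -> : eps / 2 * (2 * pi) = \int[leb]_(t in period) (eps / 2).
  by rewrite Rintegral_period.
have ic := integrable_data (bounded_data_cst (eps / 2)).
have ik := integrable_kg PK (bounded_data_cst (eps / 2)) x1.
rewrite /kint -(RintegralD measurable_period ik ic).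
apply: le_Rintegral => //.
- by have := integrable_norm ii; apply: eq_integrable.
- by have := integrableD measurable_period ik ic; apply: eq_integrable.
move=> t Tt; rewrite normrM ger0_norm ?PK_ge0//.
have [dt|dt] := ltP (den p t) d.
  rewrite (@le_trans _ _ (keval PK x t * (eps / 2)))//.
    by rewrite ler_wpM2l ?PK_ge0// hd.
  by rewrite lerDl ltW// divr_gt0.
rewrite (@le_trans _ _ (eps / 2))//; last first.
  by rewrite lerDr mulr_ge0 ?PK_ge0// ltW// divr_gt0.
have dx : d / 4 <= den x t.
  have : den p t <= 2 * den x t + 2 * ((x.1 - p.1) ^+ 2 + (x.2 - p.2) ^+ 2).
    rewrite /den; have := sqr_ge0 (cos t - x.1 - (x.1 - p.1)); have := sqr_ge0 (sin t - x.2 - (x.2 - p.2)).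
    nra.
  by move: xp dt; lra.
rewrite PKE//.
have gM' : `|g t - c| <= `|M| by rewrite (le_trans (gM t Tt))// ler_norm.
apply: (@le_trans _ _ ((1 - sqn x) / (d / 4) * `|M|)).
  apply: ler_pM => //; first by rewrite divr_ge0// ltW// den_gt0.
  rewrite ler_wpM2l// ?(ltW q0)// lef_pV2// posrE ?den_gt0// divr_gt0//.
move: xe; rewrite ltr_pdivlMr// => xe.
rewrite (_ : (1 - sqn x) / (d / 4) * `|M| = (1 - sqn x) * (4 * `|M| / d)); last first.
  by field; exact: lt0r_neq0.
apply: le_trans (ltW xe); rewrite ler_wpM2l// ?(ltW q0)// lerDl//.
Unshelve. all: by end_near. Qed.

End PoissonLimit.
Arguments PK {R}.

(** * The maximum principle *)

Section MaximumPrinciple.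
Variable R : realType.
Local Notation plane := (R * R)%type.

Lemma second_derivative_at_max (h h1 : R -> R) (c d : R) : 0 < d ->
  (forall l, `|l| < d -> is_derive l (1 : R) h (h1 l)) ->
  is_derive (0 : R) (1 : R) h1 c ->
  (forall l, `|l| < d -> h l <= h 0) -> c <= 0.
Proof.
move=> d0 dh dh1 hmax; rewrite leNgt; apply/negP => c0.
have h10 : h1 0 = 0.
  have dn : - d <= d by lra.
  have : is_derive (0 : R) (1 : R) h 0.
    apply: (@derive1_at_max _ h (- d) d) => //.
    - move=> t; rewrite in_itv /= -ltr_norml => td.
      by have [] := dh t td.
    - by rewrite in_itv /= oppr_lt0 d0.
    - by move=> t; rewrite in_itv /= -ltr_norml; exact: hmax.
  have [|_ <-] := dh 0; first by rewrite normr0.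
  by move=> [_ ->].
have [e e0 he] : exists2 e : R, 0 < e & forall l, 0 < l -> l < e -> 0 < h1 l.
  have [/cvg_ex[/= c' cvc] E] := dh1.
  have Ec : c' = c by rewrite -E; apply/esym/cvg_lim.
  rewrite {}Ec in cvc; clear c'.
  have /= := cvgr_gt _ cvc 0 c0.
  rewrite /nbhs /= => -[e /= e0 he]; exists e => // l l0 le.
  have := he l; rewrite /ball_ /= sub0r normrN gtr0_norm// => /(_ le (lt0r_neq0 l0)).
  by rewrite h10 subr0 addr0 [l *: 1]mulr1 pmulr_rgt0// invr_gt0.
pose a := Num.min (d / 2) (e / 2).
have a0 : 0 < a by rewrite lt_min !divr_gt0.
have ad : a < d by rewrite gt_min; apply/orP; left; lra.
have ae : a < e by rewrite gt_min; apply/orP; right; lra.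
have [||b] := @MVT _ h h1 0 a a0.
- move=> l; rewrite in_itv /= => /andP[l0 la]; apply: dh.
  by rewrite gtr0_norm// (lt_trans la).
- apply: derivable_within_continuous => l; rewrite in_itv /= => /andP[l0 la].
  have [|//] := dh l; by rewrite ger0_norm// (le_lt_trans la).
rewrite in_itv /= => /andP[b0 ba] E.
have : h a <= h 0 by apply: hmax; rewrite gtr0_norm.
rewrite -subr_le0 E subr0 leNgt mulr_gt0// he//; exact: lt_trans ae.
Qed.

Lemma disk_line (x : plane) (i : 'I_2) : sqn x < 1 ->
  exists2 d : R, 0 < d & forall l, `|l| < d -> sqn (x + l *: axis R i) < 1.
Proof.
move=> x1; have h : \forall y \near x, sqn y < 1 by exact: sqn_near.
move/nbhs_ballP: h => [d /= d0 hd]; exists d => // l ld.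
apply: hd; rewrite -ball_normE /= opprD addNKr normrN normrZ.
by apply: le_lt_trans ld; rewrite ler_piMr// norm_axis.
Qed.

(** The Laplacian involves the pure second derivatives only, and the maximum
    principle needs them along the two axes. *)
Definition twice_derivable (f : plane -> R) (f1 f2 : 'I_2 -> plane -> R) :=
  forall x, sqn x < 1 -> forall i,
    is_derive x (axis R i) f (f1 i x) /\ is_derive x (axis R i) (f1 i) (f2 i x).

Lemma is_derive_sqn (x : plane) i : is_derive x (axis R i) (@sqn R)
  (2 * (x.1 * (axis R i).1 + x.2 * (axis R i).2)).
Proof.
have h1 := is_derive_fst x (axis R i); have h2 := is_derive_snd x (axis R i).
by rewrite /sqn; apply: is_derive_eq; rewrite /GRing.scale /=; ring.
Qed.

(** Adding e |x|^2 makes the Laplacian positive, which excludes an interior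
    maximum; then e tends to 0. *)
Lemma maximum_principle (f : plane -> R) f1 f2 :
  {within @cdisk R, continuous f} -> twice_derivable f f1 f2 ->
  (forall x, sqn x < 1 -> f2 0 x + f2 1 x = 0) ->
  (forall x, sqn x = 1 -> f x <= 0) -> forall x, sqn x <= 1 -> f x <= 0.
Proof.
move=> cf df hf f0 x x1.
suff key e : 0 < e -> f x <= e.
  by apply/ler_addgt0Pr => e e0; rewrite add0r; exact: key.
move=> e0.
pose g y := f y + e * sqn y.
have cg : {within @cdisk R, continuous g}.
  move=> y; apply: cvgD; first exact: cf.
  apply: cvgM; first exact: cvg_cst.
  have : {within @cdisk R, continuous (@sqn R)}.
    by apply: continuous_subspaceT; exact: sqn_continuous.
  exact.
have [|z zD zmax] := compact_EVT_max _ (@compact_cdisk R) cg.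
  by exists x.
rewrite inE in zD.
have gx : f x <= g x by rewrite /g lerDl mulr_ge0 ?(ltW e0)// /sqn addr_ge0// sqr_ge0.
apply: (le_trans gx); apply: (le_trans (zmax x _)); first by rewrite inE.
have : sqn z <= 1 by [].
rewrite le_eqVlt => /predU1P[z1|z1].
  by rewrite /g z1 mulr1 gerDr f0.
exfalso.
have neg i : f2 i z + 2 * e <= 0.
  have [d d0 hd] := disk_line i z1.
  pose dd : plane := axis R i.
  pose h1 (l : R) := f1 i (z + l *: dd) +
    e * (2 * ((z + l *: dd).1 * dd.1 + (z + l *: dd).2 * dd.2)).
  have dh l : `|l| < d -> is_derive l (1 : R) (fun l => g (z + l *: dd)) (h1 l).
    move=> ld; have [k1 _] := df _ (hd l ld) i.
    have k2 := is_derive_sqn (z + l *: axis R i) i.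
    have k3 : is_derive (z + l *: axis R i) (axis R i) g (h1 l).
      rewrite /g /h1 /dd.
      by apply: is_derive_eq; rewrite /GRing.scale /=; ring.
    exact: (is_derive_shift_line k3).
  have dh1 : is_derive (0 : R) (1 : R) h1 (f2 i z + 2 * e).
    have [_ h2] := df _ z1 i.
    have h3 : is_derive (0 : R) (1 : R) (fun l => f1 i (z + l *: dd)) (f2 i z).
      by apply/is_derive_line.
    pose a := e * (2 * (z.1 * dd.1 + z.2 * dd.2)).
    rewrite (_ : h1 = (fun l => f1 i (z + l *: dd)) \+ (fun l => a + l * (2 * e))); last first.
      apply/funext => l /=; congr (_ + _); rewrite /a /dd /GRing.scale /=.
      by elim/I2_ind: i {hd dd h1 dh h2 h3 a} => /=; rewrite /GRing.scale /=; ring.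
    have h4 : is_derive (0 : R) (1 : R) (fun l => a + l * (2 * e)) (2 * e).
      by apply: is_derive_eq; rewrite /GRing.scale /=; ring.
    exact: is_deriveD.
  apply: (second_derivative_at_max d0 dh dh1) => l ld.
  rewrite scale0r addr0; apply: zmax; rewrite inE; apply: ltW; exact: hd.
have := lerD (neg 0) (neg 1); rewrite addrACA hf//; lra.
Qed.

Lemma harmonic_uniq (f g : plane -> R) f1 f2 g1 g2 :
  {within @cdisk R, continuous f} -> twice_derivable f f1 f2 ->
  (forall x, sqn x < 1 -> f2 0 x + f2 1 x = 0) ->
  {within @cdisk R, continuous g} -> twice_derivable g g1 g2 ->
  (forall x, sqn x < 1 -> g2 0 x + g2 1 x = 0) ->
  (forall x, sqn x = 1 -> f x = g x) -> forall x, sqn x <= 1 -> f x = g x.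
Proof.
suff main f' g' f1' f2' g1' g2' :
  {within @cdisk R, continuous f'} -> twice_derivable f' f1' f2' ->
  (forall x, sqn x < 1 -> f2' 0 x + f2' 1 x = 0) ->
  {within @cdisk R, continuous g'} -> twice_derivable g' g1' g2' ->
  (forall x, sqn x < 1 -> g2' 0 x + g2' 1 x = 0) ->
  (forall x, sqn x = 1 -> f' x = g' x) -> forall x, sqn x <= 1 -> f' x <= g' x.
  move=> *; apply/le_anti/andP; split; first by apply: (main f g) => //; eassumption.
  by apply: (main g f); try eassumption; move=> y y1; apply/esym; auto.
move=> {f g f1 f2 g1 g2}; move: f' g' f1' f2' g1' g2' => f g f1 f2 g1 g2.
move=> cf df hf cg dg hg fg x x1; rewrite -subr_le0.
apply: (@maximum_principle (fun y => f y - g y) (fun i y => f1 i y - g1 i y)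
   (fun i y => f2 i y - g2 i y)) x1.
- by move=> y; apply: cvgB; [exact: cf|exact: cg].
- move=> y y1 i; have [a1 a2] := df y y1 i; have [b1 b2] := dg y y1 i.
  by split; exact: is_deriveB.
- by move=> y y1; rewrite addrACA -opprD hf// hg// subrr.
- by move=> y y1; rewrite fg// subrr.
Qed.

End MaximumPrinciple.

(** * The Dirichlet problem on the disk *)

Section Dirichlet.
Variable R : realType.
Local Notation plane := (R * R)%type.
Local Notation period := ([set` `[0, 2 * pi[%R] : set R).
Local Notation periodic2pi g := (forall t : R, g (t + 2 * pi) = g t).

Lemma sqn_circ (t : R) : sqn (circ t) = 1.
Proof. exact: cos2Dsin2. Qed.

Lemma circ_cdisk (t : R) : cdisk (circ t).
Proof. by rewrite /cdisk /= cos2Dsin2. Qed.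

Lemma circ_periodic (t : R) : circ (t + 2 * pi) = circ t.
Proof. by rewrite /circ mulr_natl cosD2pi sinD2pi. Qed.

Lemma continuous_circ : continuous (@circ R).
Proof.
move=> t; apply: (@cvg_pair _ _ _ _ (nbhs (cos t)) (nbhs (sin t))) => /=.
  exact: continuous_cos.
exact: continuous_sin.
Qed.

Lemma circ_surj (p : plane) : sqn p = 1 -> exists2 t, period t & p = circ t.
Proof.
case: p => a b; rewrite /sqn /= => ab.
have a1 : -1 <= a <= 1.
  by rewrite -ler_norml -(@ler_sqr R) ?nnegrE// expr1n real_normK ?num_real//; have := sqr_ge0 b; lra.
have pi0 := @pi_gt0 R.
have ca : cos (acos a) = a by apply: acosK; rewrite in_itv.
have [ac0 ac1] : 0 <= acos a /\ acos a <= pi by split; [apply: acos_ge0|apply: acos_lepi].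
have sa : sin (acos a) = `|b|.
  rewrite sin_acos// -sqrtr_sqr; congr Num.sqrt; lra.
have [b0|b0] := leP 0 b.
  exists (acos a); first by rewrite /= in_itv /= ac0 /=; lra.
  by rewrite /circ ca sa ger0_norm.
exists (2 * pi - acos a).
  rewrite /= in_itv /=; apply/andP; split; first lra.
  suff : 0 < acos a by lra.
  rewrite lt_neqAle ac0 andbT; apply/eqP => E.
  by move: sa; rewrite -E sin0 ltr0_norm//; lra.
rewrite /circ -[2 * pi - _](addrC (- acos a)) mulr_natl cosD2pi sinD2pi cosN sinN ca sa.
by rewrite ltr0_norm// opprK.
Qed.

Lemma den_circ (a t : R) : den (circ a) t = 2 - 2 * cos (t - a).
Proof.
by rewrite /den /circ cosB /=; have := cos2Dsin2 t; have := cos2Dsin2 a; nra.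
Qed.

(** Proximity on the circle, expressed for angles in [0, 2 pi[: the angles
    are close up to a period. *)
Lemma near_circ (a d : R) : period a -> 0 < d -> exists2 e, 0 < e &
  forall t, period t -> den (circ a) t < e ->
    exists2 s, `|s| < d & [\/ t = a + s, t = a + s + 2 * pi | t + 2 * pi = a + s].
Proof.
rewrite /= in_itv /= => /andP[a0 a2] d0.
have pi0 := @pi_gt0 R.
pose d' := Num.min d pi.
have d'0 : 0 < d' by rewrite lt_min d0.
have d'pi : d' <= pi by rewrite ge_min lexx orbT.
have d'd : d' <= d by rewrite ge_min lexx.
have cd : cos d' < 1.
  by rewrite -cos0 ltr_cos// in_itv /= ?lexx ?(ltW d'0)//= ltW.
have cl s : `|s| <= pi -> cos d' < cos s -> `|s| < d.
  move=> spi; rewrite -[cos s]cos_norm ltr_cos ?in_itv /= ?normr_ge0 ?(ltW d'0)//.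
  by move=> /lt_le_trans; apply.
exists (2 - 2 * cos d'); first lra.
move=> t; rewrite in_itv /= => /andP[t0 t2]; rewrite den_circ => h.
have {}h : cos d' < cos (t - a) by lra.
have [s1|s1] := ltP pi (t - a).
  exists (t - a - 2 * pi); last by constructor 2; ring.
  apply: cl; first by rewrite ler_norml; apply/andP; split; lra.
  have -> : cos (t - a - 2 * pi) = cos (t - a) by rewrite -[in RHS](subrK (2 * pi) (t - a)) mulr_natl cosD2pi.
  exact: h.
have [s2|s2] := ltP (t - a) (- pi).
  exists (t - a + 2 * pi); last by constructor 3; ring.
  apply: cl; first by rewrite ler_norml; apply/andP; split; lra.
  by rewrite mulr_natl cosD2pi.
exists (t - a); last by constructor 1; ring.
by apply: cl => //; rewrite ler_norml s2.
Qed.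

Lemma data_near (g : R -> R) (a : R) : periodic2pi g -> period a ->
  {for a, continuous g} -> forall e, 0 < e -> exists2 d, 0 < d &
    forall t, period t -> den (circ a) t < d -> `|g t - g a| <= e.
Proof.
move=> pg pa cg e e0.
move/cvgrPdist_le : cg => /(_ e e0) /nbhs_ballP[d /= d0 hd].
have [h h0 hh] := near_circ pa d0.
exists h => // t pt /(hh t pt)[s sd ts].
have E : g t = g (a + s).
  case: ts => [->//|->//|<-]; by rewrite pg.
rewrite E distrC; apply: hd; rewrite -ball_normE /= opprD addNKr normrN//.
Qed.

Definition angle (x : plane) : R := xget 0 [set t | period t /\ x = circ t].

Lemma angleP x : sqn x = 1 -> period (angle x) /\ x = circ (angle x).
Proof.
move=> /circ_surj[t pt xt]; rewrite /angle.
by case: xgetP => [y -> //|/(_ t)[]].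
Qed.

Lemma circ_inj (s t : R) : period s -> period t -> circ s = circ t -> s = t.
Proof.
move=> ps pt E; apply/eqP; rewrite -subr_eq0 -normr_eq0; apply/negP => /negP n0.
move: (ps) (pt); rewrite /= !in_itv /= => /andP[s0 s2] /andP[t0 t2].
have pi0 := @pi_gt0 R.
have E2 : sin ((s - t) / 2) = 0.
  have : cos (s - t) = 1.
    by move: E => [c1 c2]; rewrite cosB c1 c2 -!expr2 cos2Dsin2.
  rewrite [in cos _](splitr (s - t)) -mulr2n cos_mulr2n => h.
  have := cos2Dsin2 ((s - t) / 2); move: h; rewrite mulr2n => h1 h2.
  by apply/eqP; rewrite -sqrf_eq0; apply/eqP; lra.
have [l|l|l] := ltgtP s t; last by rewrite l subrr normr0 eqxx in n0.
- have := @sin_gt0_pi _ ((t - s) / 2); rewrite -[t - s]opprB mulNr sinN E2 oppr0 ltxx.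
  by move=> h; have : false by apply: h; apply/andP; split; lra.
- have := @sin_gt0_pi _ ((s - t) / 2); rewrite E2 ltxx.
  by move=> h; have : false by apply: h; apply/andP; split; lra.
Qed.

Lemma angle_circ t : period t -> angle (circ t) = t.
Proof.
move=> pt; have [pa E] := angleP (sqn_circ t).
by apply: circ_inj.
Qed.

Definition pext (g : R -> R) (x : plane) : R :=
  if sqn x < 1 then poisson g x else g (angle x).

Lemma pext_continuous g : periodic2pi g -> continuous g -> bounded_data g ->
  {within @cdisk R, continuous (pext g)}.
Proof.
move=> pg cg bg; apply/subspace_continuousP => x xD; rewrite /from_subspace.
have : sqn x <= 1 by [].
rewrite le_eqVlt => /predU1P[x1|x1]; last first.
  apply: cvg_within_filter.
  have h : \forall y \near x, sqn y < 1 by exact: sqn_near.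
  have -> : pext g x = poisson g x by rewrite /pext x1.
  have cp : poisson g @ x --> poisson g x.
    have ck := @continuous_kint _ PK _ _ bg x1.
    by apply: (@cvgM _ _ _ _ (fun=> (2 * pi)^-1) (kint PK g)) => //; exact: cvg_cst.
  apply: cvg_trans cp; apply: near_eq_cvg.
  by near=> y; rewrite /pext; have -> : sqn y < 1 by near: y.
have -> : pext g x = g (angle x) by rewrite /pext x1 ltxx.
have [pa xa] := angleP x1.
apply/cvgrPdist_le => e e0.
have H := data_near pg pa (cg (angle x)).
have h1 := @poisson_near R x g (g (angle x)) e x1 bg.
have {}h1 : \forall y \near x, sqn y < 1 -> `|poisson g y - g (angle x)| <= e.
  by apply: h1 => //; rewrite [in den _]xa.
have [d d0 hd] := H e e0.
have h2 : \forall y \near x, (x.1 - y.1) ^+ 2 + (x.2 - y.2) ^+ 2 < d.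
  have cc : (fun y : plane => (x.1 - y.1) ^+ 2 + (x.2 - y.2) ^+ 2) @ x --> (0 : R).
    rewrite [X in _ --> X](_ : _ = (x.1 - x.1) ^+ 2 + (x.2 - x.2) ^+ 2); last by rewrite !subrr expr0n addr0.
    under eq_fun do rewrite !expr2.
    by rewrite !expr2; apply: cvgD; apply: cvgM; apply: cvgB; try exact: cvg_cst;
      try exact: cvg_fst; exact: cvg_snd.
  by move/cvgr_lt : cc; apply.
rewrite near_withinE; near=> y => yD.
rewrite /pext distrC; case: ifPn => [y1|]; first by move: y1; near: y.
rewrite -leNgt => y1.
have {}y1 : sqn y = 1 by apply/le_anti; rewrite y1 andbT; exact: yD.
have [py ya] := angleP y1.
apply: hd => //.
have : (x.1 - y.1) ^+ 2 + (x.2 - y.2) ^+ 2 < d by near: y.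
apply: le_lt_trans; rewrite -xa /den.
have -> : cos (angle y) = y.1 by rewrite [in RHS]ya.
have -> : sin (angle y) = y.2 by rewrite [in RHS]ya.
by rewrite -[_ - x.1]opprB -[_ - x.2]opprB !sqrrN.
Unshelve. all: by end_near. Qed.

Definition poisson1 (g : R -> R) (i : 'I_2) (x : plane) : R :=
  (2 * pi)^-1 * kint (kdiff i PK) g x.
Definition poisson2 (g : R -> R) (i : 'I_2) (x : plane) : R :=
  (2 * pi)^-1 * kint (kdiff i (kdiff i PK)) g x.

Lemma poisson_derivable g : bounded_data g ->
  twice_derivable (poisson g) (poisson1 g) (poisson2 g).
Proof.
move=> bg x x1 i.
have h1 := is_derive_kint PK i bg x1.
have h2 := is_derive_kint (kdiff i PK) i bg x1.
by split; [rewrite /poisson|rewrite /poisson1]; apply: is_derive_eq;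
  rewrite /GRing.scale /= ?mulr0 ?addr0.
Qed.

Lemma poisson_harmonic g : bounded_data g -> forall x, sqn x < 1 ->
  poisson2 g 0 x + poisson2 g 1 x = 0.
Proof.
move=> bg x x1; rewrite /poisson2 -mulrDr /kint -RintegralD//;
  try exact: measurable_period; try exact: integrable_kg.
rewrite (@eq_Rintegral _ _ _ _ _ (fun=> 0)).
  by rewrite (Rintegral_period 0) mul0r mulr0.
by move=> t _; rewrite -mulrDl PK_harmonic mul0r.
Qed.

(** Both sides solve the same Dirichlet problem, so they agree by the maximum
    principle. *)
Lemma poisson_representation (f : plane -> R) f1 f2 :
  {within @cdisk R, continuous f} -> twice_derivable f f1 f2 ->
  (forall x, sqn x < 1 -> f2 0 x + f2 1 x = 0) ->
  bounded_data (fun t => f (circ t)) /\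
  forall x, sqn x < 1 -> f x = poisson (fun t => f (circ t)) x.
Proof.
move=> cf df hf; set g := (fun t => f (circ t)).
have pg : periodic2pi g by move=> t; rewrite /g circ_periodic.
have cg : continuous g.
  move=> t; have ct := @continuous_circ t.
  have fc : f @ within (@cdisk R) (nbhs (circ t)) --> f (circ t).
    by move/subspace_continuousP : cf; apply; exact: circ_cdisk.
  move=> A /fc h0; have h : \forall y \near circ t, cdisk y -> A (f y) by exact: h0.
  have h2 : \forall s \near t, cdisk (circ s) -> A (f (circ s)) by exact: (ct _ h).
  apply: filterS h2 => s; apply; exact: circ_cdisk.
have bg : bounded_data g.
  split; first by apply: (@measurable_funS _ _ _ _ setT) => //; exact: continuous_measurable_fun.
  have cn : {within [set` `[0, 2 * pi]%R], continuous (fun t => `|g t|)}.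
    by apply: continuous_subspaceT => t; apply: cvg_norm; exact: cg.
  have [|c _ hc] := @EVT_max _ (fun t => `|g t|) 0 (2 * pi) _ cn.
    by rewrite mulr_ge0// pi_ge0.
  exists `|g c| => t; rewrite /= in_itv /= => /andP[t0 t1]; apply: hc.
  by rewrite in_itv /= t0 ltW.
split => // x x1.
have dp : twice_derivable (pext g) (poisson1 g) (poisson2 g).
  move=> y y1 i; have [h1 h2] := poisson_derivable bg y1 i; split => //.
  apply: near_eq_is_derive h1.
  have h : \forall z \near y, sqn z < 1 by exact: sqn_near.
  by near=> z; rewrite /pext; have -> : sqn z < 1 by near: z.
rewrite (harmonic_uniq cf df hf (pext_continuous pg cg bg) dp (poisson_harmonic bg) _ (ltW x1)).
  by rewrite /pext x1.
move=> y y1; rewrite /pext y1 ltxx /g.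
by have [_ <-] := angleP y1.
Unshelve. all: by end_near. Qed.

End Dirichlet.

(** * Integration by parts on the disk *)

Section IntegrationByParts.
Variable R : realType.
Local Notation plane := (R * R)%type.
Local Notation mplane := (measurableTypeR R * measurableTypeR R)%type.
Local Notation leb := (@lebesgue_measure R).
Local Notation mu := (@area_measure R).

Lemma compact_bound (S : set plane) (f : plane -> R) : compact S ->
  (forall x, S x -> {for x, continuous f}) ->
  exists2 M, 0 <= M & forall x, S x -> `|f x| <= M.
Proof.
move=> cS cf.
have [->|/set0P S0] := eqVneq S set0; first by exists 0.
have cn : {within S, continuous (fun x => `|f x|)}.
  apply/subspace_continuousP => x Sx; apply: cvg_within_filter.
  by apply: cvg_norm; exact: cf.
have [c _ hc] := compact_EVT_max S0 cS cn.
by exists `|f c| => // x Sx; apply: hc; rewrite inE.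
Qed.

Lemma bounded_integrable_disk (f : plane -> R) :
  measurable_fun (@disk R : set mplane) (f : mplane -> measurableTypeR R) ->
  (exists M, forall x, disk x -> `|f x| <= M) ->
  mu.-integrable (@disk R) (EFin \o f).
Proof.
move=> mf [M fM]; apply: measurable_bounded_integrable => //.
- exact: measurable_disk.
- exact: disk_finite.
exists M; split; first exact: num_real.
by move=> N MN t Tt /=; exact: le_trans (fM t Tt) (ltW MN).
Qed.

Lemma integrable_supported (f h : plane -> R) (S : set plane) :
  (forall x, disk x -> {for x, continuous f}) -> continuous h ->
  compact S -> S `<=` @disk R -> (forall x, ~ S x -> h x = 0) ->
  mu.-integrable (@disk R) (EFin \o (fun x => f x * h x)).
Proof.
move=> cf ch cS SD hS; apply: bounded_integrable_disk.
  apply: plane_continuous_measurable; first exact: open_disk.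
  by move=> x xD; apply: cvgM; [exact: cf|exact: ch].
have [|M M0 hM] := @compact_bound S (fun x => f x * h x) cS.
  by move=> x Sx; apply: cvgM; [apply: cf; exact: SD|exact: ch].
exists M => x _; have [Sx|nSx] := pselect (S x); first exact: hM.
by rewrite hS// mulr0 normr0.
Qed.

Lemma continuous_pair1 (y : R) : continuous (fun s : R => (s, y)).
Proof.
move=> s; have c1 : id @ s --> s by exact: cvg_id.
have c2 : (fun=> y) @ s --> y by exact: cvg_cst.
exact: (cvg_pair c1 c2).
Qed.

Lemma continuous_pair2 (x : R) : continuous (fun s : R => (x, s)).
Proof.
move=> s; have c1 : id @ s --> s by exact: cvg_id.
have c2 : (fun=> x) @ s --> x by exact: cvg_cst.
exact: (cvg_pair c2 c1).
Qed.

(** Fubini reduces the claim to the fundamental theorem of calculus on lines,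
    where the boundary terms vanish. *)
Lemma plane_integral_derive (F F' : plane -> R) (i : 'I_2) :
  continuous F' -> (forall x, is_derive x (axis R i) F (F' x)) ->
  (forall x, ~ cdisk x -> F x = 0 /\ F' x = 0) ->
  \int[mu]_x F' x = 0.
Proof.
move=> cF' dF F0.
have iF : mu.-integrable setT (EFin \o F' : mplane -> \bar R).
  have [M M0 hM] := compact_bound (@compact_cdisk R) (fun x _ => cF' x).
  have mF : measurable_fun (setT : set mplane) (F' : mplane -> measurableTypeR R).
    apply: (@plane_continuous_measurable R setT F'); first exact: openT.
    by move=> x _; exact: cF'.
  have iB : mu.-integrable (@box R) (EFin \o F').
    apply: measurable_bounded_integrable.
    - exact: measurable_box.
    - exact: box_finite.
    - exact: measurable_funS mF.
    exists M; split; first exact: num_real.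
    move=> N MN t Tt /=; apply: le_trans (ltW MN).
    have [tD|/F0[_ ->]] := pselect (cdisk t); first exact: hM.
    by rewrite normr0.
  move/(integrable_mkcond _ (@measurable_box R)) : iB.
  apply: eq_integrable => // x _; rewrite patchE; case: ifPn => //.
  rewrite notin_setE => nB; have [|_ /= ->//] := F0 x.
  by move/cdisk_box.
have line (G G' : R -> R) : continuous G' -> (forall s, is_derive s (1 : R) G (G' s)) ->
    (forall s, 1 < `|s| -> G s = 0 /\ G' s = 0) -> (\int[leb]_s (G' s)%:E = 0)%E.
  move=> cG' dG G0.
  have -> : (\int[leb]_s (G' s)%:E = \int[leb]_(s in [set` `[-2, 2[%R]) (G' s)%:E)%E.
    rewrite [RHS]integral_mkcond; apply: eq_integral => s _.
    rewrite patchE; case: ifPn => //; rewrite notin_setE /= in_itv /= => /negP h.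
    have [|_ ->//] := G0 s; rewrite ltNge; apply: contra h.
    by rewrite ler_norml => /andP[s1 s2]; apply/andP; split; lra.
  have l2 : (-2 : R) <= 2 by lra.
  have := FTC_co l2 dG cG'.
  have [|-> _] := G0 2; first by rewrite gtr0_norm//; lra.
  have [|-> _] := G0 (-2); first by rewrite normrN gtr0_norm//; lra.
  rewrite subrr /Rintegral => h.
  rewrite -[LHS]fineK ?h//.
  by apply: integrable_fin_num => //; exact: integrable_co.
elim/I2_ind: i dF => dF.
- rewrite /Rintegral -(@integral21_prod_meas1 _ _ _ _ _ leb leb _ iF) /fubini_G.
  rewrite integral0_eq// => y _.
  apply: (line (fun s => F (s, y)) (fun s => F' (s, y))).
  + by move=> s; apply: (continuous_comp (f := fun s => (s, y))); [exact: continuous_pair1|exact: cF'].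
  + move=> s; have h : is_derive (((0, y) : plane) + s *: axis R 0) (axis R 0) F (F' (s, y)).
      by rewrite axisE /axis /= mulr1 mulr0 add0r addr0.
    have := is_derive_shift_line h; congr is_derive; apply/funext => l.
    by rewrite axisE /axis /= mulr1 mulr0 add0r addr0.
  + by move=> s s1; apply: F0 => /disk_bound[/=]; rewrite leNgt s1.
- rewrite /Rintegral -(@integral12_prod_meas1 _ _ _ _ _ leb leb _ iF) /fubini_F.
  rewrite integral0_eq// => x _.
  apply: (line (fun s => F (x, s)) (fun s => F' (x, s))).
  + by move=> s; apply: (continuous_comp (f := fun s => (x, s))); [exact: continuous_pair2|exact: cF'].
  + move=> s; have h : is_derive (((x, 0) : plane) + s *: axis R 1) (axis R 1) F (F' (x, s)).
      by rewrite axisE /axis /= mulr1 mulr0 add0r addr0.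
    have := is_derive_shift_line h; congr is_derive; apply/funext => l.
    by rewrite axisE /axis /= mulr1 mulr0 add0r addr0.
  + by move=> s s1; apply: F0 => /disk_bound[/= _]; rewrite leNgt s1.
Qed.

Lemma test_functionP (h : plane -> R) : test_function h ->
  [/\ continuous h, forall i, continuous (fun x => 'D_(axis R i) (h : plane -> R^o) x),
   forall i x, is_derive x (axis R i) h ('D_(axis R i) (h : plane -> R^o) x) &
   exists S : set plane, [/\ compact S, S `<=` @disk R, closed S &
     forall x, ~ S x -> h x = 0 /\ forall i, 'D_(axis R i) (h : plane -> R^o) x = 0]].
Proof.
move=> [hC cS SD]; have [ch hD] := hC 1%N.
have ch' : continuous h by move=> x; exact: ch.
have dh i x : is_derive x (axis R i) h ('D_(axis R i) (h : plane -> R^o) x).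
  by apply: DeriveDef => //; have [+ _] := hD i; apply.
split => //.
  by move=> i x; have [_ [+ _]] := hD i; apply.
exists (closure [set x | h x != 0]).
have near0 x : ~ closure [set x | h x != 0] x -> \forall y \near x, h y = 0.
  move=> nS; have : open (~` closure [set x | h x != 0]) by apply: closed_openC; exact: closed_closure.
  move=> oS; have := open_nbhs_nbhs (conj oS nS).
  apply: filterS => y nSy; apply: contrapT => hy; apply: nSy.
  by apply: subset_closure; apply/eqP.
split => //; first exact: closed_closure.
move=> x /near0 h0; split; first exact: nbhs_singleton h0.
by move=> i; have := @near_eq_derive _ _ _ (h : plane -> R^o) (cst 0) x (axis R i) h0; rewrite derive_cst.
Qed.

(** The function f h, extended by 0, is differentiable on the whole plane
    since h has compact support in the disk; its partial derivative has
    integral 0.  No regularity of f up to the boundary is involved. *)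
Lemma weak_partial_C1 (f g : plane -> R) (i : 'I_2) :
  (forall x, disk x -> {for x, continuous f}) ->
  (forall x, disk x -> {for x, continuous g}) ->
  (forall x, disk x -> is_derive x (axis R i) f (g x)) ->
  weak_partial f i g.
Proof.
move=> cf cg df h /test_functionP[ch cDh dh [S [cS SD clS hS]]].
set h' := fun x => 'D_(axis R i) (h : plane -> R^o) x.
have ch' : continuous h' by exact: cDh.
have i1 : mu.-integrable (@disk R) (EFin \o (fun x => f x * h' x)).
  by apply: (integrable_supported cf ch' cS SD) => x /hS[_]; apply.
have i2 : mu.-integrable (@disk R) (EFin \o (fun x => g x * h x)).
  by apply: (integrable_supported cg ch cS SD) => x /hS[].
apply/eqP; rewrite -addr_eq0 -RintegralD//; last exact: measurable_disk.
rewrite Rintegral_mkcond.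
pose F := (fun x => f x * h x) \_ (@disk R).
have disk_near (x : plane) : disk x -> \forall y \near x, disk y.
  move=> xD; have : open_nbhs x (@disk R) by split => //; exact: open_disk.
  by move/open_nbhs_nbhs.
have out_near (x : plane) : ~ S x -> \forall y \near x, ~ S y.
  move=> nS; have : open_nbhs x (~` S) by split => //; exact: closed_openC.
  by move/open_nbhs_nbhs.
have cover (x : plane) : disk x \/ ~ S x.
  by have [|nx] := pselect (disk x); [left|right => /SD].
apply/eqP/(@plane_integral_derive F _ i).
- move=> x; have [xD|nS] := cover x.
    have E : \forall y \near x, f y * h' y + g y * h y =
        ((fun x => f x * h' x + g x * h x) \_ (@disk R)) y.
      by near=> y; rewrite patchE mem_set//; near: y; exact: disk_near.
    rewrite /continuous_at patchE mem_set//.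
    apply: cvg_trans (near_eq_cvg E) _.
    by apply: cvgD; apply: cvgM; [exact: cf|exact: ch'|exact: cg|exact: ch].
  have [h0 h'0] := hS _ nS.
  rewrite /continuous_at (_ : ((fun x => f x * h' x + g x * h x) \_ (@disk R)) x = 0); last first.
    by rewrite patchE; case: ifP => // _; rewrite h0 /h' h'0 !mulr0 addr0.
  have E : \forall y \near x, (0 : R) = ((fun x => f x * h' x + g x * h x) \_ (@disk R)) y.
    have := out_near _ nS; apply: filterS => y /hS[k0 k'0].
    by rewrite patchE; case: ifP => // _; rewrite k0 /h' k'0 !mulr0 addr0.
  exact: (cvg_trans (near_eq_cvg E) (cvg_cst _)).
- move=> x; have [xD|nS] := cover x.
    rewrite patchE mem_set//.
    have h1 := df x xD; have h2 := dh i x.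
    have h3 : is_derive x (axis R i) (fun x => f x * h x) (f x * h' x + g x * h x).
      by apply: is_derive_eq; rewrite /GRing.scale /= -/(h' x); ring.
    apply: near_eq_is_derive h3.
    by near=> y; rewrite /F patchE mem_set//; near: y; exact: disk_near.
  have [h0 h'0] := hS _ nS.
  have -> : ((fun x => f x * h' x + g x * h x) \_ (@disk R)) x = 0.
    by rewrite patchE; case: ifP => // _; rewrite h0 /h' h'0 !mulr0 addr0.
  have hc := is_derive_cst (0 : R) x (axis R i).
  apply: near_eq_is_derive hc.
  have := out_near _ nS; apply: filterS => y /hS[hy _].
  by rewrite /F patchE hy mulr0 if_same.
- move=> x nx; have xD : x \notin @disk R by rewrite notin_setE => /disk_cdisk.
  by rewrite /F !patchE (negbTE xD).
Unshelve. all: by end_near. Qed.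

Lemma in_L2P (f : plane -> R) : in_L2 f <->
  measurable_fun (@disk R : set mplane) (f : mplane -> measurableTypeR R) /\
  (\int[mu]_(x in @disk R) (f x ^+ 2)%:E < +oo)%E.
Proof.
have E : (\int[mu]_(x in @disk R) (f x ^+ 2)%:E = \int[mu]_x `|(((f \_ (@disk R)) x) ^+ 2)%:E|)%E.
  rewrite integral_mkcond; apply: eq_integral => x _; rewrite !patchE.
  by case: ifP => _ /=; rewrite ?expr0n /= ?normr0// ger0_norm// sqr_ge0.
split.
- move=> h; have := Lfun2_integrable_sqr h => /integrableP[_]; rewrite -E => ->; split => //.
  move: h; rewrite /in_L2 inE => /andP[]; rewrite inE /= => mf _.
  by apply/(measurable_restrictT _ (@measurable_disk R)).
- move=> [mf fi]; rewrite /in_L2 inE.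
  have mf' : measurable_fun setT (f \_ (@disk R) : mplane -> measurableTypeR R).
    by apply/(measurable_restrictT _ (@measurable_disk R)).
  apply/andP; split; rewrite inE//= /finite_norm.
  have two0 : (2 : R) != 0 by [].
  apply: (lty_poweRy two0); rewrite poweR_Lnorm//.
  rewrite E in fi; apply: le_lt_trans fi.
  rewrite le_eqVlt; apply/orP; left; apply/eqP; apply: eq_integral => x _.
  by rewrite /= powR_mulrn// -normrX.
Qed.

End IntegrationByParts.

(** * Smooth functions given by expressions *)

Section TestFunctions.
Variable R : realType.
Local Notation plane := (R * R)%type.

(** The functions x^-m exp(-1/x), extended by 0 to the negative half-line:
    derivatives of functions in this family are combinations of functions in
    the family, the flatness at 0 being flat_le. *)
Definition flat (m : nat) (x : R) : R := if 0 < x then x ^- m * expR (- x^-1) else 0.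

Lemma flat_ge0 m x : 0 <= flat m x.
Proof.
rewrite /flat; case: ifP => // x0.
by rewrite mulr_ge0 ?expR_ge0// invr_ge0 exprn_ge0// ltW.
Qed.

(** This follows from exp(1/x) >= ((m+1) x)^-(m+1), the (m+1)-st power of
    exp(s) >= s at s = 1/((m+1) x). *)
Lemma flat_le m : exists2 C : R, 0 < C & forall x, flat m x <= C * `|x|.
Proof.
exists (m.+1%:R ^+ m.+1); first by rewrite exprn_gt0.
move=> x; rewrite /flat; case: ifP => x0; last by rewrite mulr_ge0// exprn_ge0.
have m0 : (0 : R) < m.+1%:R by [].
have xn : x != 0 by rewrite lt0r_neq0.
have h : (m.+1%:R * x) ^- m.+1 <= expR x^-1.
  have -> : x^-1 = (m.+1%:R * x)^-1 * m.+1%:R.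
    field; by rewrite xn lt0r_neq0.
  rewrite expRM_natr -exprVn lerXn2r ?nnegrE ?expR_ge0 ?invr_ge0 ?mulr_ge0 ?(ltW x0)//.
  by apply: le_trans (expR_ge1Dx _); rewrite lerDr.
rewrite expRN gtr0_norm//.
have : (expR x^-1)^-1 <= (m.+1%:R * x) ^+ m.+1.
  rewrite -[leRHS]invrK lef_pV2// posrE ?expR_gt0// invr_gt0 exprn_gt0// mulr_gt0//.
move=> {}h; apply: (@le_trans _ _ (x ^- m * (m.+1%:R * x) ^+ m.+1)).
  by rewrite ler_wpM2l// invr_ge0 exprn_ge0// ltW.
rewrite exprMn mulrCA; apply: ler_wpM2l; first by rewrite exprn_ge0.
by rewrite exprS mulrCA mulVf ?mulr1// expf_neq0.
Qed.

Lemma flat_near_gt m (x : R) : 0 < x -> \forall y \near x, y ^- m * expR (- y^-1) = flat m y.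
Proof.
by move=> x0; near=> y; rewrite /flat; have -> : 0 < y by near: y; exact: lt_nbhsr.
Unshelve. all: by end_near. Qed.

Lemma is_derive_flat m (x : R) :
  is_derive x (1 : R) (flat m) (- m%:R * flat m.+1 x + flat m.+2 x).
Proof.
have [x0|x0|->] := ltgtP x 0.
- have hc := is_derive_cst (0 : R) x (1 : R).
  rewrite /flat ltNge (ltW x0) /= mulr0 addr0.
  apply: near_eq_is_derive hc.
  by near=> y; rewrite ltNge (_ : y <= 0)//; apply: ltW; near: y; exact: lt_nbhsl.
- have xn : x != 0 by rewrite lt0r_neq0.
  have h1 : is_derive x (1 : R) (fun y => y ^+ m) (m%:R * x ^+ m.-1).
    apply: DeriveDef; first exact: exprn_derivable.
    by rewrite exp_derive /GRing.scale /= mulr1.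
  have h2 : is_derive x (1 : R) (fun y => - y^-1) (x ^- 2).
    rewrite (_ : (fun y => _) = (fun y => (-1) / id y)); last first.
      by apply/funext => y; rewrite mulN1r.
    have := is_derive_div xn (is_derive_cst (-1 : R) x (1 : R)) (is_derive_id x (1 : R)).
    by move/is_derive_eq; apply; rewrite /=; field.
  have h3 : is_derive x (1 : R) (fun y => expR (- y^-1)) (expR (- x^-1) * x ^- 2).
    exact: is_derive1_comp (is_derive_expR _) h2.
  have h4 := @is_derive_div _ _ (fun y : R => expR (- y^-1)) (fun y : R => y ^+ m) x 1 _ _ (expf_neq0 m xn) h3 h1.
  have h5 : is_derive x (1 : R) (fun y => y ^- m * expR (- y^-1))
     (- m%:R * flat m.+1 x + flat m.+2 x).
    rewrite (_ : (fun y => _) = (fun y => expR (- y^-1) / y ^+ m)); last first.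
      by apply/funext => y; rewrite mulrC.
    move/is_derive_eq : h4; apply; rewrite /flat x0.
    case: m {h1} => [|m] /=; first by field.
    rewrite !exprS; field; by rewrite xn expf_neq0.
  by apply: near_eq_is_derive h5; exact: flat_near_gt.
- rewrite {2 3}/flat ltxx !mulr0 addr0.
  have [C C0 hC] := flat_le m.+1.
  have F0 : flat m 0 = 0 by rewrite /flat ltxx.
  have cv : h^-1 *: (flat m (h *: (1 : R) + 0) - flat m 0) @[h --> 0^'] --> (0 : R).
    apply/cvgrPdist_le => e e0.
    near=> h; rewrite sub0r normrN F0 subr0 addr0 [h *: 1]mulr1.
    have E : `|h^-1 *: flat m h| <= C * `|h|.
      apply: le_trans (hC h); rewrite le_eqVlt; apply/orP; left; apply/eqP.
      rewrite /flat; case: ifP => h0; last by rewrite scaler0 normr0.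
      rewrite /GRing.scale /= ger0_norm.
        by rewrite mulrA exprS invfM.
      by rewrite !mulr_ge0 ?invr_ge0 ?exprn_ge0 ?expR_ge0 ?(ltW h0).
    apply: (le_trans E); rewrite mulrC -ler_pdivlMr//.
    near: h; apply: dnbhs0_le; exact: divr_gt0.
  apply: DeriveDef; first by apply/cvg_ex; exists 0; exact: cv.
  by apply/cvg_lim => //; exact: cv.
Unshelve. all: by end_near. Qed.

Lemma continuous_flat m : continuous (flat m).
Proof.
move=> x; apply: differentiable_continuous; apply/derivable1_diffP.
by have [] := is_derive_flat m x.
Qed.

(** A class of smooth functions closed under partial derivatives, so that being
    of class C^k for every k is an induction on k (Ck_seval).  It is large
    enough to contain cutoffs and approximations of rectangles. *)
Inductive sexpr :=
  | SCst of R | SFst | SSnd | SAdd of sexpr & sexpr | SMul of sexpr & sexpr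
  | SFlat of nat & sexpr.

Fixpoint seval (e : sexpr) (x : plane) : R :=
  match e with
  | SCst c => c | SFst => x.1 | SSnd => x.2
  | SAdd a b => seval a x + seval b x
  | SMul a b => seval a x * seval b x
  | SFlat m a => flat m (seval a x)
  end.

Fixpoint sdiff (i : 'I_2) (e : sexpr) : sexpr :=
  match e with
  | SCst _ => SCst 0 | SFst => SCst (axis R i).1 | SSnd => SCst (axis R i).2
  | SAdd a b => SAdd (sdiff i a) (sdiff i b)
  | SMul a b => SAdd (SMul (sdiff i a) b) (SMul a (sdiff i b))
  | SFlat m a => SMul (SAdd (SMul (SCst (- m%:R)) (SFlat m.+1 a)) (SFlat m.+2 a)) (sdiff i a)
  end.

Lemma continuous_seval e : continuous (seval e).
Proof.
elim: e => [c|||a ca b cb|a ca b cb|m a ca] x /=.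
- exact: cvg_cst.
- exact: cvg_fst.
- exact: cvg_snd.
- by apply: cvgD; [exact: ca|exact: cb].
- by apply: cvgM; [exact: ca|exact: cb].
- by apply: continuous_comp; [exact: ca|exact: continuous_flat].
Qed.

Lemma is_derive_seval e x i : is_derive x (axis R i) (seval e) (seval (sdiff i e) x).
Proof.
elim: e => [c|||a da b db|a da b db|m a da] /=.
- exact: is_derive_cst.
- exact: is_derive_fst.
- exact: is_derive_snd.
- exact: is_deriveD.
- have := @is_deriveM _ _ _ _ _ _ _ _ da db.
  by move/is_derive_eq; apply; rewrite /GRing.scale /=; ring.
- apply/is_derive_line; move/is_derive_line : da => da.
  have df := is_derive_flat m (seval a (x + 0 *: axis R i)).
  have := is_derive1_comp df da.
  by rewrite scale0r addr0.
Qed.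

Lemma Ck_seval k e : Ck_on (V := R^o) setT k (seval e : plane -> R^o).
Proof.
elim: k e => [|k ih] e; (split; first by move=> x _; exact: continuous_seval) => //.
move=> i; split; first by move=> x _; have [] := is_derive_seval e x i.
rewrite (_ : (fun x => _) = seval (sdiff i e)); first exact: ih.
by apply/funext => x; have [_ ->] := is_derive_seval e x i.
Qed.

(** The cutoff exp(-1/s), where s = 1 - 1/(m+1) - |x|^2: it is supported in a
    closed disk of radius smaller than 1, and these disks exhaust the unit
    disk. *)
Definition scut (m : nat) : sexpr :=
  SFlat 0 (SAdd (SCst (1 - m.+1%:R^-1)) (SMul (SCst (-1)) (SAdd (SMul SFst SFst) (SMul SSnd SSnd)))).

Lemma scutE m x : seval (scut m) x = flat 0 (1 - m.+1%:R^-1 - sqn x).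
Proof. by rewrite /= mulN1r -!expr2. Qed.

Lemma flat_gt0 m x : (0 < flat m x) = (0 < x).
Proof.
rewrite /flat; case: ifPn => [x0|]; last by rewrite ltxx.
by rewrite mulr_gt0 ?expR_gt0// invr_gt0 exprn_gt0.
Qed.

Lemma scut_test e m : test_function (seval (SMul e (scut m))).
Proof.
set h := seval _.
have S : closure [set x | h x != 0] `<=` [set x | sqn x <= 1 - m.+1%:R^-1].
  have cl : closed [set x : plane | sqn x <= 1 - m.+1%:R^-1].
    apply: (@closed_comp _ _ (@sqn R) [set y | y <= 1 - m.+1%:R^-1]); last exact: closed_le.
    by move=> x _; exact: sqn_continuous.
  rewrite [X in _ `<=` X]((closure_id _).1 cl); apply: closure_subset => x.
  move=> h0; have : seval (scut m) x != 0.
    by apply: contra h0 => /eqP E; rewrite /h (_ : seval _ x = seval e x * seval (scut m) x)// E mulr0.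
  rewrite scutE.
  by rewrite neq_lt ltNge flat_ge0 /= flat_gt0 subr_gt0 => /ltW.
have D : [set x | sqn x <= 1 - m.+1%:R^-1] `<=` @disk R.
  by move=> x /= /le_lt_trans; apply; rewrite gtrBl invr_gt0.
split; first by move=> k; exact: Ck_seval.
- apply: (subclosed_compact _ (@compact_cdisk R)); first exact: closed_closure.
  by apply: (subset_trans S); apply: (subset_trans D); exact: disk_cdisk.
- exact: subset_trans S D.
Qed.

End TestFunctions.

(** * The fundamental lemma of the calculus of variations *)

Section FundamentalLemma.
Variable R : realType.
Local Notation plane := (R * R)%type.
Local Notation mplane := (measurableTypeR R * measurableTypeR R)%type.
Local Notation mu := (@area_measure R).

(** The sets A over which phi has zero integral, after intersection with D,
    form a Dynkin system.  Applied to the first coordinate, to the second one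
    and to products, this passes from open rectangles to all Borel sets. *)
Lemma dynkin_integral0 (phi : plane -> R) d (T : measurableType d) (G : set (set T))
    (pre : mplane -> T) (D : set mplane) :
  mu.-integrable setT (EFin \o phi) ->
  d.-measurable = <<s G >> -> setI_closed G -> measurable_fun setT pre ->
  measurable D -> (\int[mu]_(x in D) (phi x)%:E = 0)%E ->
  (forall A, G A -> (\int[mu]_(x in D `&` pre @^-1` A) (phi x)%:E = 0)%E) ->
  forall A, measurable A -> (\int[mu]_(x in D `&` pre @^-1` A) (phi x)%:E = 0)%E.
Proof.
move=> iphi EG GI mpre mD D0 G0 A mA.
have mpA S : measurable S -> measurable (D `&` pre @^-1` S).
  by move=> mS; apply: measurableI => //; rewrite -[X in measurable X]setTI; exact: mpre.
have iS S : measurable S -> mu.-integrable S (EFin \o phi).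
  by move=> mS; apply: integrableS iphi.
rewrite EG in mA.
apply: (dynkin_induction (P := fun S => (\int[mu]_(x in D `&` pre @^-1` S) (phi x)%:E = 0)%E) EG GI _ _ _ _ mA) => //.
- by rewrite preimage_setT setIT.
- move=> S mS S0.
  have ED : D = (D `&` pre @^-1` S) `|` (D `&` pre @^-1` (~` S)).
    by rewrite -setIUr -preimage_setU setUv preimage_setT setIT.
  move: D0; rewrite [in X in X -> _]ED integral_setU_EFin.
  + by rewrite S0 add0e.
  + exact: mpA.
  + by apply: mpA; exact: measurableC.
  + rewrite -ED; have := iS _ mD; move/measurable_int; by move/measurable_EFinP.
  + by apply/disj_setPS => x [[_ xS] [_ nS]].
- move=> F mF tF F0.
  rewrite preimage_bigcup setI_bigcupr integral_bigcup.
  + by apply: eseries0 => i _ _; exact: F0.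
  + apply/trivIsetP => i j _ _ ij; move/trivIsetP : tF => /(_ i j I I ij) E.
    rewrite -subset0 => x [[_ xi] [_ xj]].
    by have : (F i `&` F j) (pre x) by []; rewrite E.
  + by move=> k; exact: mpA.
  + apply: iS; apply: bigcup_measurable => k _; exact: mpA.
Qed.

Lemma integral0_ae (phi : plane -> R) :
  mu.-integrable setT (EFin \o phi) ->
  (forall x, ~ cdisk x -> phi x = 0) ->
  (forall a b c d : R, (\int[mu]_(x in `]a, b[ `*` `]c, d[) (phi x)%:E = 0)%E) ->
  ae_eq mu setT (EFin \o phi) (cst 0%E).
Proof.
move=> iphi phi0 rect.
have EG := @RGenOpens.measurableE R.
have GI : setI_closed (@RGenOpens.G R).
  move=> _ _ [a [b ->]] [c [d ->]]; exists (Num.max a c), (Num.min b d).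
  apply/seteqP; split => x /=; rewrite !in_itv /= gt_max lt_min.
    by move=> [/andP[-> ->] /andP[-> ->]].
  by move=> /andP[/andP[-> ->] /andP[-> ->]].
(* phi is supported in the closed disk, so that ]-2, 2[ may replace the whole
   line. *)
have big (A : set plane) (B : set plane) : (forall x, cdisk x -> (A x <-> B x)) ->
    (\int[mu]_(x in A) (phi x)%:E = \int[mu]_(x in B) (phi x)%:E)%E.
  move=> AB; rewrite integral_mkcond [RHS]integral_mkcond; apply: eq_integral => x _.
  rewrite !patchE.
  have [xD|nD] := pselect (cdisk x); last by rewrite phi0// !if_same.
  by congr (if _ then _ else _); apply/idP/idP; rewrite !inE; apply AB.
have s1 c d A : measurable (A : set (measurableTypeR R)) ->
    (\int[mu]_(x in (setT `*` `]c, d[) `&` fst @^-1` A) (phi x)%:E = 0)%E.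
  have mfst : measurable_fun setT (fst : mplane -> measurableTypeR R) by exact: measurable_fst.
  have mD : measurable (setT `*` `]c, d[ : set mplane) by exact: measurableX.
  apply: (dynkin_integral0 iphi EG GI mfst mD).
  - rewrite (big _ (`]-2, 2[ `*` `]c, d[))// => x /disk_bound[]; rewrite ler_norml => /andP[x1 x2] _.
    split=> [[_ h]|[_ h]]; split => //=; rewrite in_itv /=; apply/andP; split; lra.
  - move=> _ [a [b ->]]; rewrite -(rect a b c d); congr integral.
    by apply/seteqP; split => x /= [] // [].
have s2 A B : measurable (A : set (measurableTypeR R)) -> measurable (B : set (measurableTypeR R)) ->
    (\int[mu]_(x in (A `*` setT) `&` snd @^-1` B) (phi x)%:E = 0)%E.
  move=> mA; have msnd : measurable_fun setT (snd : mplane -> measurableTypeR R) by exact: measurable_snd.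
  have mD : measurable (A `*` setT : set mplane) by exact: measurableX.
  apply: (dynkin_integral0 iphi EG GI msnd mD).
  - rewrite -(s1 (-2) 2 A mA); apply: big => x /disk_bound[_]; rewrite ler_norml => /andP[x1 x2].
    split=> [[h _]|[_ h]]; split => //=; split => //=; rewrite in_itv /=; apply/andP; split; lra.
  - move=> _ [c [d ->]]; rewrite -(s1 c d A mA); congr integral.
    by apply/seteqP; split => x /= [] [].
have s3 E : measurable (E : set mplane) -> (\int[mu]_(x in E) (phi x)%:E = 0)%E.
  move=> mE; rewrite -[E]setTI.
  apply: (dynkin_integral0 (pre := id) iphi (@measurable_prod_measurableType _ _ (measurableTypeR R) (measurableTypeR R))) => //.
  - move=> _ _ [A mA [B mB <-]] [A' mA' [B' mB' <-]].
    exists (A `&` A'); first exact: measurableI.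
    by exists (B `&` B'); [exact: measurableI|rewrite setXI].
  - rewrite -(s2 setT setT)//; congr integral.
    by apply/seteqP; split => x.
  - move=> _ [A mA [B mB <-]]; rewrite -(s2 A B mA mB); congr integral.
    by apply/seteqP; split => x /=; [move=> [_ []]|move=> [[]]].
apply: integral_ae_eq => //.
by move=> E _ mE; rewrite integral0; exact: s3.
Qed.

Lemma flat0_le1 (x : R) : flat 0 x <= 1.
Proof.
rewrite /flat; case: ifP => // x0; rewrite expr0 invr1 mul1r -expR0 ler_expR.
by rewrite oppr_le0 invr_ge0 ltW.
Qed.

Lemma flat0_cvg (s : R) : flat 0 (n.+1%:R * s) @[n --> \oo] --> (if 0 < s then 1 else 0 : R).
Proof.
case: ifPn => s0; last first.
  rewrite (_ : (fun n => _) = fun=> 0); first exact: cvg_cst.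
  by apply/funext => n; rewrite /flat pmulr_rgt0// (negbTE s0).
rewrite (_ : (fun n => _) = (fun n => expR (- (n.+1%:R^-1 * s^-1)))); last first.
  by apply/funext => n; rewrite /flat pmulr_rgt0// s0 expr0 invr1 mul1r invfM.
rewrite -[X in _ --> X]expR0 -oppr0.
apply: continuous_cvg; first exact: continuous_expR.
apply: cvgN; rewrite -[X in _ --> X](mul0r s^-1).
by apply: cvgM; [exact: cvg_harmonic|exact: cvg_cst].
Qed.

(** A smooth approximation, from below, of the indicator function of the
    rectangle ]a, b[ x ]c, d[, as n grows. *)
Definition srect (n : nat) (a b c d : R) : sexpr R :=
  let up k e := SFlat 0 (SMul (SCst n.+1%:R) (SAdd e (SCst (- k)))) in
  let dn k e := SFlat 0 (SMul (SCst n.+1%:R) (SAdd (SCst k) (SMul (SCst (-1)) e))) in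
  SMul (SMul (up a (@SFst R)) (dn b (@SFst R))) (SMul (up c (@SSnd R)) (dn d (@SSnd R))).

Lemma srectE n a b c d x : seval (srect n a b c d) x =
  flat 0 (n.+1%:R * (x.1 - a)) * flat 0 (n.+1%:R * (b - x.1)) *
  (flat 0 (n.+1%:R * (x.2 - c)) * flat 0 (n.+1%:R * (d - x.2))).
Proof. by rewrite /= !mulN1r. Qed.

(** Test functions approximating rectangles, multiplied by a cutoff, show that
    g times the cutoff has zero integral over all rectangles, hence vanishes
    almost everywhere. *)
Lemma fundamental_lemma (g : plane -> R) :
  measurable_fun (@disk R : set mplane) (g : mplane -> measurableTypeR R) ->
  (forall m, mu.-integrable (@disk R) (EFin \o (fun x => g x * seval (scut R m) x))) ->
  (forall h, test_function h -> \int[mu]_(x in @disk R) (g x * h x) = 0) ->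
  ae_eq mu (@disk R) (EFin \o g) (cst 0%E).
Proof.
move=> mg ig g0.
have step m : {ae mu, forall x, disk x -> g x * seval (scut R m) x = 0}.
  pose phi := (fun x => g x * seval (scut R m) x) \_ (@disk R).
  have iphi : mu.-integrable setT (EFin \o phi).
    have := ig m; move/(integrable_mkcond _ (@measurable_disk R)); apply: eq_integrable => //.
    by move=> x _; rewrite /phi /= !patchE; case: ifP.
  have : ae_eq mu setT (EFin \o phi) (cst 0%E).
    apply: integral0_ae => //.
      by move=> x nx; rewrite /phi patchE; case: ifPn => //; rewrite inE => /disk_cdisk.
    move=> a b c d; pose Q : set plane := `]a, b[ `*` `]c, d[.
    have mQ : measurable (Q : set mplane) by exact: measurableX.
    pose F n x := (g x * seval (SMul (srect n a b c d) (scut R m)) x)%:E.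
    pose f x := (phi x * \1_Q x)%:E.
    have mF n : measurable_fun (@disk R : set mplane) (F n : mplane -> \bar R).
      apply/measurable_EFinP; apply: measurable_funM => //.
      apply: plane_continuous_measurable; first exact: open_disk.
      by move=> x _; exact: continuous_seval.
    have mf : measurable_fun (@disk R : set mplane) (f : mplane -> \bar R).
      apply/measurable_EFinP; apply: measurable_funM.
        have := measurable_int _ iphi; move/measurable_EFinP; apply: measurable_funS => //.
      by apply: (@measurable_funS _ _ _ _ setT) => //; exact: measurable_indic.
    have Ff : {ae mu, forall x, disk x -> F n x @[n --> \oo] --> f x}.
      apply: aeW => x xD.
      have sc : seval (srect n a b c d) x @[n --> \oo] --> (\1_Q x : R).
        have -> : \1_Q x = (if 0 < x.1 - a then 1 else 0) * (if 0 < b - x.1 then 1 else 0) *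
            ((if 0 < x.2 - c then 1 else 0) * (if 0 < d - x.2 then 1 else 0)) :> R.
          rewrite indicE /Q in_setX !mem_setE !in_itv /= !subr_gt0.
          by case: (a < _); case: (_ < b); case: (c < _); case: (_ < d); rewrite /= ?(mulr0, mul0r, mulr1).
        rewrite (_ : (fun n => _) = (fun n => flat 0 (n.+1%:R * (x.1 - a)) * flat 0 (n.+1%:R * (b - x.1)) *
            (flat 0 (n.+1%:R * (x.2 - c)) * flat 0 (n.+1%:R * (d - x.2))))); last first.
          by apply/funext => n; rewrite srectE.
        by apply: cvgM; apply: cvgM; exact: flat0_cvg.
      have Fc : g x * seval (scut R m) x * seval (srect n a b c d) x @[n --> \oo] --> phi x * \1_Q x.
        by rewrite /phi patchE mem_set//; apply: cvgM => //; exact: cvg_cst.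
      rewrite /F /f (_ : (fun n => _) = EFin \o (fun n => g x * seval (scut R m) x * seval (srect n a b c d) x)).
        by apply: cvg_EFin; first exact: nearW.
      by apply/funext => n; congr EFin; rewrite -mulrA [in RHS](mulrC (seval (scut R m) x)).
    have Fg' x n : disk x -> (`|F n x| <= `|(g x * seval (scut R m) x)%:E|)%E.
      move=> xD; rewrite /F lee_fin (_ : seval _ x = seval (srect n a b c d) x * seval (scut R m) x)//.
      rewrite mulrCA normrM; apply: ler_piMl => //.
      rewrite srectE !normrM !ger0_norm ?flat_ge0//.
      by rewrite !mulr_ile1 ?mulr_ge0 ?flat_ge0 ?flat0_le1.
    have Fg : {ae mu, forall x n, disk x -> (`|F n x| <= `|(g x * seval (scut R m) x)%:E|)%E}.
      by apply: aeW => x n; exact: Fg'.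
    have iF n : mu.-integrable (@disk R) (F n).
      by apply: (le_integrable (@measurable_disk R) (mF n) _ (ig m)) => x xD; exact: Fg'.
    have F0 n : (\int[mu]_(x in @disk R) F n x = 0)%E.
      have := g0 _ (scut_test (srect n a b c d) m); rewrite /Rintegral => E.
      by rewrite -[LHS]fineK ?E//; apply: integrable_fin_num => //; exact: measurable_disk.
    have [_ _] := dominated_convergence (@measurable_disk R) mF mf Ff (integrable_abse (ig m)) Fg.
    rewrite (_ : [sequence _]_n = fun=> 0%E); last by apply/funext => n; exact: F0.
    move=> cF; have <- : (\int[mu]_(x in @disk R) f x = 0)%E.
      by apply: (cvg_unique _ cF (cvg_cst _)).
    rewrite integral_mkcond [RHS]integral_mkcond; apply: eq_integral => x _.
    rewrite !patchE /f /phi !patchE indicE; case: (x \in Q); case: (x \in @disk R) => //=;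
     by rewrite ?mulr1 ?mulr0.
  apply: filterS => x /(_ I) /= [h] xD.
  by move: h; rewrite /phi patchE mem_set.
have := ae_foralln step; apply: filterS => x h xD /=; congr EFin.
have q0 : 0 < 1 - sqn x by rewrite subr_gt0.
have [m hm] : exists m : nat, (m.+1%:R^-1 : R) < 1 - sqn x.
  have := near_infty_natSinv_lt (PosNum q0).
  by move=> [n _ /(_ n (leqnn n))] ?; exists n.
have := h m xD; rewrite scutE => /eqP; rewrite mulf_eq0 => /orP[/eqP//|].
by rewrite gt_eqF// flat_gt0 subr_gt0 ltrBrDr addrC -ltrBrDr.
Qed.

End FundamentalLemma.

(** * Weak and classical gradients *)

Section ClassicalGradient.
Variable R : realType.
Local Notation plane := (R * R)%type.
Local Notation mplane := (measurableTypeR R * measurableTypeR R)%type.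
Local Notation space := 'rV[R]_4.
Local Notation mu := (@area_measure R).
Local Notation D := (@disk R).

Lemma sum2 (V : nmodType) (F : 'I_2 -> V) : \sum_(i < 2) F i = F 0 + F 1.
Proof. by rewrite big_ord_recl big_ord1; congr (_ + F _); exact: val_inj. Qed.

Lemma in_L2_sqr (f : plane -> R) : in_L2 f -> mu.-integrable D (EFin \o (fun x => f x ^+ 2)).
Proof.
move=> /in_L2P[mf fi]; apply/integrableP; split.
  by apply/measurable_EFinP; exact: measurable_funX.
apply: le_lt_trans fi; rewrite le_eqVlt; apply/orP; left; apply/eqP.
by apply: eq_integral => x _; rewrite /= ger0_norm// sqr_ge0.
Qed.

Lemma in_L2_integrable (f : plane -> R) : in_L2 f -> mu.-integrable D (EFin \o f).
Proof.
move=> Lf; have /in_L2P[mf _] := Lf.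
have i1 : mu.-integrable D (EFin \o (fun=> 1 : R)).
  apply: bounded_integrable_disk => //; by exists 1 => x _; rewrite normr1.
have i3 := integrableD (@measurable_disk R) (in_L2_sqr Lf) i1.
apply: (le_integrable (@measurable_disk R) _ _ i3); first exact/measurable_EFinP.
move=> x _; rewrite /= lee_fin [leRHS]ger0_norm ?addr_ge0 ?sqr_ge0//.
rewrite -[f x ^+ 2]real_normK ?num_real//; have := sqr_ge0 (`|f x| - 1); nra.
Qed.

Lemma in_L2_mul (f g : plane -> R) : in_L2 f -> in_L2 g ->
  mu.-integrable D (EFin \o (fun x => f x * g x)).
Proof.
move=> Lf Lg; have := integrableD (@measurable_disk R) (in_L2_sqr Lf) (in_L2_sqr Lg).
move/in_L2P : Lf => [mf _]; move/in_L2P : Lg => [mg _].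
apply: le_integrable; first exact: measurable_disk.
  by apply/measurable_EFinP; exact: measurable_funM.
move=> x _; rewrite /= lee_fin [leRHS]ger0_norm ?addr_ge0 ?sqr_ge0//.
rewrite normrM -[f x ^+ 2]real_normK ?num_real// -[g x ^+ 2]real_normK ?num_real//.
have := sqr_ge0 (`|f x| - `|g x|); have := sqr_ge0 `|f x|; have := sqr_ge0 `|g x|; nra.
Qed.

Lemma integrable_mul_bounded (f h : plane -> R) : mu.-integrable D (EFin \o f) ->
  continuous h -> mu.-integrable D (EFin \o (fun x => f x * h x)).
Proof.
move=> fi ch.
have [M M0 hM] := compact_bound (@compact_cdisk R) (fun x _ => ch x).
have := integrableZl (@measurable_disk R) M fi => iM.
apply: (le_integrable (@measurable_disk R) _ _ iM).
  apply/measurable_EFinP; apply: measurable_funM.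
    by move: fi => /measurable_int /measurable_EFinP.
  apply: plane_continuous_measurable; first exact: open_disk.
  by move=> x _; exact: ch.
move=> x xD; rewrite /= lee_fin !normrM mulrC ler_wpM2r//.
by rewrite (ger0_norm M0) hM//; exact: disk_cdisk.
Qed.

(** f1 is also a weak derivative, by integration by parts, and weak
    derivatives coincide almost everywhere.  This is the way in which the
    hypothesis of finite energy, stated with weak gradients, is transferred to
    the classical gradient of a harmonic map. *)
Lemma weak_partial_unique (f f1 G : plane -> R) (i : 'I_2) :
  (forall x, disk x -> {for x, continuous f}) ->
  (forall x, disk x -> {for x, continuous f1}) ->
  (forall x, disk x -> is_derive x (axis R i) f (f1 x)) ->
  in_L2 G -> weak_partial f i G -> in_L2 f1.
Proof.
move=> cf cf1 df LG wG.
have wf1 := weak_partial_C1 cf cf1 df.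
have iG := in_L2_integrable LG.
move/in_L2P : (LG) => [mG G2].
have mf1 : measurable_fun (D : set mplane) (f1 : mplane -> measurableTypeR R).
  by apply: plane_continuous_measurable => //; exact: open_disk.
have itest h : test_function h -> mu.-integrable D (EFin \o (fun x => f1 x * h x)).
  move=> /test_functionP[ch _ _ [S [cS SD _ hS]]].
  by apply: (integrable_supported cf1 ch cS SD) => x /hS[].
have E : ae_eq mu D (EFin \o (fun x => G x - f1 x)) (cst 0%E).
  apply: fundamental_lemma.
  - exact: measurable_funB.
  - move=> m.
    have i1 := integrable_mul_bounded iG (@continuous_seval _ (scut R m)).
    have i2 := itest _ (scut_test (SCst 1) m).
    have := integrableB (@measurable_disk R) i1 i2.
    apply: eq_integrable; first exact: measurable_disk.
    move=> x _; rewrite /= -/(seval (scut R m) x) mul1r -EFinB -mulrBl//.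
  - move=> h th; have [ch _ _ _] := test_functionP th.
    under eq_Rintegral do rewrite mulrBl.
    rewrite RintegralB; [|exact: measurable_disk|exact: integrable_mul_bounded|exact: itest].
    have := wG h th; rewrite (wf1 h th) => /oppr_inj ->; exact: subrr.
apply/in_L2P; split => //.
rewrite (_ : (\int[mu]_(x in D) (f1 x ^+ 2)%:E = \int[mu]_(x in D) (G x ^+ 2)%:E)%E)//.
apply: ae_eq_integral => //.
- exact: measurable_disk.
- by apply/measurable_EFinP; exact: measurable_funX.
- by apply/measurable_EFinP; exact: measurable_funX.
by apply: filterS E => x /= h /h /eqP; rewrite eqe subr_eq0 => /eqP ->.
Qed.

Definition C1_disk (f : plane -> R) (f1 : 'I_2 -> plane -> R) :=
  forall x, disk x -> [/\ {for x, continuous f},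
    forall i, {for x, continuous (f1 i)} & forall i, is_derive x (axis R i) f (f1 i x)].

Lemma continuous_coord (u : plane -> space) (x : plane) k :
  {for x, continuous u} -> {for x, continuous (fun y => u y 0 k)}.
Proof.
move=> cu; apply: (continuous_comp (f := u) (g := fun M : space => M 0 k)) => //.
exact: coord_continuous.
Qed.

Definition ucoord (u : plane -> space) (k : 'I_4) : plane -> R := fun x => u x 0 k.
Definition ucoord1 (u : plane -> space) (k : 'I_4) (i : 'I_2) : plane -> R :=
  fun x => 'D_(axis R i) u x 0 k.
Definition ucoord2 (u : plane -> space) (k : 'I_4) (i : 'I_2) : plane -> R :=
  fun x => 'D_(axis R i) (fun y => 'D_(axis R i) u y) x 0 k.

Lemma is_derive_coord (u : plane -> space) (x v : plane) k : derivable u x v ->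
  is_derive x v (fun y => u y 0 k) ('D_v u x 0 k).
Proof.
move=> du; apply: DeriveDef; first by move/derivable_mxP : du; apply.
by rewrite derive_mx// mxE.
Qed.

Lemma harmonic_coord (u : plane -> space) k : harmonic_on_disk u ->
  [/\ C1_disk (ucoord u k) (ucoord1 u k),
      twice_derivable (ucoord u k) (ucoord1 u k) (ucoord2 u k) &
      forall x, sqn x < 1 -> ucoord2 u k 0 x + ucoord2 u k 1 x = 0].
Proof.
move=> [[cu h] hu]; split.
- move=> x xD; split.
  + by apply: continuous_coord; exact: cu.
  + move=> i; have [_ [c _]] := h i.
    by apply: continuous_coord; exact: c.
  + by move=> i; have [d _] := h i; apply: is_derive_coord; exact: d.
- move=> x xD i; have [d [_ d2]] := h i; split.
    by apply: is_derive_coord; exact: d.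
  by have [d2' _] := d2 i; apply: is_derive_coord; exact: d2'.
- by move=> x xD; have := hu x xD; rewrite sum2 => /rowP/(_ k); rewrite !mxE.
Qed.

Lemma W12_grad_C1 (u : plane -> space) (U : 'I_2 -> plane -> space) :
  (forall k, C1_disk (fun x => u x 0 k) (fun i x => U i x 0 k)) ->
  (forall k, in_L2 (fun x => u x 0 k)) -> (forall k i, in_L2 (fun x => U i x 0 k)) ->
  W12_grad u U.
Proof.
move=> C1 Lu LU k; split => // i; split => //.
apply: weak_partial_C1 => x xD; have [c c1 d] := C1 k x xD.
- exact: c.
- exact: c1.
- exact: d.
Qed.

Lemma harmonic_W12_grad (u : plane -> space) : harmonic_on_disk u -> W12 u ->
  W12_grad u (fun i x => 'D_(axis R i) u x).
Proof.
move=> hu [G WG]; apply: W12_grad_C1.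
- by move=> k; have [] := harmonic_coord k hu.
- by move=> k; have [] := WG k.
- move=> k i; have [_ /(_ i)[LG wG]] := WG k.
  have [C1 _ _] := harmonic_coord k hu.
  apply: (weak_partial_unique _ _ _ LG wG) => x xD; have [c c1 d] := C1 x xD.
  + exact: c.
  + exact: c1.
  + exact: d.
Qed.

End ClassicalGradient.

(** * A uniform energy bound *)

Section EnergyBound.
Variable R : realType.
Local Notation plane := (R * R)%type.
Local Notation mplane := (measurableTypeR R * measurableTypeR R)%type.
Local Notation space := 'rV[R]_4.
Local Notation mu := (@area_measure R).
Local Notation D := (@disk R).

Definition lift_weight (eps : R) (k : 'I_4) : R := if (k < 2)%N then 1 else eps.

(** Shrinking the last two coordinates by eps maps the lifted curve of
    parameter 1 onto that of parameter eps, hence spanning maps onto spanning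
    maps. *)
Definition flatten_lift (eps : R) (v : plane -> space) (x : plane) : space :=
  \row_k (lift_weight eps k * v x 0 k).

Lemma lifted_flatten gamma (eps : R) p :
  lifted gamma eps p = \row_k (lift_weight eps k * lifted gamma 1 p 0 k).
Proof.
apply/rowP => k; rewrite !mxE /lift_weight.
by case: k => -[|[|[|[|//]]]] h /=; rewrite !mul1r.
Qed.

Lemma continuous_within_row (A : set plane) (f : plane -> space) :
  (forall k, {within A, continuous (fun x => f x 0 k)}) -> {within A, continuous f}.
Proof.
move=> cf; apply/subspace_continuousP => x Ax.
apply/cvgrPdist_le => e e0.
rewrite near_withinE.
have h k : \forall y \near x, A y -> `|f x 0 k - f y 0 k| <= e.
  have := cf k; move/subspace_continuousP => /(_ x Ax) /cvgrPdist_le /(_ e e0).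
  by rewrite near_withinE.
near=> y => Ay.
have hy : forall k, `|f x 0 k - f y 0 k| <= e.
  by move=> k; move: Ay; move: k; near: y; apply: filter_forall => k; exact: h.
rewrite /Num.norm /= mx_normrE (bigmax_le _ (ltW e0))// => -[i k] _ /=.
by rewrite ord1 !mxE; exact: hy.
Unshelve. all: by end_near. Qed.

Lemma within_coord (A : set plane) (f : plane -> space) k :
  {within A, continuous f} -> {within A, continuous (fun x => f x 0 k)}.
Proof.
move=> /subspace_continuousP cf; apply/subspace_continuousP => x Ax.
have cc : (fun M : space => M 0 k : R) @ nbhs (f x) --> (f x 0 k : R).
  exact: coord_continuous.
exact: (cvg_comp _ _ (cf x Ax) cc).
Qed.

Lemma sqnormE (a : space) : sqnorm a = \sum_k a 0 k ^+ 2.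
Proof. by apply: eq_bigr => k _; rewrite expr2. Qed.

Lemma sqnorm_ge0 (a : space) : 0 <= sqnorm a.
Proof. by rewrite sqnormE sumr_ge0// => k _; exact: sqr_ge0. Qed.

Lemma sqnorm_coord (a : space) k : a 0 k ^+ 2 <= sqnorm a.
Proof.
by rewrite sqnormE (bigD1 k)//= lerDl sumr_ge0// => j _; exact: sqr_ge0.
Qed.

Lemma measurable_sqnorm (f : plane -> space) :
  (forall k, measurable_fun (D : set mplane) (fun x : mplane => f x 0 k : measurableTypeR R)) ->
  measurable_fun (D : set mplane) (fun x : mplane => sqnorm (f x) : measurableTypeR R).
Proof.
move=> mf; under eq_fun do rewrite sqnormE.
by apply: measurable_sum => k; apply: measurable_funX; exact: mf.
Qed.

Lemma measurable_dot (f g : plane -> space) :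
  (forall k, measurable_fun (D : set mplane) (fun x : mplane => f x 0 k : measurableTypeR R)) ->
  (forall k, measurable_fun (D : set mplane) (fun x : mplane => g x 0 k : measurableTypeR R)) ->
  measurable_fun (D : set mplane) (fun x : mplane => dot (f x) (g x) : measurableTypeR R).
Proof.
move=> mf mg; rewrite /dot.
by apply: measurable_sum => k; apply: measurable_funM; [exact: mf|exact: mg].
Qed.

(** |a /\ b| <= |a| |b| <= (|a|^2 + |b|^2) / 2. *)
Lemma area_integrand_le (a b : space) :
  Num.sqrt (sqnorm a * sqnorm b - dot a b ^+ 2) <= (sqnorm a + sqnorm b) / 2.
Proof.
have h0 : 0 <= (sqnorm a + sqnorm b) / 2 by rewrite divr_ge0// addr_ge0// sqnorm_ge0.
rewrite -[leRHS]ger0_norm// -sqrtr_sqr; apply: ler_wsqrtr.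
have := sqr_ge0 (sqnorm a - sqnorm b); have := sqr_ge0 (dot a b); nra.
Qed.

Lemma area_integrand_conformal (a b : space) : sqnorm a = sqnorm b -> dot a b = 0 ->
  Num.sqrt (sqnorm a * sqnorm b - dot a b ^+ 2) = sqnorm b.
Proof. by move=> -> ->; rewrite expr0n subr0 -expr2 sqrtr_sqr ger0_norm// sqnorm_ge0. Qed.

Lemma weight_le (eps : R) k : 0 < eps <= 1 -> 0 <= lift_weight eps k <= 1.
Proof.
by move=> /andP[e0 e1]; rewrite /lift_weight; case: ifP => _; rewrite ?ler01 ?lexx// (ltW e0).
Qed.

Lemma in_L2_scale (c : R) (f : plane -> R) : in_L2 f -> in_L2 (fun x => c * f x).
Proof.
move=> /in_L2P[mf fi]; apply/in_L2P; split; first exact: measurable_funM.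
have E x : ((c * f x) ^+ 2)%:E = ((c ^+ 2)%:E * (f x ^+ 2)%:E)%E by rewrite exprMn.
under eq_integral do rewrite E.
rewrite ge0_integralZl//.
- by rewrite lte_mul_pinfty// lee_fin sqr_ge0.
- exact: measurable_disk.
- by apply/measurable_EFinP; exact: measurable_funX.
- by move=> x _; rewrite lee_fin sqr_ge0.
- by rewrite lee_fin sqr_ge0.
Qed.

Lemma integrable_sqnorm (f : plane -> space) : (forall k, in_L2 (fun x => f x 0 k)) ->
  mu.-integrable D (EFin \o (fun x => sqnorm (f x))).
Proof.
move=> Lf.
have ik k := in_L2_sqr (Lf k).
have := @integrable_sum _ _ _ mu D (@measurable_disk R) _ (index_enum 'I_4) xpredT (fun k => EFin \o (fun x => f x 0 k ^+ 2)) (fun k _ => ik k).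
apply: eq_integrable; first exact: measurable_disk.
by move=> x _; rewrite /= sqnormE sumEFin.
Qed.

(** The image of u 1 by the contraction flatten_lift eps is a competitor for
    u eps.  By conformality the area of u eps is its energy, so
    E(u eps) = A(u eps) <= A(flattened u 1) <= E(flattened u 1) <= E(u 1). *)
Lemma energy_bound (gamma : plane -> plane) (u : R -> plane -> space) :
  (forall eps : R, 0 < eps <= 1 -> douglas_minimizer (lifted gamma eps) (u eps)) ->
  exists M : R, forall eps : R, 0 < eps <= 1 -> forall k i,
    (\int[mu]_(x in D) (ucoord1 (u eps) k i x ^+ 2)%:E <= M%:E)%E.
Proof.
move=> umin.
have e1 : 0 < (1 : R) <= 1 by rewrite ltr01 lexx.
have [[cu1 W1 [phi [cphi sphi mphi u1phi]]] hu1 _ _] := umin 1 e1.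
have WD1 := harmonic_W12_grad hu1 W1.
pose U1 (i : 'I_2) (x : plane) := 'D_(axis R i) (u 1) x.
pose E1 : \bar R := (\int[mu]_(x in D) ((sqnorm (U1 0 x) + sqnorm (U1 1 x)) / 2)%:E)%E.
have mU (v : plane -> space) i k : harmonic_on_disk v ->
    measurable_fun (D : set mplane) (fun x : mplane => ('D_(axis R i) v x) 0 k : measurableTypeR R).
  move=> hv; apply: plane_continuous_measurable; first exact: open_disk.
  by move=> x xD; have [C1 _ _] := harmonic_coord k hv; have [_ c _] := C1 x xD; exact: c.
have E1fin : (E1 < +oo)%E.
  have i0 := integrable_sqnorm (fun k => ((WD1 k).2 0).1).
  have i1 := integrable_sqnorm (fun k => ((WD1 k).2 1).1).
  have := integrableZl (@measurable_disk R) (2^-1) (integrableD (@measurable_disk R) i0 i1).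
  move=> /integrableP[_]; apply: le_lt_trans; rewrite le_eqVlt; apply/orP; left; apply/eqP.
  apply: eq_integral => x _; rewrite /= ger0_norm; first by rewrite mulrC.
  by rewrite mulr_ge0 ?invr_ge0// addr_ge0// sqnorm_ge0.
have E10 : (0 <= E1)%E.
  by apply: integral_ge0 => x _; rewrite lee_fin divr_ge0// addr_ge0// sqnorm_ge0.
exists (fine E1) => eps eps01 k i.
have [[cu Wu _] hu conf min] := umin eps eps01.
have WD := harmonic_W12_grad hu Wu.
pose v := flatten_lift eps (u 1).
pose V (i : 'I_2) (x : plane) : space := \row_k (lift_weight eps k * U1 i x 0 k).
have WV : W12_grad v V.
  apply: W12_grad_C1.
  - move=> j x xD; have [C1 _ _] := harmonic_coord j hu1; have [c c1 d] := C1 x xD.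
    have Ev : (fun x => v x 0 j) = (fun x => lift_weight eps j * ucoord (u 1) j x).
      by apply/funext => y; rewrite mxE.
    have EV l : (fun x => V l x 0 j) = (fun x => lift_weight eps j * ucoord1 (u 1) j l x).
      by apply/funext => y; rewrite mxE.
    split.
    + by rewrite Ev; apply: cvgM; [exact: cvg_cst|exact: c].
    + by move=> l; rewrite EV; apply: cvgM; [exact: cvg_cst|exact: c1].
    + move=> l; rewrite Ev; have dl := d l.
      rewrite (_ : V l x 0 j = lift_weight eps j * ucoord1 (u 1) j l x); last by rewrite mxE.
      by apply: is_derive_eq; rewrite /GRing.scale /= ?mulr0 ?addr0.
  - move=> j; have [L _] := WD1 j; have := in_L2_scale (lift_weight eps j) L.
    by congr in_L2; apply/funext => x; rewrite mxE.
  - move=> j l; have [_ /(_ l)[L _]] := WD1 j; have := in_L2_scale (lift_weight eps j) L.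
    by congr in_L2; apply/funext => x; rewrite mxE.
have sv : spans (lifted gamma eps) v.
  split.
  - apply: continuous_within_row => j.
    rewrite (_ : (fun x => _) = (fun x => lift_weight eps j * u 1 x 0 j)); last first.
      by apply/funext => y; rewrite mxE.
    apply/subspace_continuousP => x Ax; apply: cvgM; first exact: cvg_cst.
    by have := within_coord (k := j) cu1; move/subspace_continuousP => /(_ x Ax).
  - by exists V.
  - exists phi; split => // x xc.
    by rewrite lifted_flatten -u1phi.
have aU : (area (fun i x => 'D_(axis R i) (u eps) x) <= area V)%E by exact: (min v).
have mUk i' k' : measurable_fun (D : set mplane) (fun x : mplane => U1 i' x 0 k' : measurableTypeR R).
  exact: mU.
have mV i' k' : measurable_fun (D : set mplane) (fun x : mplane => V i' x 0 k' : measurableTypeR R).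
  rewrite (_ : (fun x => _) = (fun x => lift_weight eps k' * U1 i' x 0 k')).
    by apply: measurable_funM => //; exact: mUk.
  by apply/funext => x; rewrite mxE.
have sVU i' x : sqnorm (V i' x) <= sqnorm (U1 i' x).
  rewrite !sqnormE; apply: ler_sum => k' _; rewrite mxE exprMn ler_piMl ?sqr_ge0//.
  by have /andP[w0 w1] := weight_le k' eps01; rewrite expr_le1.
have aV : (area V <= E1)%E.
  apply: ge0_le_integral => //.
  - exact: measurable_disk.
  - apply/measurable_EFinP; apply: measurableT_comp.
      by apply: continuous_measurable_fun; exact: sqrt_continuous.
    apply: measurable_funB; last by apply: measurable_funX; apply: measurable_dot => k'; exact: mV.
    by apply: measurable_funM; apply: measurable_sqnorm => k'; exact: mV.
  - apply/measurable_EFinP; apply: measurable_funM => //.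
    by apply: measurable_funD; apply: measurable_sqnorm => k'; exact: mUk.
  - move=> x _; rewrite lee_fin; apply: (le_trans (area_integrand_le _ _)).
    by rewrite ler_pM2r// lerD.
(* This is where conformality is used: the area integrand is the common value
   of the squared norms of the two partial derivatives. *)
have Ea : area (fun i x => 'D_(axis R i) (u eps) x) =
   (\int[mu]_(x in D) (sqnorm ('D_(axis R i) (u eps) x))%:E)%E.
  apply: eq_integral => x; rewrite inE => xD; congr EFin.
  have [s01 d01] := conf x xD; rewrite (area_integrand_conformal s01 d01).
  by move: i; apply: I2_ind; [exact: esym s01|reflexivity].
rewrite fineK; last by rewrite ge0_fin_numE.
apply: le_trans (le_trans aU aV); rewrite Ea.
apply: ge0_le_integral => //.
- exact: measurable_disk.
- by move=> x _; rewrite lee_fin sqr_ge0.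
- by apply/measurable_EFinP; apply: measurable_funX; exact: mU.
- by apply/measurable_EFinP; apply: measurable_sqnorm => j; exact: mU.
- by move=> x _; rewrite lee_fin; exact: sqnorm_coord.
Qed.

End EnergyBound.

(** * Compactness of monotone parametrizations *)

Section Helly.
Variable R : realType.
Local Notation plane := (R * R)%type.

(** The lifts to the line of the monotone maps of the circle that wrap once
    around; they may jump. *)
Definition degree_one (W : R -> R) :=
  (forall s t, s <= t -> W s <= W t) /\ (forall t, W (t + 2 * pi) = W t + 2 * pi).

Lemma circ_int (t : R) (m : int) : circ (t + 2 * pi * m%:~R) = circ t.
Proof.
have nat_case (s : R) (n : nat) : circ (s + 2 * pi * n%:R) = circ s.
  elim: n s => [|n ih] s; first by rewrite mulr0 addr0.
  have -> : s + 2 * pi * n.+1%:R = s + 2 * pi * n%:R + 2 * pi by rewrite -natr1; ring.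
  by rewrite circ_periodic ih.
case: m => n; first exact: nat_case.
have -> : t = t + 2 * pi * (Negz n)%:~R + 2 * pi * n.+1%:R by rewrite NegzE mulrNz; ring.
rewrite nat_case; congr circ; by rewrite NegzE mulrNz; ring.
Qed.

(** The bound 2 pi on the oscillation over one period is what makes the
    extension nondecreasing across multiples of 2 pi. *)
Lemma degree_one_extend (w : R -> R) :
  {in `[0, 2 * pi[ &, {homo w : s t / s <= t}} ->
  {in `[0, 2 * pi[ &, forall s t, w s - w t <= 2 * pi} ->
  exists2 W : R -> R, degree_one W &
    forall t, exists s m, [/\ s \in `[0, 2 * pi[, t = s + 2 * pi * m%:~R &
      W t = w s + 2 * pi * m%:~R].
Proof.
move=> wn wo.
have pi2 : 0 < 2 * pi :> R by rewrite mulr_gt0// pi_gt0.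
pose k (t : R) : int := Num.floor (t / (2 * pi)).
pose r t := t - 2 * pi * (k t)%:~R.
have rP t : r t \in `[0, 2 * pi[.
  have /andP[h1 h2] := floor_itv (t / (2 * pi)).
  rewrite ler_pdivlMr// in h1; rewrite ltr_pdivrMr// intrD mulrDl mul1r in h2.
  rewrite in_itv /= /r /k subr_ge0 ltrBlDl; apply/andP; split; lra.
have tE t : t = r t + 2 * pi * (k t)%:~R by rewrite /r subrK.
have kD t : k (t + 2 * pi) = k t + 1.
  rewrite /k mulrDl divff ?lt0r_neq0// floorDrz ?rpred1// floor1//.
exists (fun t => w (r t) + 2 * pi * (k t)%:~R); last first.
  by move=> t; exists (r t), (k t).
split=> [s t st|t]; last first.
  rewrite kD /r kD intrD.
  have -> : t + 2 * pi - 2 * pi * ((k t)%:~R + 1%:~R) = t - 2 * pi * (k t)%:~R by ring.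
  by ring.
have : k s <= k t by apply: le_floor; rewrite ler_pM2r// invr_gt0.
rewrite le_eqVlt => /predU1P[E|].
  by rewrite E lerD2r; apply: wn => //; rewrite /r E lerD2r.
rewrite -lezD1 -(ler_int R) intrD => kst.
have h := wo _ _ (rP s) (rP t).
have : 2 * pi * ((k s)%:~R + 1) <= 2 * pi * (k t)%:~R :> R by rewrite ler_pM2l.
by rewrite mulrDr mulr1; lra.
Qed.

(** A nonincreasing parametrization is the opposite of a nondecreasing one;
    the sign sg records the orientation.  Subtracting a multiple of 2 pi
    normalizes W 0, which makes families of lifts locally bounded. *)
Lemma monotone_param_lift (phi : plane -> plane) : monotone_param phi ->
  exists sg W, [/\ sg = 1 \/ sg = -1, degree_one W, 0 <= W 0 < 2 * pi &
    forall t, phi (circ t) = circ (sg * W t)].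
Proof.
move=> [w [wmono wosc phiw]].
have pi2 : 0 < 2 * pi :> R by rewrite mulr_gt0// pi_gt0.
have osc : {in `[0, 2 * pi[ &, forall s t, w s - w t <= 2 * pi}.
  move=> s t sI tI; rewrite -lee_fin EFinB; apply: le_trans wosc; apply: leeB.
    by apply: ereal_sup_ubound; exists s.
  by apply: ereal_inf_lbound; exists t.
have [sg [w' [sg1 w'n w'o w'w]]] : exists sg w', [/\ sg = 1 \/ sg = -1,
    {in `[0, 2 * pi[ &, {homo w' : s t / s <= t}},
    {in `[0, 2 * pi[ &, forall s t, w' s - w' t <= 2 * pi} & forall t, w t = sg * w' t].
  case: wmono => wm.
    by exists 1, w; split => //; [left|move=> t; rewrite mul1r].
  exists (-1), (fun t => - w t); split; first by right.
  - by move=> s t sI tI st; rewrite lerN2; exact: wm.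
  - by move=> s t sI tI; rewrite opprK addrC; exact: osc.
  - by move=> t; rewrite mulN1r opprK.
have [W [Wn Wp] WE] := degree_one_extend w'n w'o.
pose m : int := Num.floor (W 0 / (2 * pi)).
have csg s (n : int) : circ (sg * (s + 2 * pi * n%:~R)) = circ (sg * s).
  rewrite mulrDr; case: sg1 => ->; first by rewrite !mul1r circ_int.
  by rewrite !mulN1r -mulrN -mulrNz circ_int.
exists sg, (fun t => W t + 2 * pi * (- m)%:~R); split => //.
- split=> [s t st|t]; first by rewrite lerD2r; exact: Wn.
  by rewrite Wp; ring.
- have /andP[h1 h2] := floor_itv (W 0 / (2 * pi)).
  rewrite ler_pdivlMr// in h1; rewrite ltr_pdivrMr// intrD mulrDl mul1r in h2.
  rewrite mulrNz -/m in h1 h2 *; apply/andP; split; lra.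
move=> t; have [s [n [sI -> ->]]] := WE t.
by rewrite csg csg circ_int phiw// w'w.
Qed.

Lemma increasing_ge_id (f : nat -> nat) : increasing_seq f -> forall n, (n <= f n)%N.
Proof.
move=> fi; elim=> // n ih; apply: (leq_ltn_trans ih).
by have := (increasing_seqP f).2 fi n.
Qed.

Lemma increasing_comp (f g : nat -> nat) : increasing_seq f -> increasing_seq g ->
  increasing_seq (f \o g).
Proof. by move=> fi gi m n; rewrite /comp; exact: etrans (fi _ _) (gi m n). Qed.

Lemma diagonal_subsequence (x : nat -> nat -> R) :
  (forall q, bounded_fun (x q)) ->
  exists2 f : nat -> nat, increasing_seq f & forall q, cvgn (x q \o f).
Proof.
move=> bx.
have step (s : nat * (nat -> nat)) : {s' : nat * (nat -> nat) |
    s'.1 = s.1.+1 /\ exists h : nat -> nat, [/\ increasing_seq h, s'.2 = s.2 \o h & cvgn (x s.1 \o s'.2)]}.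
  have bxs : bounded_fun (x s.1 \o s.2).
    have [M [Mr hM]] := bx s.1; exists M; split => // N MN n _.
    exact: hM.
  have [h hi hc] := cid2 (bolzano_weierstrass bxs).
  by exists (s.1.+1, s.2 \o h); split => //; exists h; split.
have [S [S0 SS]] := dependent_choice step (0%N, id).
have S1 n : (S n).1 = n by elim: n => [|n ih]; [rewrite S0|have [-> _] := SS n; rewrite ih].
have comp m n : (m <= n)%N -> exists h, increasing_seq h /\ (S n).2 = (S m).2 \o h.
  elim: n => [|n ih].
    by rewrite leqn0 => /eqP ->; exists id; split.
  rewrite leq_eqVlt => /predU1P[->|]; first by exists id; split.
  rewrite ltnS => /ih[h [hi E]]; have [_ [h' [h'i E' _]]] := SS n.
  by exists (h \o h'); split; [exact: increasing_comp|rewrite E' E].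
have Si n : increasing_seq (S n).2.
  by have [h [hi ->]] := comp 0%N n (leq0n n); rewrite S0.
exists (fun n => (S n).2 n).
  apply/increasing_seqP => n; have [_ [h [hi -> _]]] := SS n => /=.
  rewrite ltEnat /=; have := Si n; have := increasing_ge_id hi n.+1 => hn /(_ (h n.+1) n).
  by rewrite ltnNge -leEnat => ->; rewrite leEnat -ltnNge.
move=> q; have [_ [_ [_ _ cq]]] := SS q; rewrite S1 in cq.
have [l cl] := (cvg_ex _).1 cq.
apply/cvg_ex; exists l; apply/cvgrPdist_le => e e0.
move/cvgrPdist_le : cl => /(_ e e0)[N _ hN].
exists (maxn N q.+1) => // n /=; rewrite geq_max => /andP[Nn qn].
have [h [hi ->]] := comp _ _ qn.
apply: hN => /=; exact: (leq_trans Nn (increasing_ge_id hi n)).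
Qed.

Lemma rat_between (a b : R) : a < b -> exists q : rat, a < ratr q < b.
Proof.
move=> ab; have [q] := rat_in_itvoo ab; rewrite in_itv /= => h; by exists q.
Qed.

(** For a nondecreasing w this is continuity from the left. *)
Definition left_continuous_at (w : R -> R) (t : R) :=
  forall e, 0 < e -> exists2 s, s < t & w t - e <= w s.

(** The jumps are disjoint open intervals, each of which contains a rational. *)
Lemma countable_left_jumps (w : R -> R) : (forall s t, s <= t -> w s <= w t) ->
  countable [set t | ~ left_continuous_at w t].
Proof.
move=> wn; pose P t (q : rat) := (forall s, s < t -> w s < ratr q) /\ ratr q < w t.
have ex t : ~ left_continuous_at w t -> exists q, P t q.
  move=> /existsNP[e /not_implyP[e0 /forall2NP h]].
  have [|q /andP[q1 q2]] := @rat_between (w t - e) (w t); first lra.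
  exists q; split => // s st; apply: lt_trans q1.
  by have [//|/negP] := h s; rewrite -ltNge.
apply/countable_injP.
exists (fun t => pickle (xget 0 (P t))) => s t; rewrite !inE => /ex es /ex et.
have [ys1 ys2] : P s (xget 0 (P s)) := xgetPex 0 es.
have [yt1 yt2] : P t (xget 0 (P t)) := xgetPex 0 et.
move=> /(pcan_inj pickleK) E.
have [st|st|//] := ltgtP s t.
- by have := yt1 s st; rewrite -E ltNge (ltW ys2).
- by have := ys1 t st; rewrite E ltNge (ltW yt2).
Qed.

Lemma degree_one_nat W (t : R) (n : nat) : degree_one W ->
  W (t + 2 * pi * n%:R) = W t + 2 * pi * n%:R.
Proof.
move=> [_ Wp]; elim: n => [|n ih]; first by rewrite mulr0 !addr0.
have -> : t + 2 * pi * n.+1%:R = t + 2 * pi * n%:R + 2 * pi by rewrite -natr1; ring.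
by rewrite Wp ih -natr1; ring.
Qed.

Lemma degree_one_bound (t : R) : exists M, forall W, degree_one W -> 0 <= W 0 < 2 * pi ->
  `|W t| <= M.
Proof.
have pi2 : 0 < 2 * pi :> R by rewrite mulr_gt0// pi_gt0.
have [n tn] : exists n : nat, `|t| <= 2 * pi * n%:R.
  exists (Num.bound (`|t| / (2 * pi))).
  rewrite mulrC -ler_pdivrMr//; apply: ltW; apply: archi_boundP.
  by rewrite divr_ge0// ltW.
exists (2 * pi + 2 * pi * n%:R) => W dW /andP[W0 W2].
have [Wn _] := dW.
move: tn; rewrite !ler_norml => /andP[t1 t2].
have := Wn _ _ t2; have := Wn _ _ t1.
have := degree_one_nat 0 n dW; rewrite add0r => ->.
have := degree_one_nat (- (2 * pi * n%:R)) n dW; rewrite addNr => h h1 h2.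
apply/andP; split; lra.
Qed.

(** Helly's selection principle, together with the convergence of the
    orientations.  A diagonal subsequence converges at all rational multiples
    of 2 pi; the limit w is the infimum of these limits from the right, hence
    right-continuous, and monotonicity squeezes W (f j) t at every t where w
    is left-continuous too. *)
Theorem helly (sg : nat -> R) (W : nat -> R -> R) :
  (forall n, sg n = 1 \/ sg n = -1) ->
  (forall n, degree_one (W n)) -> (forall n, 0 <= W n 0 < 2 * pi) ->
  exists (f : nat -> nat) (s : R) (w : R -> R), [/\ increasing_seq f, (s = 1 \/ s = -1) /\ sg (f j) @[j --> \oo] --> s,
    degree_one w,
    forall t e, 0 < e -> exists2 d, 0 < d & forall s, s < t + d -> w s <= w t + e &
    forall t, left_continuous_at w t -> W (f j) t @[j --> \oo] --> w t].
Proof.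
move=> sg1 dW W0.
have pi2 : 0 < 2 * pi :> R by rewrite mulr_gt0// pi_gt0.
(* The sequence of index 0 is that of the orientations; the others are the
   values at an enumeration of the rational multiples of 2 pi. *)
pose x i n := if i is j.+1 then
   (if (unpickle j : option rat) is Some q then W n (2 * pi * ratr q) else 0) else sg n.
have bx i : bounded_fun (x i).
  have [M hM] : exists M, forall n, `|x i n| <= M.
    case: i => [|j] /=.
      by exists 1 => n; case: (sg1 n) => ->; rewrite ?normrN normr1.
    case: (unpickle j) => [q|]; last by exists 0 => n; rewrite normr0.
    by have [M hM] := degree_one_bound (2 * pi * ratr q); exists M => n; exact: hM.
  exists M; split; first exact: num_real.
  by move=> N MN n _ /=; exact: le_trans (hM n) (ltW MN).
have [f fi fc] := diagonal_subsequence bx.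
pose L (q : rat) := lim (W (f j) (2 * pi * ratr q) @[j --> \oo]).
have cL q : W (f j) (2 * pi * ratr q) @[j --> \oo] --> L q.
  have E : x (pickle q).+1 \o f = (fun j => W (f j) (2 * pi * ratr q)).
    apply/funext => j.
    rewrite -[LHS]/(if (unpickle (pickle q) : option rat) is Some q
      then W (f j) (2 * pi * ratr q) else 0).
    by rewrite pickleK.
  by have := fc (pickle q).+1; rewrite E.
have L1 q q' : (ratr q : R) <= ratr q' -> L q <= L q'.
  move=> qq; apply: (ler_cvg_to (cL q) (cL q')); apply: nearW => j.
  by have [h _] := dW (f j); apply: h; rewrite ler_pM2l.
have L2 q : L (q + 1) = L q + 2 * pi.
  apply: cvg_lim => //.
  rewrite (_ : (fun j => _) = (fun j => W (f j) (2 * pi * ratr q) + 2 * pi)).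
    by apply: cvgD; [exact: cL|exact: cvg_cst].
  apply/funext => j; have [_ h] := dW (f j).
  by rewrite rmorphD rmorph1 mulrDr mulr1 h.
(* The strict inequality makes the infimum w right-continuous. *)
pose E (t : R) := [set L q | q in [set q | t < 2 * pi * ratr q]].
pose w (t : R) := inf (E t).
have q_above (a b : R) : a < b -> exists q : rat, a < 2 * pi * ratr q < b.
  move=> ab; have [|q /andP[q1 q2]] := @rat_between (a / (2 * pi)) (b / (2 * pi)).
    by rewrite ltr_pM2r// invr_gt0.
  exists q; rewrite -ltr_pdivrMl// -[_ * _ < b]ltr_pdivlMl//.
  by rewrite ![(2 * pi)^-1 * _]mulrC q1.
have F4' t q : 2 * pi * ratr q <= t -> lbound (E t) (L q).
  move=> qt _ [q' /= tq' <-]; apply: L1.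
  by rewrite -(ler_pM2l pi2); exact: le_trans qt (ltW tq').
have E0 t : has_inf (E t).
  split.
    have [|q /andP[tq _]] := q_above t (t + 1); first lra.
    by exists (L q), q.
  have [|q /andP[_ qt]] := q_above (t - 1) t; first lra.
  by exists (L q); apply: F4'; exact: ltW.
have F3 t q : t < 2 * pi * ratr q -> w t <= L q.
  by move=> tq; apply: inf_lbound; [have [_] := E0 t|exists q].
have F4 t q : 2 * pi * ratr q <= t -> L q <= w t.
  by move=> qt; apply: lb_le_inf; [have [] := E0 t|exact: F4'].
have F5 t e : 0 < e -> exists2 q, t < 2 * pi * ratr q & L q < w t + e.
  by move=> e0; have [_ [q tq <-] h] := inf_adherent e0 (E0 t); exists q.
have wn s t : s <= t -> w s <= w t.
  move=> st; apply: lb_le_inf; first by have [] := E0 t.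
  by move=> _ [q /= tq <-]; apply: F3; exact: le_lt_trans tq.
have sgc : cvgn (sg \o f) by exact: (fc 0%N).
have [s cs] := (cvg_ex _).1 sgc.
exists f, s, w; split => //.
- split => //.
  have : s ^+ 2 = 1.
    have c2 : (fun j => sg (f j) * sg (f j)) @ \oo --> s * s by apply: cvgM.
    rewrite (_ : (fun j => _) = (fun=> 1)) in c2; last first.
      by apply/funext => j; case: (sg1 (f j)) => ->; rewrite ?mulr1 // mulrN1 opprK.
    by rewrite expr2; apply/esym; exact: (cvg_unique _ (cvg_cst _) c2).
  move/eqP; rewrite sqrf_eq1 => /orP[/eqP|/eqP]; by [left|right].
- split => // t; apply/le_anti/andP; split.
    apply/ler_addgt0Pr => e e0; have [q tq Lq] := F5 t e e0.
    apply: (@le_trans _ _ (L (q + 1))).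
      apply: F3; have -> : ratr (q + 1) = ratr q + 1 :> R by rewrite rmorphD rmorph1.
      have -> : 2 * pi * (ratr q + 1) = 2 * pi * ratr q + 2 * pi :> R by ring.
      by rewrite ltrD2r.
    by rewrite L2 addrAC lerD2r ltW.
  apply/ler_addgt0Pr => e e0; have [q tq Lq] := F5 (t + 2 * pi) e e0.
  have := L2 (q - 1); rewrite subrK => E1.
  have : w t <= L (q - 1).
    apply: F3; have -> : ratr (q - 1) = ratr q - 1 :> R by rewrite rmorphB rmorph1.
    have -> : 2 * pi * (ratr q - 1) = 2 * pi * ratr q - 2 * pi :> R by ring.
    by rewrite ltrBrDr.
  lra.
- move=> t e e0; have [q tq Lq] := F5 t e e0.
  exists (2 * pi * ratr q - t); first by rewrite subr_gt0.
  move=> r; rewrite addrC subrK => /F3 h; exact: le_trans h (ltW Lq).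
- move=> t lc; apply/cvgrPdist_le => e e0.
  have [q2 tq2 Lq2] := F5 t (e / 2) (divr_gt0 e0 (ltr0n _ 2)).
  have [r rt wr] := lc (e / 2) (divr_gt0 e0 (ltr0n _ 2)).
  have [q1 /andP[rq1 q1t]] := q_above r t rt.
  have wq1 := F3 _ _ rq1.
  have e2 : 0 < e / 2 by rewrite divr_gt0.
  have c1 := cL q1; move/cvgrPdist_le : c1 => /(_ _ e2) c1.
  have c2 := cL q2; move/cvgrPdist_le : c2 => /(_ _ e2) c2.
  near=> j.
  have [Wn _] := dW (f j).
  have k1 : `|L q1 - W (f j) (2 * pi * ratr q1)| <= e / 2 by near: j.
  have k2 : `|L q2 - W (f j) (2 * pi * ratr q2)| <= e / 2 by near: j.
  have := Wn _ _ (ltW q1t); have := Wn _ _ (ltW tq2).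
  move: k1 k2; rewrite !ler_norml => /andP[? ?] /andP[? ?] ? ?.
  by apply/andP; split; lra.
Unshelve. all: by end_near. Qed.

End Helly.

(** * Finite energy excludes jumps of the boundary data *)

Section NoJump.
Variable R : realType.
Local Notation plane := (R * R)%type.
Local Notation mplane := (measurableTypeR R * measurableTypeR R)%type.
Local Notation leb := (@lebesgue_measure R).
Local Notation mu := (@area_measure R).
Local Notation D := (@disk R).
Local Notation period := ([set` `[0, 2 * pi[%R] : set R).

(** The gradient of the Poisson kernel is bounded by 2 / |e^{it} - x|^2, that
    is by the kernel itself times 2 / (1 - |x|^2).  Hence data that are small
    near a boundary point p contribute little to the gradient, relative to
    the inverse of the distance to the circle (kint_diff_bound). *)
Lemma kdiff_PK_bound (i : 'I_2) (x : plane) t : sqn x < 1 ->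
  `|keval (kdiff i PK) x t| <= 2 / (1 - sqn x) * keval PK x t.
Proof.
move=> x1; rewrite PKE//.
have q0 : 0 < 1 - sqn x by rewrite subr_gt0.
have -> : 2 / (1 - sqn x) * ((1 - sqn x) / den x t) = 2 * (Ak x t ^+ 2 + Bk x t ^+ 2).
  rewrite AkBk//; have d0 := den_gt0 t x1; field; by rewrite !lt0r_neq0.
have key (c s P Q : R) : c ^+ 2 + s ^+ 2 = 1 ->
    (c * P + s * Q) ^+ 2 <= P ^+ 2 + Q ^+ 2.
  by move=> cs; have := sqr_ge0 (c * Q - s * P); nra.
set a := Ak x t; set b := Bk x t.
have h (c s : R) : c ^+ 2 + s ^+ 2 = 1 -> `|2 * (c * (a ^+ 2 - b ^+ 2) + s * (2 * (a * b)))| <= 2 * (a ^+ 2 + b ^+ 2).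
  move=> cs; rewrite normrM ger0_norm// ler_pM2l//.
  have ab0 : 0 <= a ^+ 2 + b ^+ 2 by rewrite addr_ge0// sqr_ge0.
  rewrite -[leRHS]ger0_norm// -ler_sqr ?nnegrE// !real_normK ?num_real//.
  rewrite (_ : (a ^+ 2 + b ^+ 2) ^+ 2 = (a ^+ 2 - b ^+ 2) ^+ 2 + (2 * (a * b)) ^+ 2); last by ring.
  exact: key.
elim/I2_ind: i.
- rewrite (_ : keval _ x t = 2 * (cos t * (a ^+ 2 - b ^+ 2) + sin t * (2 * (a * b)))); last first.
    by rewrite /= /a /b; ring.
  by apply: h; exact: cos2Dsin2.
- rewrite (_ : keval _ x t = 2 * ((- sin t) * (a ^+ 2 - b ^+ 2) + cos t * (2 * (a * b)))); last first.
    by rewrite /= /a /b; ring.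
  by apply: h; rewrite sqrrN addrC cos2Dsin2.
Qed.

Lemma kint_diff_bound (i : 'I_2) (x : plane) (g : R -> R) : sqn x < 1 -> bounded_data g ->
  `|kint (kdiff i PK) g x| <= 2 / (1 - sqn x) * (2 * pi * poisson (fun t => `|g t|) x).
Proof.
move=> x1 bg; have pi0 := @pi_gt0 R.
have q0 : 0 < 1 - sqn x by rewrite subr_gt0.
have -> : 2 * pi * poisson (fun t => `|g t|) x = kint PK (fun t => `|g t|) x.
  by rewrite /poisson mulrA mulfV ?mul1r// lt0r_neq0// mulr_gt0.
have bn := bounded_data_norm bg.
have ii := integrable_kg (kdiff i PK) bg x1.
have h := le_normr_Rintegral measurable_period ii.
apply: (le_trans h).
have ik := integrable_kg PK bn x1.
have E := RintegralZl (2 / (1 - sqn x)) measurable_period ik.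
rewrite -/(kint _ _ _) in E; rewrite -E.
apply: le_Rintegral => //.
- by have := integrable_norm ii; apply: eq_integrable.
- by have := integrableZl measurable_period (2 / (1 - sqn x)) ik; apply: eq_integrable.
by move=> t _; rewrite normrM mulrA ler_wpM2r// kdiff_PK_bound.
Qed.

(** A square of side s/4 whose centre is at distance s from the boundary point
    p, on the radius: its size is comparable to its distance to p and to the
    circle. *)
Definition square (p : plane) (s : R) : set plane :=
  `[(1 - s) * p.1 - s / 8, (1 - s) * p.1 + s / 8] `*`
  `[(1 - s) * p.2 - s / 8, (1 - s) * p.2 + s / 8].

Lemma squareP (p : plane) s x : sqn p = 1 -> 0 < s <= 8^-1 -> square p s x ->
  [/\ (x.1 - p.1) ^+ 2 + (x.2 - p.2) ^+ 2 <= 4 * s ^+ 2, s <= 1 - sqn x &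
      3 / 4 * s <= p.1 * (p.1 - x.1) + p.2 * (p.2 - x.2)].
Proof.
case: p x => [a b] [x y]; rewrite /sqn /square /= => ab /andP[s0 s8] [].
rewrite /= !in_itv /= => /andP[x1 x2] /andP[y1 y2].
pose z := x - (1 - s) * a; pose w := y - (1 - s) * b.
have zs : `|z| <= s / 8 by rewrite ler_norml /z; apply/andP; split; lra.
have ws : `|w| <= s / 8 by rewrite ler_norml /w; apply/andP; split; lra.
have xE : x = (1 - s) * a + z by rewrite /z; ring.
have yE : y = (1 - s) * b + w by rewrite /w; ring.
have a1 : `|a| <= 1 by rewrite -(@ler_sqr R) ?nnegrE// expr1n real_normK ?num_real//; have := sqr_ge0 b; lra.
have b1 : `|b| <= 1 by rewrite -(@ler_sqr R) ?nnegrE// expr1n real_normK ?num_real//; have := sqr_ge0 a; lra.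
have az : `|a * z| <= s / 8 by rewrite normrM -[leRHS]mul1r ler_pM.
have bw : `|b * w| <= s / 8 by rewrite normrM -[leRHS]mul1r ler_pM.
have z2 : z ^+ 2 <= (s / 8) ^+ 2 by rewrite -[z ^+ 2]real_normK ?num_real// ler_sqr ?nnegrE//; lra.
have w2 : w ^+ 2 <= (s / 8) ^+ 2 by rewrite -[w ^+ 2]real_normK ?num_real// ler_sqr ?nnegrE//; lra.
move: az bw; rewrite !ler_norml => /andP[az1 az2] /andP[bw1 bw2].
have P : a * (a - x) + b * (b - y) = s - (a * z + b * w).
  transitivity (s * (a ^+ 2 + b ^+ 2) - (a * z + b * w)); first by rewrite xE yE; ring.
  by rewrite ab mulr1.
have N : (x - a) ^+ 2 + (y - b) ^+ 2 = s ^+ 2 - 2 * s * (a * z + b * w) + (z ^+ 2 + w ^+ 2).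
  transitivity (s ^+ 2 * (a ^+ 2 + b ^+ 2) - 2 * s * (a * z + b * w) + (z ^+ 2 + w ^+ 2)).
    by rewrite xE yE; ring.
  by rewrite ab mulr1.
have h1 : (x - a) ^+ 2 + (y - b) ^+ 2 <= 4 * s ^+ 2.
  rewrite N; have : - (s * (a * z + b * w)) <= s * (s / 4).
    by rewrite -mulrN ler_pM2l//; lra.
  nra.
have h2 : 3 / 4 * s <= a * (a - x) + b * (b - y) by rewrite P; lra.
split => //.
have -> : 1 - (x ^+ 2 + y ^+ 2) = 2 * (a * (a - x) + b * (b - y)) - ((x - a) ^+ 2 + (y - b) ^+ 2).
  transitivity ((a ^+ 2 + b ^+ 2) - (x ^+ 2 + y ^+ 2)); first by rewrite ab.
  by ring.
have : s ^+ 2 <= s / 8 by rewrite expr2 ler_pM2l.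
lra.
Qed.

Lemma square_measure (p : plane) s : 0 < s -> mu (square p s) = ((s / 4) ^+ 2)%:E.
Proof.
move=> s0.
have -> : mu (square p s) = (leb [set` `[(1 - s) * p.1 - s / 8, (1 - s) * p.1 + s / 8]%R] *
   leb [set` `[(1 - s) * p.2 - s / 8, (1 - s) * p.2 + s / 8]%R])%E by exact: product_measure1E.
rewrite !lebesgue_measure_itv /= !lte_fin.
do 2 (rewrite ifT; last by lra).
by rewrite -!EFinD -EFinM; congr EFin; field.
Qed.

(** If g has different one-sided limits at t0, then the gradient of its Poisson
    integral is at least c / s at distance comparable to s from the jump.
    Write g as a step plus an error that is small near t0.  The tangential
    derivative of the Poisson integral of the step is explicit and of order
    1/s; the error contributes o(1/s) by kint_diff_bound.

    A step on the circle has two discontinuities, at the angles 0 and tau; t0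
    is the one under consideration and t1 the other one, far away. *)
Lemma jump_gradient (g : R -> R) (tau c1 c2 t0 t1 : R) : bounded_data g ->
  0 <= tau <= 2 * pi -> (t0 = 0 /\ t1 = tau) \/ (t0 = tau /\ t1 = 0) ->
  0 < den (circ t0) t1 -> c1 != c2 ->
  (forall e, 0 < e -> exists2 d, 0 < d & forall t, period t -> den (circ t0) t < d ->
     `|g t - (if t < tau then c1 else c2)| <= e) ->
  exists c s0, [/\ 0 < c, 0 < s0 <= 8^-1 & forall s x, 0 < s <= s0 -> square (circ t0) s x ->
    (c / s) ^+ 2 <= poisson1 g 0 x ^+ 2 + poisson1 g 1 x ^+ 2].
Proof.
move=> bg tau2 tt q0 c12 gstep.
have pi0 := @pi_gt0 R.
set p := circ t0 in q0 gstep *; set q := den p t1 in q0.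
have p1 : sqn p = 1 by exact: sqn_circ.
pose gt t := if t < tau then c1 else c2.
have bgt : bounded_data gt by exact: bounded_data_step.
have be := bounded_dataB bg bgt.
set e := (fun t => g t - gt t) in be.
pose dl := `|c2 - c1|.
have dl0 : 0 < dl by rewrite normr_gt0 subr_eq0 eq_sym.
pose eta := dl / (64 * pi).
have eta0 : 0 < eta by rewrite divr_gt0// mulr_gt0.
have enear : \forall x \near p, sqn x < 1 -> `|poisson (fun t => `|e t|) x| <= eta.
  have := @poisson_near R p (fun t => `|e t|) 0 eta p1 (bounded_data_norm be).
  move=> h; have : \forall x \near p, sqn x < 1 -> `|poisson (fun t => `|e t|) x - 0| <= eta.
    apply: h => // r r0; have [d d0 hd] := gstep r r0; exists d => // t pt dt.
    by rewrite subr0 normr_id; exact: hd.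
  by apply: filterS => x; rewrite subr0.
move/nbhs_ballP : enear => [r /= r0 hr].
pose C' : R := 2 * (4 / q + 1).
have C'0 : 0 < C' by rewrite mulr_gt0// addr_gt0// divr_gt0.
pose s0 := Num.min (8^-1) (Num.min (r / 4) (Num.min ((16 * C')^-1) (Num.min (q / 64) 1))).
have h16 : 0 < (16 * C')^-1 by rewrite invr_gt0; apply: mulr_gt0.
have h8 : 0 < 8^-1 :> R by rewrite invr_gt0.
have s00 : 0 < s0 by rewrite !lt_min h16 h8 !divr_gt0 ?ltr01.
have s08 : s0 <= 8^-1 by rewrite ge_min lexx.
have s0r : s0 <= r / 4 by rewrite !ge_min lexx !orbT.
have s0C : s0 <= (16 * C')^-1 by rewrite !ge_min lexx !orbT.
have s0q : s0 <= q / 64 by rewrite !ge_min lexx !orbT.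
exists (dl / (16 * pi)), s0; split; first by rewrite divr_gt0// mulr_gt0.
  by rewrite s00.
move=> s x /andP[sp ss0] xs.
have [|xp xsq px] := squareP p1 _ xs; first by rewrite sp (le_trans ss0).
have x1 : sqn x < 1 by rewrite -subr_gt0 (lt_le_trans sp).
have q1 : 0 < 1 - sqn x by rewrite subr_gt0.
have s81 : s <= 8^-1 by exact: le_trans ss0 s08.
(* The gradient of the error e is at most dl / (16 s), by the choice of eta. *)
have pb : `|p.1 - x.1| < r /\ `|p.2 - x.2| < r.
  have bd (a b : R) : a ^+ 2 + b ^+ 2 <= 4 * s ^+ 2 -> `|a| < r.
    move=> h; apply: (@le_lt_trans _ _ (2 * s)); last by move: s0r ss0; lra.
    rewrite -ler_sqr ?nnegrE ?mulr_ge0 ?(ltW sp)// real_normK ?num_real//.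
    by have := sqr_ge0 b; rewrite exprMn; lra.
  split; rewrite distrC; first exact: bd xp.
  by apply: (bd _ (x.1 - p.1)); rewrite addrC.
have pe : `|poisson (fun t => `|e t|) x| <= eta by apply: hr => //; case: pb.
have P0 : 0 <= poisson (fun t => `|e t|) x.
  rewrite /poisson mulr_ge0 ?invr_ge0 ?mulr_ge0 ?(ltW pi0)//.
  by apply: Rintegral_ge0 => t _; rewrite mulr_ge0// PK_ge0.
have ke i : `|kint (kdiff i PK) e x| <= dl / (16 * s).
  apply: (le_trans (kint_diff_bound i x1 be)).
  apply: (@le_trans _ _ (2 / s * (2 * pi * eta))).
    apply: ler_pM.
    - by apply: divr_ge0 => //; exact: ltW.
    - by apply: mulr_ge0 => //; apply: mulr_ge0 => //; exact: ltW.
    - by rewrite ler_wpM2l// lef_pV2.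
    - rewrite ler_wpM2l ?mulr_ge0 ?(ltW pi0)//; exact: le_trans (ler_norm _) pe.
  rewrite /eta le_eqVlt; apply/orP; left; apply/eqP.
  have gen (P : R) : 0 < P -> 2 / s * (2 * P * (dl / (64 * P))) = dl / (16 * s).
    by move=> P0'; field; rewrite !lt0r_neq0.
  exact: gen.
have kg i : kint (kdiff i PK) g x = kint (kdiff i PK) gt x + kint (kdiff i PK) e x.
  have := kintB (kdiff i PK) bg bgt x1; rewrite -/e => ->; ring.
(* N t is the radial component at p of 1 / (e^{it} - x).  The tangential
   derivative of the Poisson integral of the step is a multiple of
   N 0 - N tau, where N t0 is of order 1/s and N t1 is bounded by C'. *)
pose N t := p.1 * Ak x t + p.2 * Bk x t.
have [pn1 pn2] : `|p.1| <= 1 /\ `|p.2| <= 1 by apply: disk_bound; exact: circ_cdisk.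
have main : p.1 * kint (kdiff 1 PK) gt x - p.2 * kint (kdiff 0 PK) gt x =
    - 2 * (c2 - c1) * (N 0 - N tau).
  by rewrite kint_step0// kint_step1// /N; ring.
have Nt0 : 3 / (16 * s) <= N t0.
  have d0 := den_gt0 t0 x1.
  have -> : N t0 = (p.1 * (p.1 - x.1) + p.2 * (p.2 - x.2)) / den x t0.
    by rewrite /N /Ak /Bk /p /circ /=; field; exact: lt0r_neq0.
  have dE : den x t0 = (x.1 - p.1) ^+ 2 + (x.2 - p.2) ^+ 2 by rewrite /den /p /circ /=; ring.
  rewrite ler_pdivlMr// dE; apply: le_trans px.
  apply: (@le_trans _ _ (3 / (16 * s) * (4 * s ^+ 2))).
    by rewrite ler_wpM2l// divr_ge0// mulr_ge0// ltW.
  by rewrite le_eqVlt; apply/orP; left; apply/eqP; field; rewrite lt0r_neq0.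
have Nt1 : `|N t1| <= C'.
  have dq : q / 4 <= den x t1.
    have : q <= 2 * den x t1 + 2 * ((x.1 - p.1) ^+ 2 + (x.2 - p.2) ^+ 2).
      rewrite /q /den; have := sqr_ge0 (cos t1 - x.1 - (x.1 - p.1)).
      have := sqr_ge0 (sin t1 - x.2 - (x.2 - p.2)); nra.
    have : s ^+ 2 <= s * 1 by rewrite expr2 ler_pM2l//; lra.
    by move: xp s0q ss0; lra.
  have iq : (den x t1)^-1 <= 4 / q.
    rewrite -[4 / q]invrK invf_div lef_pV2// posrE ?divr_gt0//; exact: den_gt0.
  have E := AkBk t1 x1.
  have Ab : `|Ak x t1| <= 4 / q + 1.
    have := sqr_ge0 (Bk x t1); have := sqr_ge0 (`|Ak x t1| - 1); rewrite -[Ak x t1 ^+ 2]real_normK ?num_real// in E; nra.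
  have Bb : `|Bk x t1| <= 4 / q + 1.
    have := sqr_ge0 (Ak x t1); have := sqr_ge0 (`|Bk x t1| - 1); rewrite -[Bk x t1 ^+ 2]real_normK ?num_real// in E; nra.
  apply: (le_trans (ler_normD _ _)); rewrite (normrM p.1) (normrM p.2).
  have -> : C' = 1 * (4 / q + 1) + 1 * (4 / q + 1) by rewrite /C'; ring.
  by apply: lerD; apply: ler_pM.
have NN : (8 * s)^-1 <= `|N 0 - N tau|.
  have -> : `|N 0 - N tau| = `|N t0 - N t1|.
    by case: tt => -[-> ->] //; rewrite distrC.
  apply: le_trans (ler_norm _).
  have Cs : C' <= (16 * s)^-1.
    have Ci : C'^-1 \is Num.pos by rewrite posrE invr_gt0.
    have sp16 : 16 * s \is Num.pos by rewrite posrE mulr_gt0.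
    rewrite -[C']invrK (lef_pV2 Ci sp16).
    by rewrite -ler_pdivlMl// -invfM; exact: le_trans ss0 s0C.
  have E8 : (8 * s)^-1 = 3 / (16 * s) - (16 * s)^-1 by field; exact: lt0r_neq0.
  by rewrite E8; move: Nt1 Nt0; rewrite ler_norml => /andP[n1 n2]; lra.
pose T := p.1 * kint (kdiff 1 PK) g x - p.2 * kint (kdiff 0 PK) g x.
have TE : T = - 2 * (c2 - c1) * (N 0 - N tau) +
    (p.1 * kint (kdiff 1 PK) e x - p.2 * kint (kdiff 0 PK) e x).
  by rewrite -main /T !kg; ring.
have Tlow : dl / (8 * s) <= `|T|.
  have h1 : dl / (4 * s) <= `|- 2 * (c2 - c1) * (N 0 - N tau)|.
    have -> : `|- 2 * (c2 - c1) * (N 0 - N tau)| = 2 * dl * `|N 0 - N tau|.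
      by rewrite (normrM _ (N 0 - N tau)) (normrM _ (c2 - c1)) normrN (ger0_norm (_ : 0 <= 2)).
    have -> : dl / (4 * s) = 2 * dl * (8 * s)^-1 by field; exact: lt0r_neq0.
    by apply: ler_wpM2l => //; apply: mulr_ge0 => //; exact: ltW.
  have h2 : `|p.1 * kint (kdiff 1 PK) e x - p.2 * kint (kdiff 0 PK) e x| <= dl / (8 * s).
    apply: (le_trans (ler_normB _ _)).
    have -> : dl / (8 * s) = 1 * (dl / (16 * s)) + 1 * (dl / (16 * s)) by field; exact: lt0r_neq0.
    by rewrite !normrM; apply: lerD; apply: ler_pM.
  rewrite TE; apply: le_trans (lerB_normD _ _).
  have -> : dl / (8 * s) = dl / (4 * s) - dl / (8 * s) by field; exact: lt0r_neq0.
  exact: lerB.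
set f0 := poisson1 g 0 x; set f1 := poisson1 g 1 x.
have T2 : T = 2 * pi * (p.1 * f1 - p.2 * f0).
  rewrite /T /f0 /f1 /poisson1.
  have gen (P a b : R) : 0 < P -> p.1 * a - p.2 * b = P * (p.1 * (P^-1 * a) - p.2 * (P^-1 * b)).
    by move=> P0'; field; exact: lt0r_neq0.
  by apply: gen; rewrite mulr_gt0.
have h : dl / (16 * pi) / s <= `|p.1 * f1 - p.2 * f0|.
  move: Tlow; rewrite T2 normrM gtr0_norm ?mulr_gt0//.
  have gen (P Y : R) : 0 < P -> dl / (8 * s) <= 2 * P * Y -> dl / (16 * P) / s <= Y.
    move=> P0'; have -> : dl / (8 * s) = 2 * P * (dl / (16 * P) / s).
      by field; rewrite !lt0r_neq0.
    by rewrite ler_pM2l// mulr_gt0.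
  exact: gen.
apply: (@le_trans _ _ ((p.1 * f1 - p.2 * f0) ^+ 2)).
  rewrite -[leRHS]real_normK ?num_real// ler_sqr ?nnegrE//.
  by rewrite !divr_ge0 ?mulr_ge0 ?(ltW pi0) ?(ltW sp) ?(ltW dl0).
have := sqr_ge0 (p.1 * f0 + p.2 * f1); move: p1; rewrite /sqn => p1 hh.
have : (p.1 * f1 - p.2 * f0) ^+ 2 + (p.1 * f0 + p.2 * f1) ^+ 2 = f0 ^+ 2 + f1 ^+ 2.
  transitivity ((p.1 ^+ 2 + p.2 ^+ 2) * (f0 ^+ 2 + f1 ^+ 2)); first by ring.
  by rewrite p1 mul1r.
lra.
Qed.

(** The square of scale s has area s^2 / 16, so by jump_gradient it carries
    energy at least c^2 / 16 for all small s.  These squares shrink to a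
    boundary point, which contradicts the absolute continuity of a finite
    energy. *)
Lemma no_jump (g : R -> R) (tau c1 c2 t0 t1 : R) : bounded_data g ->
  0 <= tau <= 2 * pi -> (t0 = 0 /\ t1 = tau) \/ (t0 = tau /\ t1 = 0) ->
  0 < den (circ t0) t1 ->
  (forall e, 0 < e -> exists2 d, 0 < d & forall t, period t -> den (circ t0) t < d ->
     `|g t - (if t < tau then c1 else c2)| <= e) ->
  in_L2 (poisson1 g 0) -> in_L2 (poisson1 g 1) -> c1 = c2.
Proof.
move=> bg tau2 tt q0 gstep L0 L1; apply/eqP; apply: contrapT => /negP c12.
have [c [s0 [c0 /andP[s00 s08] low]]] := jump_gradient bg tau2 tt q0 c12 gstep.
set p := circ t0 in low.
have p1 : sqn p = 1 by exact: sqn_circ.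
pose F x := poisson1 g 0 x ^+ 2 + poisson1 g 1 x ^+ 2.
have F0 x : 0 <= F x by rewrite addr_ge0// sqr_ge0.
have iF : mu.-integrable D (EFin \o F) by have := integrableD (@measurable_disk R) (in_L2_sqr L0) (in_L2_sqr L1); apply.
(* The squares at the scales s n tend to the boundary point p; if the gradient
   were large on all of them, their energies would stay above c^2 / 16. *)
pose s (n : nat) : R := s0 / n.+1%:R.
have sn n : 0 < s n <= s0.
  rewrite divr_gt0//= ler_pdivrMr// ler_peMr ?(ltW s00)//.
  by rewrite ler1n.
have s8 n : 0 < s n <= 8^-1 by have /andP[-> h] := sn n; exact: le_trans h s08.
have QD n : square p (s n) `<=` D.
  move=> x xs; have [_ h _] := squareP p1 (s8 n) xs; rewrite /disk /=.
  have /andP[h0 _] := sn n; rewrite -subr_gt0; exact: lt_le_trans h0 h.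
have mQ n : measurable (square p (s n) : set mplane) by exact: measurableX.
pose f n : plane -> \bar R := (EFin \o F) \_ (square p (s n)).
have mf n : measurable_fun (D : set mplane) (f n : mplane -> \bar R).
  have /measurable_int mF := iF.
  apply/(measurable_restrict _ (mQ n)); first exact: measurable_disk.
  by apply: measurable_funS mF => //; exact: measurable_disk.
have fc : {ae mu, forall x, D x -> f n x @[n --> \oo] --> 0%E}.
  apply: aeW => x xD.
  have xp : 0 < (x.1 - p.1) ^+ 2 + (x.2 - p.2) ^+ 2.
    rewrite lt_neqAle addr_ge0 ?sqr_ge0// andbT eq_sym paddr_eq0 ?sqr_ge0//.
    apply/negP => /andP[]; rewrite !sqrf_eq0 !subr_eq0 => /eqP x1 /eqP x2.
    have : sqn x < 1 by exact: xD.
    by rewrite /sqn x1 x2 -/(sqn p) p1 ltxx.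
  have cs : 4 * s n ^+ 2 @[n --> \oo] --> (0 : R).
    have c0' : s n @[n --> \oo] --> (0 : R).
      rewrite -[X in _ --> X](mulr0 s0); apply: cvgM; first exact: cvg_cst.
      exact: cvg_harmonic.
    rewrite -[X in _ --> X](mulr0 4); apply: cvgM; first exact: cvg_cst.
    by rewrite -[X in _ --> X](mulr0 0); under eq_fun do rewrite expr2; apply: cvgM.
  apply: cvg_near_cst.
  have hn : \forall n \near \oo, 4 * s n ^+ 2 < (x.1 - p.1) ^+ 2 + (x.2 - p.2) ^+ 2.
    by move/cvgr_lt : cs; apply.
  apply: filterS hn => n h.
  rewrite /f patchE; case: ifPn => //; rewrite inE => xs.
  by have [] := squareP p1 (s8 n) xs; rewrite leNgt h.
have fF : {ae mu, forall x n, D x -> (`|f n x| <= (EFin \o F) x)%E}.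
  apply: aeW => x n xD; rewrite /f patchE; case: ifPn => _ /=; last by rewrite normr0 lee_fin.
  by rewrite lee_fin ger0_norm.
have [_ _ lim] := dominated_convergence (@measurable_disk R) mf (measurable_cst _) fc iF fF.
rewrite integral0 in lim.
have big n : ((c ^+ 2 / 16)%:E <= \int[mu]_(x in D) f n x)%E.
  rewrite /f -integral_mkcondr (setIidr (QD n)).
  have /andP[sn0 _] := sn n.
  have -> : ((c ^+ 2 / 16)%:E = \int[mu]_(x in square p (s n)) ((c / s n) ^+ 2)%:E)%E.
    rewrite integral_cst; last exact: mQ.
    rewrite square_measure//= -EFinM; congr EFin; field; exact: lt0r_neq0.
  apply: ge0_le_integral.
  - exact: mQ.
  - by move=> x _; rewrite lee_fin sqr_ge0.
  - exact: measurable_cst.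
  - have /measurable_int mF := iF.
    by apply: measurable_funS mF; [exact: measurable_disk|exact: QD].
  - by move=> x xs; rewrite lee_fin; apply: low.
have : ((c ^+ 2 / 16)%:E <= 0)%E.
  by apply: (cvge_ge _ lim); apply: nearW.
rewrite lee_fin leNgt; apply/negP; rewrite negbK.
by rewrite divr_gt0// exprn_gt0.
Qed.

End NoJump.

(** * Weak convergence from locally uniform convergence *)

Section WeakConvergence.
Variable R : realType.
Local Notation plane := (R * R)%type.
Local Notation mplane := (measurableTypeR R * measurableTypeR R)%type.
Local Notation space := 'rV[R]_4.
Local Notation mu := (@area_measure R).
Local Notation D := (@disk R).

Lemma in_L2D (f g : plane -> R) : in_L2 f -> in_L2 g -> in_L2 (fun x => f x + g x).
Proof.
move=> Lf Lg; move/in_L2P : (Lf) => [mf _]; move/in_L2P : (Lg) => [mg _].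
apply/in_L2P; split; first exact: measurable_funD.
have i1 := integrableD (@measurable_disk R) (in_L2_sqr Lf) (in_L2_sqr Lg).
have := integrableZl (@measurable_disk R) 2 i1 => /integrableP[_].
apply: le_lt_trans; apply: ge0_le_integral.
- exact: measurable_disk.
- by move=> x _; rewrite lee_fin sqr_ge0.
- by apply/measurable_EFinP; apply: measurable_funX; exact: measurable_funD.
- apply: measurableT_comp => //; have := integrableZl (@measurable_disk R) 2 i1.
  exact: measurable_int.
- move=> x _; rewrite /= lee_fin; apply: le_trans (ler_norm _).
  have := sqr_ge0 (f x - g x); nra.
Qed.

Lemma W12_gradD (a : R) f F g G : W12_grad f F -> W12_grad g G ->
  W12_grad (fun x => a *: f x + g x : space) (fun i x => a *: F i x + G i x).
Proof.
move=> Wf Wg k; have [Lf hf] := Wf k; have [Lg hg] := Wg k.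
have E (p q : plane -> space) : (fun x => (a *: p x + q x) 0 k) = (fun x => a * p x 0 k + q x 0 k).
  by apply/funext => x; rewrite !mxE.
split; first by rewrite E; apply: in_L2D => //; exact: in_L2_scale.
move=> i; have [LF wf] := hf i; have [LG wg] := hg i.
split; first by rewrite E; apply: in_L2D => //; exact: in_L2_scale.
rewrite !E => h th; have [ch cdh _ _] := test_functionP th.
have If p : in_L2 p -> mu.-integrable D (EFin \o (fun x => p x * h x)).
  by move=> Lp; apply: integrable_mul_bounded => //; exact: in_L2_integrable.
have Id p : in_L2 p -> mu.-integrable D (EFin \o (fun x => p x * 'D_(axis R i) (h : plane -> R^o) x)).
  by move=> Lp; apply: integrable_mul_bounded => //; exact: in_L2_integrable.
have lin (p q k' : plane -> R) : mu.-integrable D (EFin \o (fun x => p x * k' x)) ->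
    mu.-integrable D (EFin \o (fun x => q x * k' x)) ->
    \int[mu]_(x in D) ((a * p x + q x) * k' x) =
    a * (\int[mu]_(x in D) (p x * k' x)) + \int[mu]_(x in D) (q x * k' x).
  move=> ip iq; rewrite -RintegralZl//; last exact: measurable_disk.
  rewrite -RintegralD//; first by apply: eq_Rintegral => x _; rewrite mulrDl mulrA.
  - exact: measurable_disk.
  - have := integrableZl (@measurable_disk R) a ip; apply: eq_integrable => //; exact: measurable_disk.
rewrite (lin _ _ _ (Id _ Lf) (Id _ Lg)) (lin _ _ _ (If _ LF) (If _ LG)).
by rewrite wf// wg// mulrN -opprD.
Qed.

(** Dominated convergence: the annuli r < |x|^2 < 1 decrease to the empty set
    as r tends to 1. *)
Lemma tail_small (p : plane -> R) (e : R) : in_L2 p -> 0 < e ->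
  exists r, [/\ r < 1,
    mu.-integrable D (EFin \o (fun x => if sqn x <= r then 0 else p x ^+ 2)) &
    \int[mu]_(x in D) (if sqn x <= r then 0 else p x ^+ 2) <= e].
Proof.
move=> Lp e0; have ip := in_L2_sqr Lp.
pose r n : R := 1 - n.+1%:R^-1.
pose f n x := (if sqn x <= r n then 0 else p x ^+ 2)%:E.
have mle n : measurable [set x : mplane | sqn x <= r n].
  rewrite -[X in measurable X]setCK; apply: measurableC; apply: plane_open_measurable.
  rewrite (_ : ~` _ = (@sqn R) @^-1` [set y | r n < y]).
    by apply: open_comp; [move=> x _; exact: sqn_continuous|exact: open_gt].
  by apply/seteqP; split => x /=; rewrite ltNge => /negP.
have mf n : measurable_fun (D : set mplane) (f n : mplane -> \bar R).
  rewrite (_ : f n = (EFin \o (fun x => p x ^+ 2)) \_ (~` [set x | sqn x <= r n])).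
    apply/(measurable_restrict _ (measurableC (mle n))); first exact: measurable_disk.
    apply: measurable_funS (measurable_int _ ip) => //; exact: measurable_disk.
  apply/funext => x; rewrite /f patchE in_setC.
  by case: ifPn => h; [rewrite mem_set|rewrite memNset//= (negbTE h)].
have fc : {ae mu, forall x, D x -> f n x @[n --> \oo] --> 0%E}.
  apply: aeW => x xD; apply: cvg_near_cst.
  have q0 : 0 < 1 - sqn x by rewrite subr_gt0.
  have := near_infty_natSinv_lt (PosNum q0); apply: filterS => n /= h.
  by rewrite /f ifT// /r lerBrDr addrC -lerBrDr ltW.
have fF : {ae mu, forall x n, D x -> (`|f n x| <= (EFin \o (fun x => p x ^+ 2)%R) x)%E}.
  apply: aeW => x n xD; rewrite /f; case: ifPn => _ /=; first by rewrite normr0 lee_fin sqr_ge0.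
  by rewrite lee_fin ger0_norm// sqr_ge0.
have [_ _ lim] := dominated_convergence (@measurable_disk R) mf (measurable_cst _) fc ip fF.
rewrite integral0 in lim.
have near0 : \forall n \near \oo, fine (\int[mu]_(x in D) f n x)%E <= e.
  by have := cvgr_le _ (fine_cvg lim) _ e0; apply.
have [n _ hn] := near0.
exists (r n); split; first by rewrite /r gtrBl invr_gt0.
  apply: (le_integrable _ (mf n) _ ip); first exact: measurable_disk.
  move=> x _; rewrite /f; case: ifPn => _ /=; last by [].
  by rewrite normr0 lee_fin.
exact: (hn n (leqnn n)).
Qed.

(** A bounded sequence in L^2 that converges to 0 locally uniformly converges
    weakly to 0: on the thin annulus where uniform convergence fails, p has
    small norm, and |p q| <= p^2 / (2 l) + l q^2 / 2. *)
Lemma weak_L2_test (p : plane -> R) (q : nat -> plane -> R) (M : R) :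
  in_L2 p -> (forall k, in_L2 (q k)) -> (forall k, \int[mu]_(x in D) (q k x ^+ 2) <= M) ->
  (forall r e : R, r < 1 -> 0 < e -> \forall k \near \oo, forall x, sqn x <= r -> `|q k x| <= e) ->
  forall e : R, 0 < e -> \forall k \near \oo, `|\int[mu]_(x in D) (p x * q k x)| <= e.
Proof.
move=> Lp Lq qM qu e e0.
have M0 : 0 <= M by apply: le_trans (qM 0%N); apply: Rintegral_ge0 => x _; exact: sqr_ge0.
(* With these constants each of the three terms of the bound contributes at
   most e / 2 or e / 4. *)
pose l := e / (M + 1); have l0 : 0 < l by rewrite divr_gt0// ltr_wpDl.
have le2 : 0 < l * e / 2 by rewrite divr_gt0// mulr_gt0.
have [r [r1 it ht]] := tail_small Lp le2.
have mD := @measurable_disk R.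
have ia : mu.-integrable D (EFin \o (fun x => `|p x|)).
  exact: integrable_norm (in_L2_integrable Lp).
pose A := \int[mu]_(x in D) `|p x|.
have A0 : 0 <= A by apply: Rintegral_ge0.
pose n := e / (4 * (1 + A)); have n0 : 0 < n by rewrite divr_gt0// mulr_gt0// ltr_wpDr.
have := qu _ _ r1 n0; apply: filterS => k hk.
apply: le_trans (le_normr_Rintegral mD (in_L2_mul Lp (Lq k))) _.
pose t x := if sqn x <= r then 0 else p x ^+ 2.
have i1 := integrableZl mD ((2 * l)^-1) it.
have i2 := integrableZl mD (l / 2) (in_L2_sqr (Lq k)).
have i3 := integrableZl mD n ia.
have i12 := integrableD mD i1 i2; have i123 := integrableD mD i12 i3.
apply: (@le_trans _ _ (\int[mu]_(x in D) (((2 * l)^-1 * t x + l / 2 * q k x ^+ 2) + n * `|p x|))).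
  apply: le_Rintegral => //.
    exact: integrable_norm (in_L2_mul Lp (Lq k)).
  move=> x _; rewrite normrM /t; case: ifPn => h.
    rewrite mulr0 add0r; apply: ler_wpDl.
      by rewrite mulr_ge0 ?sqr_ge0// divr_ge0// ltW.
    by rewrite mulrC ler_wpM2r// hk.
  apply: ler_wpDr; first by rewrite mulr_ge0// ltW.
  rewrite -[p x ^+ 2]real_normK ?num_real// -[q k x ^+ 2]real_normK ?num_real//.
  have := sqr_ge0 (`|p x| - l * `|q k x|); move: (`|p x|) (`|q k x|) => a b hab.
  rewrite -subr_ge0 (_ : _ - _ = (2 * l)^-1 * (a - l * b) ^+ 2); last by field; rewrite gt_eqF.
  by rewrite mulr_ge0// invr_ge0 mulr_ge0// ltW.
rewrite !RintegralD// !RintegralZl//; last exact: in_L2_sqr.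
rewrite -/A.
have h1 : (2 * l)^-1 * \int[mu]_(x in D) t x <= e / 4.
  apply: (@le_trans _ _ ((2 * l)^-1 * (l * e / 2))).
    by rewrite ler_wpM2l// invr_ge0 mulr_ge0// ltW.
  by rewrite le_eqVlt; apply/orP; left; apply/eqP; field; rewrite gt_eqF.
have h2 : l / 2 * \int[mu]_(x in D) (q k x ^+ 2) <= e / 2.
  apply: (@le_trans _ _ (l / 2 * (M + 1))).
    apply: ler_wpM2l; first by rewrite divr_ge0// ltW.
    by rewrite (le_trans (qM k))// lerDl.
  rewrite le_eqVlt; apply/orP; left; apply/eqP; rewrite /l; field.
  by rewrite gt_eqF// ltr_wpDl.
have h3 : n * A <= e / 4.
  rewrite -subr_ge0 (_ : _ - _ = n); first exact: ltW.
  by rewrite /n; field; rewrite gt_eqF// ltr_wpDr.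
lra.
Qed.

End WeakConvergence.

Section BanachSaks.
Variable R : realType.
Local Notation plane := (R * R)%type.
Local Notation space := 'rV[R]_4.
Local Notation mu := (@area_measure R).
Local Notation D := (@disk R).

(** The twelve scalar components of a map and of its gradient; the index 0 of
    'I_3 stands for the map itself, the two others for the derivatives. *)
Definition jet (f : plane -> space) (F : 'I_2 -> plane -> space) (j : 'I_3 * 'I_4)
  (x : plane) : R := (if unlift ord0 j.1 is Some i then F i x else f x) 0 j.2.

Definition W12_dot f F g G : R := \sum_j \int[mu]_(x in D) (jet f F j x * jet g G j x).

Lemma jet_in_L2 f F j : W12_grad f F -> in_L2 (jet f F j).
Proof.
move=> W; have [Lf LF] := W j.2; rewrite /jet; case: unliftP => [i _|_] //.
by have [] := LF i.
Qed.

Lemma W12_normE f F : W12_grad f F -> W12_norm f F = Num.sqrt (W12_dot f F f F).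
Proof.
move=> W; rewrite /W12_norm /W12_dot; congr Num.sqrt.
have E x : sqnorm (f x) + \sum_(i < 2) sqnorm (F i x) = \sum_j jet f F j x ^+ 2.
  rewrite -(pair_bigA _ (fun i k => jet f F (i, k) x ^+ 2)) /= [RHS]big_ord_recl; congr (_ + _).
    by rewrite sqnormE; apply: eq_bigr => k _; rewrite /jet/= unlift_none.
  by apply: eq_bigr => i _; rewrite sqnormE; apply: eq_bigr => k _; rewrite /jet/= liftK.
under eq_Rintegral do rewrite E.
have S (s : seq ('I_3 * 'I_4)) : mu.-integrable D (EFin \o (fun x => \sum_(j <- s) jet f F j x ^+ 2)) /\
   \int[mu]_(x in D) (\sum_(j <- s) jet f F j x ^+ 2) =
   \sum_(j <- s) \int[mu]_(x in D) (jet f F j x * jet f F j x).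
  elim: s => [|j s [ih1 ih2]].
    rewrite big_nil; split.
      rewrite (_ : _ \o _ = cst 0%E); first exact: integrable0.
      by apply/funext => x /=; rewrite big_nil.
    under eq_Rintegral do rewrite big_nil.
    by rewrite Rintegral_cst ?mul0r//; exact: measurable_disk.
  have ij := in_L2_sqr (jet_in_L2 j W); rewrite big_cons; split.
    have := integrableD (@measurable_disk R) ij ih1; apply: eq_integrable; first exact: measurable_disk.
    by move=> x _; rewrite /= big_cons.
  under eq_Rintegral do rewrite big_cons.
  by rewrite RintegralD// ?ih2//; exact: measurable_disk.
by have [_ ->] := S (index_enum _).
Qed.

Lemma W12_dot_expand (a : R) f F g G : W12_grad f F -> W12_grad g G ->
  let h := (fun x => a *: f x + g x : space) in
  let H := (fun i x => a *: F i x + G i x : space) in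
  W12_dot h H h H = a ^+ 2 * W12_dot f F f F + 2 * a * W12_dot g G f F + W12_dot g G g G.
Proof.
move=> Wf Wg /=; rewrite /W12_dot !big_distrr -!big_split; apply: eq_bigr => j _ /=.
pose h := (fun x => a *: f x + g x : space); pose H := (fun i x => a *: F i x + G i x : space).
rewrite -/h -/H.
have mD := @measurable_disk R.
have E x : jet h H j x = a * jet f F j x + jet g G j x.
  by rewrite /jet; case: unliftP => [i _|_]; rewrite !mxE.
have Lf := jet_in_L2 j Wf; have Lg := jet_in_L2 j Wg.
have i1 := integrableZl mD (a ^+ 2) (in_L2_mul Lf Lf).
have i2 := integrableZl mD (2 * a) (in_L2_mul Lg Lf).
have i3 := in_L2_mul Lg Lg.
have i12 := integrableD mD i1 i2.
have EE x : jet h H j x * jet h H j x = (a ^+ 2 * (jet f F j x * jet f F j x) +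
    (2 * a) * (jet g G j x * jet f F j x)) + jet g G j x * jet g G j x.
  by rewrite E; ring.
under eq_Rintegral do rewrite EE.
by rewrite !RintegralD// !RintegralZl//; exact: in_L2_mul.
Qed.

(** A Banach-Saks argument, which treats an arbitrary bounded functional
    without representing it by integrals.  If |L (f k)| >= e infinitely often,
    one chooses successively terms that are almost orthogonal to the sum of
    the previous ones, by weak_L2_test, with signs making L positive.  The
    sum T of n terms has squared norm O(n) but L T >= n e, contradicting
    |L T| <= C |T| for large n. *)
Lemma weak_cvg0 (L : (plane -> space) -> R) (f : nat -> plane -> space)
    (F : nat -> 'I_2 -> plane -> space) (M : R) :
  W12_dual L -> (forall k, W12_grad (f k) (F k)) ->
  (forall k j, \int[mu]_(x in D) (jet (f k) (F k) j x ^+ 2) <= M) ->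
  (forall j (r e : R), r < 1 -> 0 < e ->
    \forall k \near \oo, forall x, sqn x <= r -> `|jet (f k) (F k) j x| <= e) ->
  L (f k) @[k --> \oo] --> 0.
Proof.
move=> [Llin [C LC]] Wf fM fu; apply/cvgrPdist_le => e e0; apply: contrapT => nl.
have often N : exists2 k, (N <= k)%N & e < `|L (f k)|.
  apply: contrapT => h; apply: nl; exists N => // k /= Nk; rewrite sub0r normrN leNgt.
  by apply/negP => h1; apply: h; exists k.
(* Adding one term increases the squared norm by at most 12 M, the bound for the
   squared norm of one term, plus 1, the bound for the cross term. *)
pose K := 12 * M + 1.
have dotM k : W12_dot (f k) (F k) (f k) (F k) <= 12 * M.
  rewrite mulr_natl (_ : 12%N = #|{: 'I_3 * 'I_4}|); last by rewrite card_prod !card_ord.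
  by rewrite -sumr_const; apply: ler_sum => j _; exact: fM.
have W12E k : W12 (f k) by exists (F k).
have [T HT] : exists T : nat -> plane -> space, forall n, exists G, [/\ W12_grad (T n) G,
    W12_dot (T n) G (T n) G <= n%:R * K & n%:R * e <= L (T n)].
  suff H n : exists T, exists G, [/\ W12_grad T G, W12_dot T G T G <= n%:R * K & n%:R * e <= L T].
    by have [T HT] := choice H; exists T.
  elim: n => [|n [T [G [WT TK LT]]]].
    exists (fun x => (-1) *: f 0%N x + f 0%N x), (fun i x => (-1) *: F 0%N i x + F 0%N i x).
    split; first exact: W12_gradD.
      by rewrite W12_dot_expand// mul0r; lra.
    by rewrite Llin// mul0r; lra.
  have [N _ hN] : \forall k \near \oo, `|W12_dot T G (f k) (F k)| <= 1 / 2.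
    have : \forall k \near \oo, forall j, `|\int[mu]_(x in D) (jet T G j x * jet (f k) (F k) j x)| <= 1 / 24.
      apply: filter_forall => j; apply: (weak_L2_test (M := M)) => //.
      - exact: jet_in_L2.
      - by move=> k; exact: jet_in_L2.
      - by move=> r d; exact: fu.
    apply: filterS => k hk; apply: le_trans (ler_norm_sum _ _ _) _.
    apply: (@le_trans _ _ (\sum_(j : 'I_3 * 'I_4) 1 / 24)); first by apply: ler_sum => j _.
    by rewrite sumr_const card_prod !card_ord; lra.
  have [k Nk ek] := often N.
  have := hN k Nk; rewrite ler_norml => /andP[h1 h2].
  pose a := Num.sg (L (f k)).
  have Lk0 : L (f k) != 0 by rewrite -normr_gt0 (lt_trans e0).
  have a2 : a ^+ 2 = 1 by rewrite sqr_sg Lk0.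
  have aL : a * L (f k) = `|L (f k)| by rewrite -normrEsg.
  have aw : a * W12_dot T G (f k) (F k) <= 1 / 2.
    by rewrite /a; case: sgrP => _; lra.
  exists (fun x => a *: f k x + T x), (fun i x => a *: F k i x + G i x).
  split; first exact: W12_gradD.
    rewrite W12_dot_expand// a2 mul1r -(mulrA 2) -natr1 mulrDl mul1r.
    have hk : W12_dot (f k) (F k) (f k) (F k) <= K - 1 by have := dotM k; rewrite /K; lra.
    by move: hk TK aw; lra.
  rewrite Llin//; last by exists G.
  by rewrite aL -natr1 mulrDl mul1r; move: ek LT; lra.
have K0 : 0 <= K.
  have := dotM 0%N; rewrite /K; suff : 0 <= W12_dot (f 0%N) (F 0%N) (f 0%N) (F 0%N) by lra.
  by apply: sumr_ge0 => j _; apply: Rintegral_ge0 => x _; rewrite -expr2 sqr_ge0.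
(* n e <= C sqrt (n K) is impossible once n exceeds C^2 K / e^2. *)
pose n := (Num.truncn (C ^+ 2 * K / e ^+ 2)).+1.
have [G [WT TK LT]] := HT n.
have n0 : 0 < n%:R :> R by rewrite ltr0n.
have := LC _ _ WT; rewrite W12_normE// => LTn.
have h1 : n%:R * e <= `|C| * Num.sqrt (n%:R * K).
  apply: le_trans LT _; apply: le_trans (ler_norm _) _; apply: le_trans LTn _.
  apply: (@le_trans _ _ (`|C| * Num.sqrt (W12_dot (T n) G (T n) G))).
    by rewrite ler_wpM2r ?sqrtr_ge0// ler_norm.
  by rewrite ler_wpM2l// ler_wsqrtr.
have h2 : (n%:R * e) ^+ 2 <= C ^+ 2 * (n%:R * K).
  rewrite -[C ^+ 2]real_normK ?num_real// -[n%:R * K]sqr_sqrtr; last by rewrite mulr_ge0// ltW.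
  by rewrite -exprMn ler_pXn2r// nnegrE ?mulr_ge0 ?sqrtr_ge0// ltW.
have h3 : n%:R * e ^+ 2 <= C ^+ 2 * K.
  by rewrite -(ler_pM2l n0); move: h2; rewrite exprMn; lra.
have : C ^+ 2 * K / e ^+ 2 < n%:R by rewrite /n truncnS_gt.
by rewrite ltNge ler_pdivlMr ?exprn_gt0// h3.
Qed.

End BanachSaks.

(** * Limits of Poisson integrals *)

Section PoissonLimits.
Variable R : realType.
Local Notation plane := (R * R)%type.
Local Notation mplane := (measurableTypeR R * measurableTypeR R)%type.
Local Notation mu := (@area_measure R).
Local Notation leb := (@lebesgue_measure R).
Local Notation D := (@disk R).
Local Notation period := ([set` `[0, 2 * pi[%R] : set R).

Lemma poisson_C1 (g : R -> R) : bounded_data g -> C1_disk (poisson g) (poisson1 g).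
Proof.
move=> bg x xD; have x1 : sqn x < 1 by exact: xD.
split.
- by rewrite /poisson; apply: continuousM; [exact: cvg_cst|exact: continuous_kint].
- by move=> i; rewrite /poisson1; apply: continuousM; [exact: cvg_cst|exact: continuous_kint].
- by move=> i; have [] := poisson_derivable bg x1 i.
Qed.

Lemma C1_disk_measurable f f1 : C1_disk f f1 ->
  measurable_fun (D : set mplane) (f : mplane -> measurableTypeR R) /\
  forall i, measurable_fun (D : set mplane) (f1 i : mplane -> measurableTypeR R).
Proof.
move=> C1; split=> [|i]; apply: plane_continuous_measurable.
- exact: open_disk.
- by move=> x /C1[].
- exact: open_disk.
- by move=> x /C1[].
Qed.

(** The Poisson kernel is nonnegative with total mass 1. *)
Lemma poisson_le (g : R -> R) (B : R) (x : plane) : bounded_data g ->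
  (forall t, period t -> `|g t| <= B) -> sqn x < 1 -> `|poisson g x| <= B.
Proof.
move=> bg gB x1; rewrite -(poisson_cst B x1) /poisson normrM ger0_norm ?invr_ge0 ?mulr_ge0 ?pi_ge0//.
apply: ler_wpM2l; first by rewrite invr_ge0 mulr_ge0// pi_ge0.
have ii := integrable_kg (@PK R) bg x1.
apply: le_trans (le_normr_Rintegral measurable_period ii) _.
apply: le_Rintegral => //.
- by have := integrable_norm ii; apply: eq_integrable.
- exact: integrable_kg (bounded_data_cst B) x1.
- by move=> t pt; rewrite normrM ger0_norm ?PK_ge0// ler_wpM2l ?PK_ge0// gB.
Qed.

Lemma integral_le_Fatou (f : nat -> plane -> R) (f0 : plane -> R) (M : R) :
  (forall n, measurable_fun (D : set mplane) (f n : mplane -> measurableTypeR R)) ->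
  (forall x, D x -> f n x @[n --> \oo] --> f0 x) ->
  (forall n, (\int[mu]_(x in D) (f n x ^+ 2)%:E <= M%:E)%E) ->
  (\int[mu]_(x in D) (f0 x ^+ 2)%:E <= M%:E)%E.
Proof.
move=> mf fc fM.
pose h n x := (f n x ^+ 2)%:E.
have mh n : measurable_fun (D : set mplane) (h n : mplane -> \bar R).
  by apply/measurable_EFinP; exact: (measurable_funX 2 (mf n)).
have h0 n x : D x -> (0 <= h n x)%E by move=> _; rewrite lee_fin sqr_ge0.
have := fatou mu (@measurable_disk R) mh h0.
rewrite (_ : (\int[mu]_(x in D) _)%E = (\int[mu]_(x in D) (f0 x ^+ 2)%:E)%E); last first.
  apply: eq_integral => x; rewrite inE => xD.
  have c : h n x @[n --> \oo] --> (f0 x ^+ 2)%:E.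
    apply: cvg_EFin; first exact: nearW.
    rewrite /h /=; under eq_fun do rewrite /= expr2; rewrite expr2.
    by apply: cvgM; exact: fc.
  by have [-> _] := cvg_limn_einf_sup c.
move=> H; apply: le_trans H _; rewrite limn_einf_lim.
apply: lime_le; first exact: is_cvg_einfs.
apply: nearW => n; apply: le_trans (fM n); apply: ereal_inf_lbound.
by exists n => /=.
Qed.

Section Sequence.
Variables (g : nat -> R -> R) (g0 : R -> R).
Hypotheses (bg : forall j, bounded_data (g j)) (bg0 : bounded_data g0).
Hypothesis gL1 : \int[leb]_(t in period) `|g j t - g0 t| @[j --> \oo] --> (0 : R).

(** On a disk of radius smaller than 1 the kernels are uniformly bounded, so
    convergence of the data in L^1 gives uniform convergence of the integrals,
    and of their derivatives of every order. *)
Lemma kint_unif k (r e : R) : r < 1 -> 0 < e -> \forall j \near \oo, forall x, sqn x <= r ->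
  `|kint k (g j) x - kint k g0 x| <= e.
Proof.
move=> r1 e0; have [C C0 hC] := keval_bound k r1.
have e1 : 0 < e / (C + 1) by rewrite divr_gt0// ltr_wpDl.
have : \forall j \near \oo, \int[leb]_(t in period) `|g j t - g0 t| <= e / (C + 1) by have := cvgr_le _ gL1 _ e1; apply.
 apply: filterS => j hj x xr.
have x1 : sqn x < 1 by exact: le_lt_trans xr r1.
rewrite -kintB//; apply: le_trans (kint_le (bounded_dataB (bg j) bg0) x1 (fun t => hC x t xr)) _.
apply: (@le_trans _ _ ((C + 1) * (e / (C + 1)))); last first.
  by rewrite mulrCA divff ?mulr1// gt_eqF// ltr_wpDl.
apply: ler_pM => //; last by rewrite lerDl.
by apply: Rintegral_ge0.
Qed.

Let pi2 : 0 < 2 * pi :> R.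
Proof. by rewrite mulr_gt0// pi_gt0. Qed.

Let scaled_unif k (r e : R) : r < 1 -> 0 < e -> \forall j \near \oo, forall x, sqn x <= r ->
  `|(2 * pi)^-1 * kint k (g j) x - (2 * pi)^-1 * kint k g0 x| <= e.
Proof.
move=> r1 e0; have e1 : 0 < 2 * pi * e by rewrite mulr_gt0.
have := kint_unif k r1 e1; apply: filterS => j hj x xr.
rewrite -mulrBr normrM ger0_norm ?invr_ge0 ?(ltW pi2)//.
by rewrite -(ler_pM2l pi2) mulrA mulfV ?mul1r ?gt_eqF// hj.
Qed.

Lemma poisson_unif (r e : R) : r < 1 -> 0 < e -> \forall j \near \oo, forall x, sqn x <= r ->
  `|poisson (g j) x - poisson g0 x| <= e.
Proof. exact: scaled_unif. Qed.

Lemma poisson1_unif i (r e : R) : r < 1 -> 0 < e -> \forall j \near \oo, forall x, sqn x <= r ->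
  `|poisson1 (g j) i x - poisson1 g0 i x| <= e.
Proof. exact: scaled_unif. Qed.

Lemma poisson1_cvg i (x : plane) : sqn x < 1 ->
  poisson1 (g j) i x @[j --> \oo] --> poisson1 g0 i x.
Proof.
move=> x1; apply/cvgrPdist_le => e e0; have := poisson1_unif i x1 e0.
by apply: filterS => j /(_ x (lexx _)); rewrite distrC.
Qed.

Lemma poisson1_energy i (M : R) :
  (forall j, (\int[mu]_(x in D) (poisson1 (g j) i x ^+ 2)%:E <= M%:E)%E) ->
  in_L2 (poisson1 g0 i) /\ (\int[mu]_(x in D) (poisson1 g0 i x ^+ 2)%:E <= M%:E)%E.
Proof.
move=> gM.
have m j : measurable_fun (D : set mplane) (poisson1 (g j) i : mplane -> measurableTypeR R).
  by have [_] := C1_disk_measurable (poisson_C1 (bg j)); apply.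
have h := integral_le_Fatou m (fun x xD => @poisson1_cvg i x xD) gM.
split => //; apply/in_L2P; split; last exact: le_lt_trans h (ltry _).
by have [_] := C1_disk_measurable (poisson_C1 bg0); apply.
Qed.

End Sequence.

Lemma bounded_in_L2 (f : plane -> R) (B : R) :
  measurable_fun (D : set mplane) (f : mplane -> measurableTypeR R) ->
  (forall x, D x -> `|f x| <= B) -> in_L2 f.
Proof.
move=> mf fB; apply/in_L2P; split => //.
have /integrableP[_] : mu.-integrable D (EFin \o (fun x => f x ^+ 2)).
  apply: bounded_integrable_disk; first exact: measurable_funX.
  exists (B ^+ 2) => x xD; rewrite normrX ler_pXn2r ?nnegrE ?normr_ge0// ?fB//.
  exact: le_trans (normr_ge0 _) (fB x xD).
apply: le_lt_trans; rewrite le_eqVlt; apply/orP; left; apply/eqP.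
by apply: eq_integral => x _ /=; rewrite ger0_norm// sqr_ge0.
Qed.

End PoissonLimits.

(** * Continuity of the limit trace *)

Section Continuity.
Variable R : realType.
Local Notation period := ([set` `[0, 2 * pi[%R] : set R).

Let pi0 : 0 < pi :> R. Proof. exact: pi_gt0. Qed.

Lemma bounded_data_comp (h w : R -> R) (B : R) : continuous h -> (forall t, `|h t| <= B) ->
  (forall s t, s <= t -> w s <= w t) -> bounded_data (fun t => h (w t)).
Proof.
move=> ch hB wn; split; last by exists B => t _.
apply: (measurableT_comp (f := h)); first exact: continuous_measurable_fun.
by apply: nondecreasing_measurable; [exact: measurable_period|exact: wn].
Qed.

Lemma left_limit (w : R -> R) (a : R) : (forall s t, s <= t -> w s <= w t) ->
  exists l, forall e, 0 < e -> exists2 d, 0 < d & forall t, a - d < t < a -> `|w t - l| <= e.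
Proof.
move=> wn; pose S := [set w s | s in [set s | s < a]].
have hS : has_sup S.
  split; first by exists (w (a - 1)), (a - 1) => //=; lra.
  by exists (w a) => _ [s /= sa <-]; exact: wn (ltW sa).
exists (sup S) => e e0; have [_ [s /= sa <-] hs] := sup_adherent e0 hS.
exists (a - s); first by rewrite subr_gt0.
move=> t /andP[st ta]; have wst := wn s t; rewrite ler_norml.
have : w t <= sup S by apply: sup_upper_bound => //; exists t.
have : w s <= w t by apply: wst; lra.
by move=> ? ?; apply/andP; split; lra.
Qed.

(** The composition of a continuous function with a nondecreasing
    right-continuous one has, near every point, the profile of a step. *)
Lemma one_sided_limits (h w : R -> R) (a : R) : continuous h -> (forall s t, s <= t -> w s <= w t) ->
  (forall e, 0 < e -> exists2 d, 0 < d & forall s, s < a + d -> w s <= w a + e) ->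
  exists l, forall e, 0 < e -> exists2 d, 0 < d & forall t, `|t - a| < d ->
    `|h (w t) - (if t < a then h l else h (w a))| <= e.
Proof.
move=> ch wn wr; have [l wl] := left_limit a wn; exists l => e e0.
have near_h c : exists2 d, 0 < d & forall t, `|t - c| <= d -> `|h t - h c| <= e.
  have := ch c; move/cvgrPdist_le => /(_ e e0) /nbhs_ballP[d /= d0 hd].
  exists (d / 2); first by rewrite divr_gt0.
  move=> t td; rewrite distrC; apply: hd; rewrite /ball /= distrC.
  by apply: le_lt_trans td _; rewrite gtr_pMr// invf_lt1// ltr1n.
have [d1 d10 h1] := near_h l; have [d2 d20 h2] := near_h (w a).
have [r1 r10 k1] := wl _ d10; have [r2 r20 k2] := wr _ d20.
exists (Num.min r1 r2); first by rewrite lt_min r10.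
move=> t; rewrite lt_min !ltr_norml => /andP[/andP[t1 t2] /andP[t3 t4]].
case: ltP => ta; first by apply: h1; apply: k1; apply/andP; split; lra.
apply: h2; have := wn _ _ ta; have : w t <= w a + d2 by apply: k2; lra.
by move=> ? ?; rewrite ler_norml; apply/andP; split; lra.
Qed.

(** Wherever w jumps, no_jump forces h to take the same value at both ends of
    the jump, so that h o w has no discontinuity.  The base point 0 of the
    period requires a separate step function, with discontinuities at 0
    and pi. *)
Lemma finite_energy_continuous (h w : R -> R) (B : R) : continuous h -> (forall t, `|h t| <= B) ->
  (forall t, h (t + 2 * pi) = h t) -> degree_one w ->
  (forall t e, 0 < e -> exists2 d, 0 < d & forall s, s < t + d -> w s <= w t + e) ->
  let g := (fun t => h (w t)) in
  in_L2 (poisson1 g 0) -> in_L2 (poisson1 g 1) -> continuous g.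
Proof.
move=> ch hB hp [wn wp] wr /= L0 L1.
have bg := bounded_data_comp ch hB wn.
set g := (fun t => h (w t)) in L0 L1 bg *.
have gp t : g (t + 2 * pi) = g t by rewrite /g wp hp.
have main a : period a -> forall e, 0 < e -> exists2 d, 0 < d & forall t, `|t - a| < d -> `|g t - g a| <= e.
  move=> pa; have [a0 a2] : 0 <= a /\ a < 2 * pi by move: pa; rewrite /= in_itv/= => /andP.
  have [l hl] := one_sided_limits ch wn (wr a).
  suff E : h l = g a.
    by move=> e e0; have [d d0 hd] := hl e e0; exists d => // t /hd; rewrite E; case: ifP.
  (* At the base point the left neighbourhood of 0 is seen near 2 pi, so the
     step takes the value g 0 before pi and the left limit after it. *)
  have [az|az] := eqVneq a 0.
    apply/esym; apply: (@no_jump _ g pi (g a) (h l) 0 pi bg) => //.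
    - by apply/andP; split; lra.
    - by left.
    - by rewrite den_circ subr0 cospi; lra.
    - move=> e e0; have [d d0 hd] := hl e e0.
      have d1 : 0 < Num.min d (pi / 2) by rewrite lt_min d0 divr_gt0.
      have [|r r0 hr] := @near_circ _ a _ _ d1; first by [].
      rewrite az in hr; exists r => // t pt /(hr t pt)[s].
      move: pt; rewrite /= in_itv/= => /andP[t0 t2].
      rewrite lt_min => /andP[sd]; rewrite ltr_norml => /andP[s1 s2].
      rewrite az in hd; case=> ts.
      - have -> : t < pi by lra.
        have := hd t; rewrite subr0 ts add0r => /(_ sd); rewrite ifF ?az//.
        by apply/negbTE; rewrite -leNgt; lra.
      - have -> : (t < pi) = false by apply/negbTE; rewrite -leNgt; lra.
        rewrite ts add0r gp; have := hd s; rewrite subr0 => /(_ sd); rewrite ifT//; lra.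
      - lra.
  have a1 : 0 < a by rewrite lt_neqAle eq_sym az.
  apply: (@no_jump _ g a (h l) (g a) a 0 bg) => //.
  - by apply/andP; split; lra.
  - by right.
  - rewrite den_circ sub0r cosN subr_gt0 -subr_gt0.
    have -> : 2 - 2 * cos a = 2 * (1 - cos a) by ring.
    rewrite mulr_gt0// subr_gt0 lt_neqAle cos_le1 andbT.
    apply/negP => /eqP c1; have := cos2Dsin2 a; rewrite c1 expr1n => s0.
    have {}s0 : sin a = 0 by apply/eqP; rewrite -sqrf_eq0; apply/eqP; lra.
    have := @circ_inj _ a 0 pa; rewrite /circ c1 s0 cos0 sin0 => h0.
    have : a = 0 by apply: h0 => //; rewrite /= in_itv/= lexx mulr_gt0.
    by move/eqP; rewrite (negbTE az).
  - move=> e e0; have [d d0 hd] := hl e e0.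
    have d1 : 0 < Num.min d (Num.min a (2 * pi - a)) by rewrite !lt_min d0 a1 subr_gt0.
    have [|r r0 hr] := @near_circ _ a _ _ d1; first by [].
    exists r => // t pt /(hr t pt)[s].
    move: pt; rewrite /= in_itv/= => /andP[t0 t2].
    rewrite !lt_min => /and3P[sd]; rewrite !ltr_norml => /andP[s1 s2] /andP[s3 s4].
    case=> ts; try lra.
    by apply: hd; rewrite ts addrAC subrr add0r.
move=> a; apply/cvgrPdist_le => e e0; apply/nbhs_ballP.
have [b pb ab] : exists2 b, period b & exists m : int, a = b + 2 * pi * m%:~R.
  pose m := Num.floor (a / (2 * pi)).
  have p2 : 0 < 2 * pi :> R by rewrite mulr_gt0.
  exists (a - 2 * pi * m%:~R); last by exists m; rewrite subrK.
  rewrite /= in_itv/=; have /andP[m1 m2] := floor_itv (a / (2 * pi)).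
  apply/andP; split; first by rewrite subr_ge0 mulrC -ler_pdivlMr.
  by move: m2; rewrite ltr_pdivrMr// intrD -/m; lra.
have gz (m : int) t : g (t + 2 * pi * m%:~R) = g t.
  have gn (n : nat) s : g (s + 2 * pi * n%:R) = g s.
    rewrite /g (degree_one_nat _ _ (conj wn wp)); elim: n => [|n ih]; first by rewrite mulr0 addr0.
    have -> : w s + 2 * pi * n.+1%:R = w s + 2 * pi * n%:R + 2 * pi by rewrite -natr1; ring.
    by rewrite hp.
  case: m => n; first exact: gn.
  by rewrite NegzE mulrNz mulrN -{1}(gn n.+1 (t - _)) subrK.
have [m am] := ab; have [d d0 hd] := main b pb e e0.
exists d => // t /=; rewrite /ball/= => td.
rewrite am gz -(gz (- m) t) distrC; apply: hd.
by rewrite mulrNz mulrN distrC (_ : _ - _ = a - t)//; rewrite am; ring.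
Qed.

End Continuity.

(** * Boundary data on the lifted curves *)

Section BoundaryData.
Variable R : realType.
Local Notation plane := (R * R)%type.
Local Notation leb := (@lebesgue_measure R).
Local Notation D := (@disk R).
Local Notation period := ([set` `[0, 2 * pi[%R] : set R).

Lemma C1_disk_ext (f g : plane -> R) g1 : (forall x, disk x -> f x = g x) ->
  C1_disk g g1 -> C1_disk f g1.
Proof.
move=> fg C1 x xD; have [cg cg1 dg] := C1 x xD.
have nx : \forall y \near x, g y = f y.
  have : open_nbhs x D by split => //; exact: open_disk.
  by move/open_nbhs_nbhs; apply: filterS => y /fg.
split => // [|i]; last by apply: near_eq_is_derive (dg i).
have fx := fg x xD; rewrite /prop_for /continuous_at fx.
by apply: cvg_trans cg; apply: near_eq_cvg.
Qed.

Lemma C1_disk_unique (f : plane -> R) f1 g1 i x : C1_disk f f1 -> C1_disk f g1 -> disk x ->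
  f1 i x = g1 i x.
Proof.
move=> h1 h2 xD; have [_ _ /(_ i) d1] := h1 x xD; have [_ _ /(_ i) d2] := h2 x xD.
by rewrite -(@derive_val _ _ _ _ _ _ _ d1) (@derive_val _ _ _ _ _ _ _ d2).
Qed.

(** Countable sets are negligible, and the data are uniformly bounded on a set
    of finite measure. *)
Lemma dominated_data_cvg (g : nat -> R -> R) (g0 : R -> R) (N : set R) (B : R) :
  (forall j, bounded_data (g j)) -> bounded_data g0 ->
  (forall j t, period t -> `|g j t| <= B) -> (forall t, period t -> `|g0 t| <= B) ->
  countable N -> (forall t, ~ N t -> g j t @[j --> \oo] --> g0 t) ->
  \int[leb]_(t in period) `|g j t - g0 t| @[j --> \oo] --> (0 : R).
Proof.
move=> bg bg0 gB g0B cN gc.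
pose f j t := (`|g j t - g0 t|)%:E.
have mf j : measurable_fun period (f j).
  by apply/measurable_EFinP; have [] := bounded_data_norm (bounded_dataB (bg j) bg0).
have fc : {ae leb, forall t, period t -> f j t @[j --> \oo] --> 0%E}.
  exists N; split; first exact: countable_measurable.
    exact: countable_lebesgue_measure0.
  move=> t /= nt; apply: contrapT => Nt; apply: nt => _.
  apply: cvg_EFin; first exact: nearW.
  have c : g j t - g0 t @[j --> \oo] --> 0.
    by rewrite -(subrr (g0 t)); apply: cvgB; [exact: gc|exact: cvg_cst].
  have := cvg_norm c; rewrite normr0 => cn. exact: cn.
have iF : leb.-integrable period (EFin \o cst (2 * B)).
  exact: integrable_data (bounded_data_cst _).
have fF : {ae leb, forall t j, period t -> (`|f j t| <= (EFin \o cst (2 * B)%R) t)%E}.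
  apply: aeW => t j pt; rewrite /f /= lee_fin normr_id.
  apply: le_trans (ler_normB _ _) _; have := gB j t pt; have := g0B t pt; lra.
have [_ _ lim] := dominated_convergence measurable_period mf (measurable_cst _) fc iF fF.
rewrite integral0 in lim.
exact: (fine_cvg lim).
Qed.

Lemma lipschitz_circle (gamma : plane -> plane) : [lipschitz gamma p | p in @circle R] ->
  exists2 K, 0 <= K & forall s t, `|gamma (circ s) - gamma (circ t)| <= K * `|circ s - circ t|.
Proof.
move=> [K [_ hK]]; exists (`|K| + 1); first by rewrite ltW// ltr_wpDl.
move=> s t; have /(_ (circ s, circ t)) := hK (`|K| + 1) (le_lt_trans (ler_norm K) (ltr_pwDr ltr01 (lexx _))).
by apply; split => /=; rewrite /circle /= cos2Dsin2.
Qed.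

(** The Lipschitz hypothesis makes gamma continuous and bounded on the circle;
    the last two coordinates of the lifted curve are at most eps. *)
Lemma lifted_circ (gamma : plane -> plane) : [lipschitz gamma p | p in @circle R] ->
  exists B : R, [/\ forall eps k t, 0 <= eps <= 1 -> `|lifted gamma eps (circ t) 0 k| <= B,
    forall eps k t, 0 <= eps ->
      `|lifted gamma eps (circ t) 0 k - lifted gamma 0 (circ t) 0 k| <= eps &
    forall k, continuous (fun t => lifted gamma 0 (circ t) 0 k)].
Proof.
move=> gl; have [K K0 hK] := lipschitz_circle gl.
have cs1 t : `|(circ t).1| <= 1 /\ `|(circ t).2| <= 1 :> R.
  by rewrite /= !ler_norml cos_geN1 cos_le1 sin_geN1 sin_le1.
have cg : continuous (fun t => gamma (circ t)).
  move=> t; apply/cvgrPdist_le => e e0.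
  have e1 : 0 < e / (K + 1) by rewrite divr_gt0// ltr_wpDl.
  have := @continuous_circ _ t; move/cvgrPdist_le => /(_ _ e1); apply: filterS => s hs.
  apply: le_trans (hK _ _) _; apply: (@le_trans _ _ ((K + 1) * (e / (K + 1)))).
    by apply: ler_pM => //; rewrite lerDl.
  by rewrite mulrCA divff ?mulr1// gt_eqF// ltr_wpDl.
have circ2 t s : `|circ t - circ s| <= 2 :> R.
  have [a1 a2] := cs1 t; have [b1 b2] := cs1 s.
  rewrite [leLHS]prod_normE ge_max; apply/andP; split => /=.
    by apply: le_trans (ler_normB _ _) _; move: a1 b1; rewrite /=; lra.
  by apply: le_trans (ler_normB _ _) _; move: a2 b2; rewrite /=; lra.
exists (`|gamma (circ 0)| + K * 2 + 1); split.
- move=> eps k t /andP[e0 e1]; have [a1 a2] := cs1 t.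
  have gB : `|gamma (circ t)| <= `|gamma (circ 0)| + K * 2.
    rewrite -[gamma (circ t)](subrK (gamma (circ 0))) [leRHS]addrC.
    apply: le_trans (ler_normD _ _) _; rewrite lerD2r.
    by apply: le_trans (hK _ _) _; rewrite ler_wpM2l.
  have n1 := norm_fst_le (gamma (circ t)); have n2 := norm_snd_le (gamma (circ t)).
  have N0 := normr_ge0 (gamma (circ 0)).
  have em (a : R) : `|a| <= 1 -> `|eps * a| <= 1.
    by move=> a1'; rewrite normrM (ger0_norm e0) mulr_ile1.
  have := em _ a1; have := em _ a2 => h1 h2.
  by rewrite mxE; case: k => -[|[|[|[|//]]]] i /=; lra.
- move=> eps k t e0; have [a1 a2] := cs1 t; rewrite !mxE.
  have em (a : R) : `|a| <= 1 -> `|eps * a - 0 * a| <= eps.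
    by move=> a1'; rewrite mul0r subr0 normrM (ger0_norm e0) ler_piMr.
  by case: k => -[|[|[|[|//]]]] i /=; rewrite ?subrr ?normr0//; apply: em.
- move=> k; have -> : (fun t => lifted gamma 0 (circ t) 0 k) =
      (fun t => [:: (gamma (circ t)).1; (gamma (circ t)).2; 0; 0]`_k).
    by apply/funext => t; rewrite mxE !mul0r.
  case: k => -[|[|[|[|//]]]] i /= t.
  + by apply: cvg_comp (cg t) _; exact: cvg_fst.
  + by apply: cvg_comp (cg t) _; exact: cvg_snd.
  + exact: cvg_cst.
  + exact: cvg_cst.
Qed.

End BoundaryData.

(** * Convergence of the minimizers *)

Section Assembly.
Variable R : realType.
Local Notation plane := (R * R)%type.
Local Notation mplane := (measurableTypeR R * measurableTypeR R)%type.
Local Notation space := 'rV[R]_4.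
Local Notation mu := (@area_measure R).
Local Notation D := (@disk R).

(** The Poisson formula holds for each coordinate; the formula for the gradient
    follows by differentiation inside the disk. *)
Lemma harmonic_trace (u : plane -> space) k : harmonic_on_disk u ->
  {within @cdisk R, continuous u} ->
  let g := (fun t => u (circ t) 0 k) in
  [/\ bounded_data g, forall x, disk x -> u x 0 k = poisson g x &
      forall i x, disk x -> ucoord1 u k i x = poisson1 g i x].
Proof.
move=> hu cu /=; have [C1 tw lap] := harmonic_coord k hu.
have [bg rep] := poisson_representation (@within_coord _ _ _ k cu) tw lap.
split => // i x xD; apply: (C1_disk_unique i C1) => //.
by apply: C1_disk_ext (poisson_C1 bg) => y yD; exact: rep.
Qed.

Lemma compact_in_disk (K : set plane) : compact K -> K `<=` D ->
  exists2 r : R, r < 1 & forall x, K x -> sqn x <= r.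
Proof.
move=> cK KD.
have cf x : K x -> {for x, continuous (fun x : plane => (1 - sqn x)^-1)}.
  move=> /KD xD; have x1 : sqn x < 1 by exact: xD.
  apply: cvgV; first by rewrite subr_eq0 gt_eqF.
  by apply: cvgB; [exact: cvg_cst|exact: sqn_continuous].
have [M M0 hM] := compact_bound cK cf.
have M1 : 0 < M + 1 by rewrite ltr_wpDl.
exists (1 - (M + 1)^-1); first by rewrite gtrBl invr_gt0.
move=> x Kx; have x1 : sqn x < 1 by exact: (KD x Kx).
have q0 : 0 < 1 - sqn x by rewrite subr_gt0.
have h : (1 - sqn x)^-1 <= M by apply: le_trans (ler_norm _) (hM x Kx).
have : (M + 1)^-1 <= 1 - sqn x.
  rewrite -[leRHS]invrK lef_pV2 ?posrE ?invr_gt0//.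
  by apply: le_trans h _; rewrite lerDl.
lra.
Qed.

Lemma uniform_cvg_coord (K : set plane) (f : nat -> plane -> space) (f0 : plane -> space) :
  (forall k (e : R), 0 < e -> \forall j \near \oo, forall x, K x ->
    `|f j x 0 k - f0 x 0 k| <= e) ->
  {uniform K, f @ \oo --> f0}.
Proof.
move=> fu P /uniform_nbhs[E [entE subP]]; apply: filterS subP _.
move: entE; rewrite -entourage_ballE => -[e /= e0 he].
have e2 : 0 < e / 2 by rewrite divr_gt0.
have : \forall j \near \oo, forall k x, K x -> `|f j x 0 k - f0 x 0 k| <= e / 2.
  by apply: filter_forall => k; exact: fu.
apply: filterS => j hj x Kx; apply: he; split => // i k; rewrite ord1 /ball /=.
rewrite distrC; apply: le_lt_trans (hj k x Kx) _.
by rewrite gtr_pMr// invf_lt1// ltr1n.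
Qed.

(** Bounded pointwise convergence on a set of finite measure. *)
Lemma L2_cvg_coord (f : nat -> plane -> space) (f0 : plane -> space) (B : R) :
  (forall j k, measurable_fun (D : set mplane) (fun x : mplane => f j x 0 k : measurableTypeR R)) ->
  (forall k, measurable_fun (D : set mplane) (fun x : mplane => f0 x 0 k : measurableTypeR R)) ->
  (forall j k x, D x -> `|f j x 0 k| <= B) -> (forall k x, D x -> `|f0 x 0 k| <= B) ->
  (forall k x, D x -> f j x 0 k @[j --> \oo] --> f0 x 0 k) ->
  L2_cvg f f0.
Proof.
move=> mf mf0 fB f0B fc.
have E j x : sqnorm (f j x - f0 x) = \sum_k (f j x 0 k - f0 x 0 k) ^+ 2.
  by rewrite sqnormE; apply: eq_bigr => k _; rewrite !mxE.
pose h j x := (sqnorm (f j x - f0 x))%:E.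
have mh j : measurable_fun (D : set mplane) (h j : mplane -> \bar R).
  apply/measurable_EFinP; rewrite (_ : (fun x => _) = (fun x => sqnorm (f j x - f0 x)))//.
  apply: measurable_sqnorm => k.
  rewrite (_ : (fun x => _) = (fun x => f j x 0 k - f0 x 0 k)).
    by apply: measurable_funB; [exact: mf|exact: mf0].
  by apply/funext => x; rewrite !mxE.
have hc : {ae mu, forall x, D x -> h j x @[j --> \oo] --> 0%E}.
  apply: aeW => x xD; apply: cvg_EFin; first exact: nearW.
  have ck k : (f j x 0 k - f0 x 0 k) ^+ 2 @[j --> \oo] --> 0.
    have c1 : f j x 0 k - f0 x 0 k @[j --> \oo] --> 0.
      by rewrite -(subrr (f0 x 0 k)); apply: cvgB; [exact: fc|exact: cvg_cst].
    by under eq_fun do rewrite expr2; rewrite -(mulr0 0); apply: cvgM.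
  have c : \sum_k (f j x 0 k - f0 x 0 k) ^+ 2 @[j --> \oo] --> 0.
    elim: (index_enum _) => [|k s ih].
      by under eq_fun do rewrite big_nil; exact: cvg_cst.
    have := cvgD (ck k) ih; rewrite addr0 => cs; under eq_fun do rewrite big_cons; exact: cs.
  rewrite (_ : fine \o _ = (fun j => \sum_k (f j x 0 k - f0 x 0 k) ^+ 2))//.
  by apply/funext => j /=; rewrite E.
pose C := 4 * (2 * B) ^+ 2.
have iC : mu.-integrable D (EFin \o cst C).
  by apply: bounded_integrable_disk => //; exists `|C|.
have hC : {ae mu, forall x j, D x -> (`|h j x| <= (EFin \o cst C) x)%E}.
  apply: aeW => x j xD; rewrite /h /= lee_fin ger0_norm ?sqnorm_ge0// E.
  apply: (@le_trans _ _ (\sum_(k < 4) (2 * B) ^+ 2)); last by rewrite sumr_const card_ord /C -[leLHS]mulr_natl.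
  apply: ler_sum => k _; have := fB j k x xD; have := f0B k x xD.
  rewrite -[_ ^+ 2]real_normK ?num_real// => h1 h2.
  rewrite ler_pXn2r ?nnegrE//.
    by apply: le_trans (ler_normB _ _) _; lra.
  by have := normr_ge0 (f0 x 0 k); lra.
have [_ _ lim] := dominated_convergence (@measurable_disk R) mh (measurable_cst _) hc iC hC.
by rewrite integral0 in lim.
Qed.

(** The differences f j - f0 satisfy the hypotheses of weak_cvg0, and L is
    linear. *)
Lemma weak_cvg_jets (f : nat -> plane -> space) F (f0 : plane -> space) F0 (M : R) :
  (forall j, W12_grad (f j) (F j)) -> W12_grad f0 F0 ->
  (forall j p, \int[mu]_(x in D) (jet (f j) (F j) p x ^+ 2) <= M) ->
  (forall p (r e : R), r < 1 -> 0 < e -> \forall j \near \oo, forall x, sqn x <= r ->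
    `|jet (f j) (F j) p x - jet f0 F0 p x| <= e) ->
  W12_weak_cvg f f0.
Proof.
move=> Wf W0 fM fu L [Llin Lb].
(* The difference f j - f0, in the form in which a functional is linear. *)
pose h j := (fun x => (-1) *: f0 x + f j x : space).
pose H j := (fun i x => (-1) *: F0 i x + F j i x : space).
have Wh j : W12_grad (h j) (H j) by exact: W12_gradD.
have jetE j p x : jet (h j) (H j) p x = jet (f j) (F j) p x - jet f0 F0 p x.
  by rewrite /jet; case: unliftP => [i _|_]; rewrite !mxE addrC mulN1r.
have [N hN] : exists N, forall p, \int[mu]_(x in D) (jet f0 F0 p x ^+ 2) <= N.
  exists (\sum_p \int[mu]_(x in D) (jet f0 F0 p x ^+ 2)) => p.
  rewrite (bigD1 p)//= lerDl sumr_ge0// => q _; apply: Rintegral_ge0 => x _; exact: sqr_ge0.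
have mD := @measurable_disk R.
have c0 : L (h j) @[j --> \oo] --> 0.
  apply: (@weak_cvg0 _ L h H (2 * M + 2 * N)) => //.
  - move=> j p; have i1 := integrableZl mD 2 (in_L2_sqr (jet_in_L2 p (Wf j))).
    have i2 := integrableZl mD 2 (in_L2_sqr (jet_in_L2 p W0)).
    apply: (@le_trans _ _ (\int[mu]_(x in D) (2 * jet (f j) (F j) p x ^+ 2 + 2 * jet f0 F0 p x ^+ 2))).
      apply: le_Rintegral => //.
      + exact: in_L2_sqr (jet_in_L2 p (Wh j)).
      + by have := integrableD mD i1 i2; apply: eq_integrable.
      + move=> x _; rewrite jetE; have := sqr_ge0 (jet (f j) (F j) p x + jet f0 F0 p x); nra.
    rewrite RintegralD// !RintegralZl//; try exact: in_L2_sqr (jet_in_L2 p _).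
    by have := fM j p; have := hN p; lra.
  - move=> p r e r1 e0; have := fu p r e r1 e0; apply: filterS => j hj x xr.
    by rewrite jetE hj.
have hE : (fun j => L (f j)) = (fun j => L (h j) + L f0).
  apply/funext => j; rewrite /h Llin; [ring|by exists F0|by exists (F j)].
rewrite hE -[X in _ --> X]add0r; apply: cvgD c0 _; exact: cvg_cst.
Qed.

End Assembly.

Section LimitTrace.
Variable R : realType.

(** The orientation s decides whether the angle function increases or
    decreases; its oscillation over a period is at most 2 pi by degree one. *)
Lemma monotone_param_of_lift (s : R) (w : R -> R) : (s = 1 \/ s = -1) -> degree_one w ->
  monotone_param (fun p => circ (s * w (angle p))).
Proof.
move=> s1 [wn wp]; exists (fun t => s * w t); split.
- case: s1 => ->; [left|right] => a b _ _ ab; first by rewrite !mul1r wn.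
  by rewrite !mulN1r lerN2 wn.
- have [a ha] : exists a, forall t, t \in `[0, 2 * pi[ -> a <= s * w t <= a + 2 * pi.
    have bw t : t \in `[0, 2 * pi[ -> w 0 <= w t <= w 0 + 2 * pi.
      rewrite in_itv/= => /andP[t0 t2]; rewrite wn//= -wp add0r wn// ltW//.
    exists (if s == 1 then w 0 else - w 0 - 2 * pi) => t /bw /andP[b1 b2].
    case: s1 => ->; first by rewrite eqxx; apply/andP; split; lra.
    by rewrite ifF; [apply/andP; split; lra|apply/negbTE/eqP; lra].
  have h1 : (ereal_sup (angle_values (fun t => s * w t)%R) <= (a + 2 * pi)%:E)%E.
    by apply: ge_ereal_sup => _ [t /= /ha/andP[_ h] <-]; rewrite lee_fin.
  have h2 : (a%:E <= ereal_inf (angle_values (fun t => s * w t)%R))%E.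
    by apply: le_ereal_inf_tmp => _ [t /= /ha/andP[h _] <-]; rewrite lee_fin.
  apply: (@le_trans _ _ ((a + 2 * pi)%:E - a%:E)%E); first exact: leeB.
  by rewrite -EFinB lee_fin addrAC subrr add0r.
- by move=> t pt; rewrite angle_circ.
Qed.

End LimitTrace.

Theorem theorem3p4 (R : realType) (gamma : R * R -> R * R)
    (gamma_lip : [lipschitz gamma p | p in @circle R])
    (theta tau : 'I_3 -> R) (pts : three_points gamma theta tau)
    (u : R -> R * R -> 'rV[R]_4)
    (u_min : forall eps : R, 0 < eps <= 1 ->
       douglas_minimizer (lifted gamma eps) (u eps))
    (u_norm : forall eps : R, 0 < eps <= 1 -> forall k : 'I_3,
       u eps (circ (theta k)) = lifted gamma eps (circ (tau k))) :
  exists (eps : nat -> R) (u0 : R * R -> 'rV[R]_4),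
    [/\ forall j, 0 < eps j <= 1, decreasing_seq eps &
        eps j @[j --> \oo] --> (0 : R)] /\
    W12 u0 /\ {within @cdisk R, continuous u0} /\
    W12_weak_cvg (fun j => u (eps j)) u0 /\
    L2_cvg (fun j => u (eps j)) u0 /\
    (forall K : set (R * R), compact K -> K `<=` @disk R ->
       {uniform K, (fun j => u (eps j)) @ \oo --> u0}) /\
    exists phi0 : R * R -> R * R,
      monotone_param phi0 /\
      forall p, circle p -> u0 p = lifted gamma 0 (phi0 p).
Proof.
pose e (n : nat) : R := n.+1%:R^-1.
have e01 n : 0 < e n <= 1 by rewrite /e invr_gt0 ltr0n /= invf_le1 ?ltr0n// ler1n.
have lifts n : exists q : R * (R -> R), [/\ q.1 = 1 \/ q.1 = -1, degree_one q.2,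
    0 <= q.2 0 < 2 * pi & forall t, u (e n) (circ t) = lifted gamma (e n) (circ (q.1 * q.2 t))].
  have [[_ _ [phi [_ _ mphi uphi]]] _ _ _] := u_min _ (e01 n).
  have [sg [W [sg1 dW W0 phiW]]] := monotone_param_lift mphi.
  exists (sg, W); split => // t; rewrite uphi ?phiW//.
  by rewrite /circle /= cos2Dsin2.
have [P HP] := choice lifts.
have [f [s [w [fi [s1 sgc] dw wr wl]]]] := @helly R (fun n => (P n).1) (fun n => (P n).2)
  (fun n => let: And4 h _ _ _ := HP n in h) (fun n => let: And4 _ h _ _ := HP n in h)
  (fun n => let: And4 _ _ h _ := HP n in h).
have [wn wp] := dw.
pose eps j := e (f j).
have eps01 j : 0 < eps j <= 1 by exact: e01.
have eps0 : eps j @[j --> \oo] --> (0 : R).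
  apply/cvgrPdist_le => d d0; have := near_infty_natSinv_lt (PosNum d0).
  apply: filterS => j /= /ltW jd; rewrite sub0r normrN ger0_norm; last by have /andP[/ltW] := eps01 j.
  by apply: le_trans jd; rewrite /eps /e lef_pV2 ?posrE ?ltr0n// ler_nat ltnS increasing_ge_id.
have [B [hB hclose hcont]] := lifted_circ gamma_lip.
(* h k o w is the limit of the k-th components of the traces. *)
pose h k (t : R) := lifted gamma 0 (circ (s * t)) 0 k.
have hc k : continuous (h k).
  move=> t; apply: (@continuous_comp _ _ _ (fun t : R => s * t) (fun t => lifted gamma 0 (circ t) 0 k)).
    by apply: cvgM; [exact: cvg_cst|exact: cvg_id].
  exact: hcont.
have hbd k t : `|h k t| <= B by apply: hB; rewrite lexx ler01.
have hp k t : h k (t + 2 * pi) = h k t.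
  rewrite /h mulrDr; case: s1 => ->; first by rewrite !mul1r circ_periodic.
  by rewrite !mulN1r -[in RHS](subrK (2 * pi) (- t)) circ_periodic.
pose g0 k (t : R) := h k (w t).
pose g j k (t : R) := u (eps j) (circ t) 0 k.
have bg0 k : bounded_data (g0 k) := bounded_data_comp (hc k) (hbd k) wn.
have tr j k : [/\ bounded_data (g j k), forall x, disk x -> u (eps j) x 0 k = poisson (g j k) x &
      forall i x, disk x -> ucoord1 (u (eps j)) k i x = poisson1 (g j k) i x].
  have [[cu _ _] hu _ _] := u_min _ (eps01 j); exact: harmonic_trace.
have bg j k : bounded_data (g j k) by have [] := tr j k.
have gE j k t : g j k t = lifted gamma (eps j) (circ ((P (f j)).1 * (P (f j)).2 t)) 0 k.
  by rewrite /g; have [_ _ _ ->] := HP (f j).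
have gB j k t : `|g j k t| <= B.
  by rewrite gE; apply: hB; have /andP[/ltW -> ->] := eps01 j.
have gL1 k : \int[@lebesgue_measure R]_(t in [set` `[0, 2 * pi[%R]) `|g j k t - g0 k t| @[j --> \oo] --> (0 : R).
  apply: (dominated_data_cvg (N := [set t | ~ left_continuous_at w t]) (B := B)) => //.
  - by move=> t _; exact: hbd.
  - exact: countable_left_jumps.
  move=> t /contrapT lt.
  have c1 : (P (f j)).1 * (P (f j)).2 t @[j --> \oo] --> s * w t by apply: cvgM => //; exact: wl.
  have c2 : lifted gamma 0 (circ ((P (f j)).1 * (P (f j)).2 t)) 0 k @[j --> \oo] --> g0 k t.
    exact: (cvg_comp _ _ c1 (hcont k _)).
  apply/cvgrPdist_le => d d0; have d2 : 0 < d / 2 by rewrite divr_gt0.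
  move/cvgrPdist_le : c2 => /(_ _ d2); move/cvgrPdist_le : eps0 => /(_ _ d2).
  apply: filterS2 => j h1 h2.
  have := hclose (eps j) k ((P (f j)).1 * (P (f j)).2 t); rewrite -gE.
  have /andP[/ltW ej _] := eps01 j => /(_ ej) h3.
  move: h1; rewrite sub0r normrN ger0_norm// => h1.
  by move: h2 h3; rewrite !ler_norml => /andP[? ?] /andP[? ?]; apply/andP; split; lra.
(* Fatou's lemma gives the limit finite energy, hence a continuous trace. *)
have [M hM] := energy_bound u_min.
have en j k i : (\int[@area_measure R]_(x in @disk R) (poisson1 (g j k) i x ^+ 2)%:E <= M%:E)%E.
  apply: le_trans (hM _ (eps01 j) k i); rewrite le_eqVlt; apply/orP; left; apply/eqP.
  by apply: eq_integral => x; rewrite inE => xD; have [_ _ ->] := tr j k.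
have L0 k i : in_L2 (poisson1 (g0 k) i).
  by have [] := poisson1_energy (fun j => bg j k) (bg0 k) (gL1 k) (fun j => en j k i).
have g0c k : continuous (g0 k) := finite_energy_continuous (hc k) (hbd k) (hp k) dw wr (L0 k 0) (L0 k 1).
have g0p k t : g0 k (t + 2 * pi) = g0 k t by rewrite /g0 wp hp.
pose u0 (x : R * R) : 'rV[R]_4 := \row_k pext (g0 k) x.
pose U0 (i : 'I_2) (x : R * R) : 'rV[R]_4 := \row_k poisson1 (g0 k) i x.
have u0D k x : disk x -> u0 x 0 k = poisson (g0 k) x.
  by move=> xD; rewrite mxE /pext ifT.
have C10 k : C1_disk (fun x => u0 x 0 k) (fun i x => U0 i x 0 k).
  apply: (C1_disk_ext (u0D k)).
  rewrite (_ : (fun i x => _) = poisson1 (g0 k)); first exact: poisson_C1.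
  by apply/funext => i; apply/funext => x; rewrite mxE.
have u0B k x : disk x -> `|u0 x 0 k| <= B.
  by move=> xD; rewrite u0D//; apply: poisson_le => // t _; exact: hbd.
have uB j k x : disk x -> `|u (eps j) x 0 k| <= B.
  by move=> xD; have [_ H _] := tr j k; rewrite (H x xD); apply: poisson_le => // t _; exact: gB.
have mu0 k := (C1_disk_measurable (C10 k)).1.
have W0 : W12_grad u0 U0.
  apply: W12_grad_C1 => // [k|k i]; first exact: bounded_in_L2 (mu0 k) (u0B k).
  by rewrite (_ : (fun x => _) = poisson1 (g0 k) i)//; apply/funext => x; rewrite mxE.
pose Du j i x := 'D_(axis R i) (u (eps j)) x.
have Wu j : W12_grad (u (eps j)) (Du j).
  by have [[_ W _] hu _ _] := u_min _ (eps01 j); exact: harmonic_W12_grad.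
have mu j k : measurable_fun (@disk R : set (measurableTypeR R * measurableTypeR R))
    ((fun x => u (eps j) x 0 k) : (measurableTypeR R * measurableTypeR R)%type -> measurableTypeR R).
  by have [L _] := Wu j k; have /in_L2P[] := L.
have unif k (r d : R) : r < 1 -> 0 < d -> \forall j \near \oo, forall x, sqn x <= r ->
    `|u (eps j) x 0 k - u0 x 0 k| <= d.
  move=> r1 d0; have := poisson_unif (fun j => bg j k) (bg0 k) (gL1 k) r1 d0.
  apply: filterS => j hj x xr; have xD : disk x := le_lt_trans xr r1.
  have [_ H _] := tr j k; rewrite (u0D k x xD) (H x xD); exact: hj.
exists eps, u0; split; [split => //|split; [|split; [|split; [|split; [|split]]]]].
- by move=> n m; rewrite /eps /e lef_pV2 ?posrE ?ltr0n// ler_nat ltnS; exact: fi.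
- by exists U0.
- apply: continuous_within_row => k.
  rewrite (_ : (fun x => _) = pext (g0 k)); first exact: pext_continuous.
  by apply/funext => x; rewrite mxE.
- apply: (weak_cvg_jets (M := Num.max (B ^+ 2 * fine (@area_measure R (@disk R))) M) Wu W0).
  + move=> j [i k]; rewrite /jet /=; case: unliftP => [i' _|_] /=.
      apply: (@le_trans _ _ M); last by rewrite le_max lexx orbT.
      have fineM (z : \bar R) : (0 <= z)%E -> (z <= M%:E)%E -> fine z <= M.
        by case: z => //= z _; rewrite lee_fin.
      by apply: fineM (hM _ (eps01 j) k i'); apply: integral_ge0 => x _; rewrite lee_fin sqr_ge0.
    apply: (@le_trans _ _ (B ^+ 2 * fine (@area_measure R (@disk R)))); last by rewrite le_max lexx.
    rewrite -Rintegral_cst; [|exact: measurable_disk].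
    have [Lu _] := Wu j k.
    apply: le_Rintegral; [exact: measurable_disk|exact: in_L2_sqr| |].
      by apply: bounded_integrable_disk => //; exists `|B ^+ 2|.
    move=> x xD; rewrite -[_ ^+ 2]real_normK ?num_real//.
    by rewrite ler_pXn2r ?nnegrE// ?(le_trans _ (uB j k x xD))// uB.
  + move=> [i k] r d r1 d0; rewrite /jet /=; case: unliftP => [i' _|_] /=; last exact: unif.
    have := poisson1_unif (fun j => bg j k) (bg0 k) (gL1 k) i' r1 d0.
    apply: filterS => j hj x xr; have xD : disk x := le_lt_trans xr r1.
    rewrite mxE; have [_ _ H] := tr j k.
    by have := H i' x xD; rewrite /ucoord1 /Du => ->; exact: hj.
- apply: (L2_cvg_coord (B := B)) => // k x xD.
  apply/cvgrPdist_le => d d0; have := unif k _ d xD d0.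
  by apply: filterS => j /(_ x (lexx _)); rewrite distrC.
- move=> K cK KD; have [r r1 Kr] := compact_in_disk cK KD.
  apply: uniform_cvg_coord => k d d0; have := unif k r d r1 d0.
  by apply: filterS => j hj x /Kr; exact: hj.
- exists (fun p => circ (s * w (angle p))); split; first exact: monotone_param_of_lift.
  move=> p p1; apply/rowP => k; rewrite mxE /pext ifF//.
  by have -> : sqn p = 1; [exact: p1|rewrite ltxx].
Qed.
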